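(* Over $\mathbb{C}$, the dual variety $(\sigma_3(Gr(\mathbb{P}^2,\mathbb{P}^7)))^{\vee}$ is $\sigma_2(Gr(\mathbb{P}^2,\mathbb{P}^7))$ (the latter taken inside the dual projective space, via an identification $(\mathbb{C}^8)^*\cong\mathbb{C}^8$), and the Grassmannian $Gr(\mathbb{P}^2,\mathbb{P}^7)$ is $3$-weakly defective with a contact locus of dimension $7$.
   Context: All varieties are over $\mathbb{C}$. $Gr(\mathbb{P}^2,\mathbb{P}^7)\subset\mathbb{P}(\bigwedge^{3}\mathbb{C}^{8})=\mathbb{P}^{55}$ is the Grassmannian of planes of $\mathbb{P}^7$ in its Plücker embedding, i.e. the set of projective classes of nonzero decomposable skew-symmetric tensors $v_1\wedge v_2\wedge v_3$. For a reduced irreducible projective variety $X\subset\mathbb{P}^N$, the $r$-secant variety $\sigma_r(X)$ is the Zariski closure of the set of points lying in the linear span of $r$ points of $X$. If $\sigma_r(X)\subsetneq\langle X\rangle$ (with $\langle X\rangle$ the linear span of $X$), take $r$ general points $t_1,\dots,t_r\in X$ and a general hyperplane section $H$ of $X$ tangent to $X$ at $t_1,\dots,t_r$. The contact locus of $H$ (also called the contact locus of $\sigma_r(X)$) is the union of the irreducible components of $\mathrm{Sing}(H)$ containing $t_1,\dots,t_r$. $X$ is $r$-weakly defective if this contact locus has positive dimension. $Y^\vee$ denotes the projective dual variety of $Y\subset\mathbb{P}^N$: the closure in the dual projective space of the set of hyperplanes tangent to $Y$ at some smooth point. *)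

(* Defs.v *)
From mathcomp Require Import all_boot all_order all_algebra.
From mathcomp Require Import classical_sets reals.
From mathcomp Require Import complex.
From mathcomp Require Import mpoly.

Set Implicit Arguments.
Unset Strict Implicit.
Unset Printing Implicit Defensive.

Import GRing.Theory.

Local Open Scope classical_set_scope.
Local Open Scope ring_scope.

(* Points of P^(n-1) are given by homogeneous coordinates: a subset of P^(n-1) *)
(* is a scaling-invariant set of nonzero vectors of K^n.                       *)
Section ProjectiveGeometry.
Variables (K : fieldType) (n : nat).
Implicit Types (X Z : set 'rV[K]_n) (x v h : 'rV[K]_n) (p : {mpoly K[n]}).

Definition vanishes p X := forall x, X x -> p.@[x 0] = 0.

Definition homogeneous p := exists d, p \is d.-homog.

Definition proj_closed Z :=
  exists2 S : set {mpoly K[n]}, S `<=` homogeneous &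
    Z = [set x : 'rV[K]_n | x != 0 /\ forall p, S p -> p.@[x 0] = 0].

Definition proj_closure X : set 'rV[K]_n :=
  [set x : 'rV[K]_n | x != 0 /\
    forall p, homogeneous p -> vanishes p X -> p.@[x 0] = 0].

Definition irreducible_closed Z :=
  [/\ proj_closed Z, Z !=set0 &
      forall A B, proj_closed A -> proj_closed B ->
        Z `<=` A `|` B -> Z `<=` A \/ Z `<=` B].

Definition irreducible_component Z C :=
  [/\ irreducible_closed C, C `<=` Z &
      forall D, irreducible_closed D -> D `<=` Z -> C `<=` D -> D = C].

Definition irreducible_chain Z d :=
  exists c : nat -> set 'rV[K]_n,
    (forall i, (i <= d)%N -> irreducible_closed (c i) /\ c i `<=` Z) /\
    (forall i, (i < d)%N -> c i `<` c i.+1).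

(* Krull dimension, as a projective variety, of a closed set Z. *)
Definition has_dim Z d := irreducible_chain Z d /\ ~ irreducible_chain Z d.+1.

Definition linear_span X : set 'rV[K]_n :=
  [set x : 'rV[K]_n | x != 0 /\
    exists r (t : 'M[K]_(r, n)), (forall i, X (row i t)) /\ (x <= t)%MS].

Definition secant_variety r X : set 'rV[K]_n :=
  proj_closure [set x : 'rV[K]_n | x != 0 /\
    exists t : 'M[K]_(r, n), (forall i, X (row i t)) /\ (x <= t)%MS].

(* The linear subspace of K^n whose projectivization is the embedded tangent   *)
(* space of X at x; at a smooth point its dimension is dim X + 1.              *)
Definition tangent_space X x : set 'rV[K]_n :=
  [set v : 'rV[K]_n | forall p, homogeneous p -> vanishes p X ->
     \sum_(i < n) (p^`M(i)).@[x 0] * v 0 i = 0].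

(* For irreducible X. *)
Definition smooth_point X x :=
  X x /\ exists d, has_dim X d /\
    exists U : {vspace 'rV[K]_n},
      \dim U = d.+1 /\ tangent_space X x = [set v : 'rV[K]_n | v \in U].

(* A hyperplane of P^(n-1) is given by the coefficients h of its equation, so  *)
(* the coordinates on the dual space are dual to those of K^n.                 *)
Definition on_hyperplane h x := \sum_(i < n) h 0 i * x 0 i = 0.

Definition tangent_at X h x :=
  forall v, tangent_space X x v -> on_hyperplane h v.

Definition dual_variety X : set 'rV[K]_n :=
  proj_closure [set h : 'rV[K]_n | h != 0 /\
    exists x, smooth_point X x /\ tangent_at X h x].

(* Singular points of the divisor cut on X by h: at a smooth point x of X the  *)
(* local equation lies in the square of the maximal ideal iff h contains the   *)
(* tangent space of X at x.                                                    *)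
Definition sing_section X h : set 'rV[K]_n :=
  [set x : 'rV[K]_n | [/\ X x, on_hyperplane h x &
     smooth_point X x -> tangent_at X h x]].

Definition contact_locus r X h (t : 'M[K]_(r, n)) : set 'rV[K]_n :=
  [set x : 'rV[K]_n | exists C, [/\ irreducible_component (sing_section X h) C,
                         exists i, C (row i t) & C x]].

End ProjectiveGeometry.

(* P holds at the general point of Y, for Y an irreducible set of tuples of    *)
(* homogeneous coordinate vectors (one per row): P holds on a nonempty open    *)
(* subset of Y. As the P used below do not depend on the scaling of each row,  *)
(* F need not be multihomogeneous: it can be replaced by one of its            *)
(* multihomogeneous components.                                                *)
Definition generally (K : fieldType) m n (Y P : set 'M[K]_(m, n)) :=
  exists F : {mpoly K[m * n]},
    (exists2 t, Y t & F.@[mxvec t 0] != 0) /\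
    (forall t, Y t -> F.@[mxvec t 0] != 0 -> P t).

Section WeakDefectivity.
Variables (K : fieldType) (n : nat).
Implicit Types (X Z : set 'rV[K]_n).

Definition tangent_hyperplanes r X (t : 'M[K]_(r, n)) : set 'rV[K]_n :=
  [set h : 'rV[K]_n | h != 0 /\ forall i, tangent_at X h (row i t)].

(* P holds for the contact locus of a general hyperplane section tangent to X  *)
(* at r general points.                                                        *)
Definition general_contact_locus r X (P : set 'rV[K]_n -> Prop) :=
  generally [set t : 'M[K]_(r, n) | forall i, X (row i t)]
    [set t : 'M[K]_(r, n) | generally (tangent_hyperplanes X t)
               [set h : 'rV[K]_n | P (contact_locus X h t)]].

Definition weakly_defective r X :=
  secant_variety r X `<` linear_span X /\
  general_contact_locus r X (fun Z => exists d, (0 < d)%N /\ has_dim Z d).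

End WeakDefectivity.

Definition increasing k n :=
  [pred t : k.-tuple 'I_n | sorted ltn [seq val i | i <- t]].

Definition pluecker_dim k n := #|increasing k n|.

(* The exterior product of the rows of A, in the basis of the exterior power   *)
(* of K^n formed by the products of the standard basis vectors.                *)
Definition wedge (K : fieldType) k n (A : 'M[K]_(k, n)) :
    'rV[K]_(pluecker_dim k n) :=
  \row_(s < pluecker_dim k n) \det (colsub (tnth (enum_val s)) A).

(* Gr(P^(k-1), P^(n-1)). By the Cauchy-Binet formula, the hyperplane with      *)
(* coefficients wedge A is the class of the product of the linear forms on K^n *)
(* whose coefficients are the rows of A, so that the coordinates on the dual   *)
(* space identify K^n with its dual through the standard basis.                *)
Definition grassmannian (K : fieldType) k n : set 'rV[K]_(pluecker_dim k n) :=
  [set w : 'rV[K]_(pluecker_dim k n) | w != 0 /\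
    exists A : 'M[K]_(k, n), w = wedge A].
Arguments grassmannian : clear implicits.

(* Main.v *)
From HB Require Import structures.
Require Import Defs.
From mathcomp Require Import all_boot all_order all_algebra fingroup perm.
From mathcomp Require Import boolp classical_sets reals.
From mathcomp Require Import complex.
From mathcomp Require Import mpoly ring zify.

(** The group GL_8 acts on the triples of points of the Grassmannian G of planes
    in the projective space of dimension 7, and it has a dense orbit
    ([general_triple]): the third of three general planes meets the join of the
    other two in one point, and adapted bases bring the planes to the position
    <e0, e1, e2>, <e3, e4, e5>, <e0 + e3, e6, e7> of the base triple. Points of G
    and hyperplanes are both acted upon by third compound matrices, which are
    compatible with the pairing, so that it suffices to study the base triple.

    A hyperplane is an alternating trilinear form. By the lemma of Terracini
    ([tangent_secant], [secant3_base]) it is tangent to the third secant variety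
    at the sum of three general decomposable tensors if and only if it is tangent
    to G at the three planes. For the base triple this leaves free the
    coefficients of a 2 x 2 x 2 tensor on <e1, e2>, <e4, e5> and <e6, e7>
    ([tang_base_eq0]). A general such tensor is the sum of two decomposable ones
    ([tensor222]), hence the alternating form is the sum of two decomposable forms
    with independent factors: the general tangent hyperplanes all lie in the orbit
    of e0 ^ e1 ^ e2 + e3 ^ e4 ^ e5 ([conormal_split]). This orbit is dense in the
    second secant variety, which gives both inclusions between the dual variety
    and that secant variety ([dual_secant3_sub], [sub_dual_secant3]).

    The form e0 ^ e1 ^ e2 + e3 ^ e4 ^ e5 is tangent to G at the span of a 3 x 8
    matrix A if and only if each of the first two 3 x 3 blocks of A has rank at
    most one ([tang_split_form]). The matrices of this kind are parametrized by a
    rational variety, so that the singular locus of the section is closed and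
    irreducible and coincides with the contact locus ([contact_locusE]); its
    normal form under row operations has 7 free entries ([tangency_locus_dim]).

    Dimensions are lengths of chains of irreducible closed sets. A chain of length
    d gives d + 1 algebraically independent forms ([chain_indep]), while a variety
    parametrized by m parameters has at most m + 1 of them ([param_indep_le]).
    Conversely, the parametrizations in use are affine in each parameter; at one
    point where the partial derivatives and the point itself are linearly
    independent, they provide a chain whose length is the number of parameters
    ([has_dim_param]), and the smoothness of the general point together with its
    tangent space ([smooth_param]). As the third secant variety has 47 parameters
    and the ambient space has dimension 55, it is not the whole space
    ([secant3_proper]). *)

Set Implicit Arguments.
Unset Strict Implicit.
Unset Printing Implicit Defensive.

Import Order.TTheory GRing.Theory Num.Theory.

Local Open Scope classical_set_scope.
Local Open Scope ring_scope.

(** * Evaluation of polynomials *)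

Section MpolyEval.
Variables (K : numFieldType).

Definition msubst n k (F : 'I_n -> {mpoly K[k]}) (p : {mpoly K[n]}) :=
  mmap (@mpolyC k K) F p.

HB.instance Definition _ n k (F : 'I_n -> {mpoly K[k]}) :=
  GRing.RMorphism.copy (msubst F) (mmap (@mpolyC k K) F).

Lemma mpoly_alg_ind n (P : {mpoly K[n]} -> Prop) :
  (forall c, P c%:MP) -> (forall i, P 'X_i) ->
  (forall p q, P p -> P q -> P (p + q)) ->
  (forall p q, P p -> P q -> P (p * q)) -> forall p, P p.
Proof.
move=> PC PX PD PM; elim/mpolyind=> [|c m p _ _ Pp].
  by rewrite -mpolyC0; apply: PC.
apply: (PD) => //; rewrite -mul_mpolyC; apply: (PM) => //.
rewrite mpolyXE_id; elim/big_ind: _ => [||i _]; rewrite -?mpolyC1 //.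
by elim: (m i) => [|j IHj]; rewrite ?expr0 -?mpolyC1 // exprS; apply: PM.
Qed.

Lemma msubstC n k (F : 'I_n -> {mpoly K[k]}) c : msubst F c%:MP = c%:MP.
Proof. exact: mmapC. Qed.

Lemma msubstX n k (F : 'I_n -> {mpoly K[k]}) i : msubst F 'X_i = F i.
Proof. by rewrite /msubst mmapX mmap1U. Qed.

Lemma meval_msubst n k (F : 'I_n -> {mpoly K[k]}) p v :
  (msubst F p).@[v] = p.@[fun i => (F i).@[v]].
Proof.
elim/mpoly_alg_ind: p => [c|i|p q IHp IHq|p q IHp IHq].
- by rewrite msubstC !mevalC.
- by rewrite msubstX mevalXU.
- by rewrite raddfD /= !mevalD IHp IHq.
- by rewrite rmorphM /= !mevalM IHp IHq.
Qed.

Lemma poly_all_roots (q : {poly K}) :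
  (forall t, t != 0 -> q.[t] = 0) -> q = 0.
Proof.
move=> q0; apply/eqP; apply: contraT => nz_q.
pose s := [seq (i.+1)%:R : K | i <- iota 0 (size q)].
suff: (size s < size q)%N by rewrite size_map size_iota ltnn.
apply: max_poly_roots => //.
  by apply/allP=> _ /mapP[i _ ->]; rewrite rootE q0 // pnatr_eq0.
rewrite map_inj_uniq ?iota_uniq // => i j /eqP.
by rewrite eqr_nat => /eqP[].
Qed.

Lemma poly_mulX_eq0 (a : K) (r : {poly K}) :
  (forall t, t * a + t ^+ 2 * r.[t] = 0) -> a = 0.
Proof.
move=> E; have : 'X * a%:P + 'X^2 * r = 0.
  by apply: poly_all_roots => t _; rewrite -[RHS](E t) !(hornerD, hornerM, hornerC, hornerX, hornerXn).
move/(congr1 (coefp 1)) => /=; rewrite coefD coefXM coefC /= coefXnM /= addr0.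
by rewrite coef0.
Qed.

(** Taylor expansion to first order, the remainder being polynomial in t: the
    tangent vectors of a variety are read off from the lines through a point. *)
Lemma meval_line n (p : {mpoly K[n]}) (x v : 'I_n -> K) :
  exists r : {poly K}, forall t, p.@[fun i => x i + t * v i] =
    p.@[x] + t * (\sum_i p^`M(i).@[x] * v i) + t ^+ 2 * r.[t].
Proof.
elim/mpoly_alg_ind: p => [c|i|p q [r Hr] [s Hs]|p q [r Hr] [s Hs]].
- exists 0 => t; rewrite !mevalC horner0 mulr0 addr0 big1 ?mulr0 ?addr0 // => i _.
  by rewrite mderivC meval0 mul0r.
- exists 0 => t; rewrite !mevalXU horner0 mulr0 addr0 (bigD1 i) //= big1.
    have -> : 'X_i^`M(i) = 1 :> {mpoly K[n]}.
      rewrite mderivX mnm1E eqxx scale1r -[RHS]mpolyX0; congr 'X_[_].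
      by apply/mnmP=> j; rewrite mnmBE subnn mnm0E.
    by rewrite meval1 mul1r !addr0.
  by move=> j ne_ji; rewrite mderivX mnm1E eq_sym (negPf ne_ji) scale0r meval0 mul0r.
- exists (r + s) => t; rewrite !mevalD Hr Hs hornerD.
  under [in RHS]eq_bigr do rewrite mderivD mevalD mulrDl.
  by rewrite big_split /=; ring.
- set a := \sum_i p^`M(i).@[x] * v i in Hr; set b := \sum_i q^`M(i).@[x] * v i in Hs.
  exists ((p.@[x])%:P * s + (q.@[x])%:P * r + (a * b)%:P
     + 'X * (a%:P * s + b%:P * r) + 'X^2 * r * s) => t.
  have -> : \sum_i (p * q)^`M(i).@[x] * v i = a * q.@[x] + p.@[x] * b.
    rewrite mulr_suml mulr_sumr -big_split /=; apply: eq_bigr => i _.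
    rewrite mderivM mevalD !mevalM mulrDl; congr (_ + _); last by rewrite mulrA.
    by rewrite mulrAC.
  rewrite !mevalM Hr Hs.
  rewrite !(hornerD, hornerM, hornerC, hornerX, hornerXn).
  set P := p.@[x]; set Q := q.@[x]; set R := r.[t]; set S := s.[t].
  ring.
Qed.

Lemma meval_line_poly n (p : {mpoly K[n]}) (x v : 'I_n -> K) :
  exists q : {poly K}, forall t, p.@[fun i => x i + t * v i] = q.[t].
Proof.
have [r Hr] := meval_line p x v.
exists ((p.@[x])%:P + 'X * (\sum_i p^`M(i).@[x] * v i)%:P + 'X^2 * r) => t.
by rewrite Hr !hornerE.
Qed.

Lemma meval_dhomog n d (p : {mpoly K[n]}) c (x : 'I_n -> K) :
  p \is d.-homog -> p.@[fun i => c * x i] = c ^+ d * p.@[x].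
Proof.
move=> /dhomogP hp; rewrite !mevalE mulr_sumr; apply: eq_big_seq => m /hp dm.
under eq_bigr do rewrite exprMn.
rewrite big_split /= prodrXr mulrCA; congr (_ ^+ _ * _).
by rewrite -dm /= mdegE.
Qed.

(** On the line through x and the origin the polynomial restricts to a
    univariate one, whose coefficients are the values at x of the homogeneous
    components. *)
Lemma meval_pihomog_cone n (p : {mpoly K[n]}) (x : 'I_n -> K) :
  (forall c, c != 0 -> p.@[fun i => c * x i] = 0) ->
  forall d, (pihomog mdeg d p).@[x] = 0.
Proof.
move=> p0 d; pose k := maxn (msize p) d.+1.
have dk : (d < k)%N by rewrite leq_max ltnS leqnn orbT.
pose q := \poly_(i < k) (pihomog mdeg i p).@[x].
suff: q = 0 by move/(congr1 (coefp d)); rewrite /= coef_poly dk coef0.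
apply: poly_all_roots => t t0.
have Ep : p = \sum_(i < k) pihomog mdeg i p.
  by apply: pihomog_partitionE; rewrite leq_maxl.
rewrite horner_poly -[RHS](p0 _ t0) [in RHS]Ep.
rewrite raddf_sum /=; apply: eq_bigr => i _.
by rewrite (meval_dhomog t x (pihomogP _ _ _)) mulrC.
Qed.

Lemma meval_sum_pihomog n (p : {mpoly K[n]}) (x : 'I_n -> K) :
  (forall d, (pihomog mdeg d p).@[x] = 0) -> p.@[x] = 0.
Proof.
move=> h; have -> : p = \sum_(i < msize p) pihomog mdeg i p.
  exact: pihomog_partitionE.
by rewrite raddf_sum big1 //= => i _; apply: h.
Qed.

Lemma mderiv_pihomog0 n (p : {mpoly K[n]}) i :
  p^`M(i) = 0 -> forall d, (pihomog mdeg d p)^`M(i) = 0.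
Proof.
move=> p0 d; apply/mpolyP=> m; rewrite mcoeff0 mcoeff_deriv.
have {p0} pm : p@_(m + U_(i)) = 0.
  move/mpolyP: p0 => /(_ m); rewrite mcoeff0 mcoeff_deriv => /eqP.
  by rewrite mulrn_eq0 /= => /eqP.
rewrite (_ : _@__ = 0) ?mul0rn //.
rewrite pihomogE raddf_sum /= big1 // => m' _.
rewrite mcoeffZ mcoeffX; case: eqP => [->|]; rewrite ?mulr0 //.
by rewrite pm mul0r.
Qed.

Lemma dhomog_deriv n d (p : {mpoly K[n]}) i :
  p \is d.-homog -> p^`M(i) \is d.-1.-homog.
Proof.
move=> hp; apply/dhomogP=> m; rewrite mcoeff_msupp mcoeff_deriv mulrn_eq0 /=.
rewrite -mcoeff_msupp => /(dhomog_mf hp) /=.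
by rewrite mdegD mdeg1 addn1 => <-.
Qed.

(** In characteristic zero a nonzero exponent survives derivation. *)
Lemma mderiv0_mpolyC n (p : {mpoly K[n]}) :
  (forall i, p^`M(i) = 0) -> p = (p@_0)%:MP.
Proof.
move=> p0; apply/mpolyP=> m; rewrite mcoeffC; case: eqP => [->|/eqP nz_m].
  by rewrite mulr1.
rewrite mulr0; have /existsP[i mi] : [exists i, m i != 0%N].
  apply: contraR nz_m; rewrite negb_exists => /forallP m0.
  by apply/eqP/mnmP=> i; rewrite mnm0E; have := m0 i; rewrite negbK => /eqP.
move/mpolyP: (p0 i) => /(_ (m - U_(i))%MM); rewrite mcoeff0 mcoeff_deriv.
by rewrite submK ?lep1mP // => /eqP; rewrite mulrn_eq0 => /eqP.
Qed.

(** The partial derivatives have smaller degree and vanish everywhere as well,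
    so that the polynomial is constant. *)
Lemma meval_eq0 n (p : {mpoly K[n]}) : (forall x, p.@[x] = 0) -> p = 0.
Proof.
elim: {p}(msize p) {-2}p (leqnn (msize p)) => [|k IHk] p.
  by rewrite leqn0 msize_poly_eq0 => /eqP.
move=> szp p0; have dp i : p^`M(i) = 0.
  apply: IHk => [|x].
    rewrite leqNgt; apply/negP => szd.
    have nz_d : p^`M(i) != 0 by rewrite -msize_poly_eq0 -lt0n (leq_ltn_trans _ szd).
    have := mlead_supp nz_d; rewrite mcoeff_msupp mcoeff_deriv mulrn_eq0 /=.
    rewrite -mcoeff_msupp => /msize_mdeg_lt; rewrite mdegD mdeg1 addn1.
    move/leq_trans/(_ szp); rewrite ltnS ltnNge => /negP[].
    by rewrite -ltnS mlead_deg.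
  have [r Hr] := meval_line p x (fun j => (j == i)%:R).
  apply: (@poly_mulX_eq0 _ r) => t; have := Hr t; rewrite !p0 add0r.
  rewrite (bigD1 i) //= eqxx mulr1 big1 ?addr0 => [E|j /negPf->]; last by rewrite mulr0.
  by rewrite -E.
rewrite (mderiv0_mpolyC dp) in p0 *.
by have := p0 (fun=> 0); rewrite mevalC => ->; rewrite mpolyC0.
Qed.

End MpolyEval.

(** * Polynomial functions *)

Section PolyFun.
Variables (K : numFieldType).
Implicit Types (T U : finType).

(** Polynomial functions of parameters indexed by any finite type: matrix
    entries and the like are parameters without being numbered. *)
Definition polyfun T (f : (T -> K) -> K) :=
  exists p : {mpoly K[#|T|]}, forall s, f s = p.@[fun i => s (enum_val i)].

Lemma polyfun_cst T c : polyfun (fun _ : T -> K => c).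
Proof. by exists c%:MP => s; rewrite mevalC. Qed.

Lemma polyfun_var T x : polyfun (fun s : T -> K => s x).
Proof. by exists 'X_(enum_rank x) => s; rewrite mevalXU enum_rankK. Qed.

Lemma polyfunD T (f g : (T -> K) -> K) :
  polyfun f -> polyfun g -> polyfun (fun s => f s + g s).
Proof. by move=> [p Hp] [q Hq]; exists (p + q) => s; rewrite mevalD Hp Hq. Qed.

Lemma polyfunM T (f g : (T -> K) -> K) :
  polyfun f -> polyfun g -> polyfun (fun s => f s * g s).
Proof. by move=> [p Hp] [q Hq]; exists (p * q) => s; rewrite mevalM Hp Hq. Qed.

Lemma polyfunN T (f : (T -> K) -> K) : polyfun f -> polyfun (fun s => - f s).
Proof. by move=> [p Hp]; exists (- p) => s; rewrite mevalN Hp. Qed.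

Lemma polyfunB T (f g : (T -> K) -> K) :
  polyfun f -> polyfun g -> polyfun (fun s => f s - g s).
Proof. by move=> pf pg; apply/polyfunD/polyfunN. Qed.

Lemma polyfunX T (f : (T -> K) -> K) n : polyfun f -> polyfun (fun s => f s ^+ n).
Proof. by move=> [p Hp]; exists (p ^+ n) => s; rewrite rmorphXn /= Hp. Qed.

Lemma polyfun_sum T I (r : seq I) (P : pred I) (f : I -> (T -> K) -> K) :
  (forall i, polyfun (f i)) -> polyfun (fun s => \sum_(i <- r | P i) f i s).
Proof.
move=> pf; elim: r => [|i r IHr].
  by under eq_fun do rewrite big_nil; apply: polyfun_cst.
under eq_fun do rewrite big_cons; case: (P i) => //; exact: polyfunD.
Qed.

Lemma polyfun_prod T I (r : seq I) (P : pred I) (f : I -> (T -> K) -> K) :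
  (forall i, polyfun (f i)) -> polyfun (fun s => \prod_(i <- r | P i) f i s).
Proof.
move=> pf; elim: r => [|i r IHr].
  by under eq_fun do rewrite big_nil; apply: polyfun_cst.
under eq_fun do rewrite big_cons; case: (P i) => //; exact: polyfunM.
Qed.

Lemma polyfun_det T n (M : (T -> K) -> 'M[K]_n) :
  (forall i j, polyfun (fun s => M s i j)) -> polyfun (fun s => \det (M s)).
Proof.
move=> pM; apply: polyfun_sum => u; apply: polyfunM; first exact: polyfun_cst.
by apply: polyfun_prod.
Qed.

Lemma polyfun_mulmx T m n p (A : (T -> K) -> 'M[K]_(m, n)) (B : (T -> K) -> 'M[K]_(n, p)) i j :
  (forall i j, polyfun (fun s => A s i j)) ->
  (forall i j, polyfun (fun s => B s i j)) -> polyfun (fun s => (A s *m B s) i j).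
Proof.
move=> pA pB; under eq_fun do rewrite mxE.
by apply: polyfun_sum => k; apply: polyfunM.
Qed.

Lemma polyfun_meval T n (p : {mpoly K[n]}) (f : 'I_n -> (T -> K) -> K) :
  (forall i, polyfun (f i)) -> polyfun (fun s => p.@[fun i => f i s]).
Proof.
move=> /choice[F HF]; exists (msubst F p) => s; rewrite meval_msubst.
by apply: meval_eq => i; rewrite HF.
Qed.

Lemma polyfun_comp T U (f : (T -> K) -> K) (g : T -> (U -> K) -> K) :
  polyfun f -> (forall x, polyfun (g x)) -> polyfun (fun s => f (fun x => g x s)).
Proof.
move=> [p Hp] pg; under eq_fun do rewrite Hp.
exact: (@polyfun_meval U _ p (fun i => g (enum_val i))).
Qed.

Lemma polyfun_line T (f : (T -> K) -> K) a b : polyfun f ->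
  exists q : {poly K}, forall t, f (fun x => a x + t * b x) = q.[t].
Proof.
move=> [p Hp].
have [q Hq] := meval_line_poly p (fun i => a (enum_val i)) (fun i => b (enum_val i)).
by exists q => t; rewrite Hp Hq.
Qed.

(** Two nonempty open sets meet: on the line joining a point of each, both
    conditions fail only finitely often. *)
Lemma polyfun_dense T (f g : (T -> K) -> K) a b : polyfun f -> polyfun g ->
  f a != 0 -> g b != 0 -> exists s, f s != 0 /\ g s != 0.
Proof.
move=> pf pg fa gb.
have [p Hp] := polyfun_line a (fun x => b x - a x) pf.
have [q Hq] := polyfun_line a (fun x => b x - a x) pg.
have nzp : p != 0.
  apply: contra_neq fa => p0; have := Hp 0; rewrite p0 horner0 => <-.
  by congr f; apply/funext => x; rewrite mul0r addr0.
have nzq : q != 0.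
  apply: contra_neq gb => q0; have := Hq 1; rewrite q0 horner0 => <-.
  by congr g; apply/funext => x; rewrite mul1r addrC subrK.
have [//|none] := pselect (exists s, f s != 0 /\ g s != 0).
suff /eqP : p * q = 0 by rewrite mulf_eq0 (negPf nzp) (negPf nzq).
apply: poly_all_roots => t _; rewrite hornerM -Hp -Hq; apply/eqP.
rewrite mulf_eq0; apply: contra_notT none; rewrite negb_or => /andP[].
by move=> ft gt; eexists; split; [exact: ft | exact: gt].
Qed.

(** The function g stands for a nonempty open set on which the identity is
    known; arguments for general points are reduced to this lemma. *)
Lemma polyfun_eq0 T (f g : (T -> K) -> K) a : polyfun f -> polyfun g ->
  g a != 0 -> (forall s, g s != 0 -> f s = 0) -> forall s, f s = 0.
Proof.
move=> pf pg ga fg s; apply/eqP; apply: contraT => fs.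
have [s' [fs' gs']] := polyfun_dense pf pg fs ga.
by rewrite fg ?eqxx in fs'.
Qed.

Lemma polyfun_mpoly n (f : ('I_n -> K) -> K) : polyfun f ->
  exists p : {mpoly K[n]}, forall s, f s = p.@[s].
Proof.
move=> [p Hp]; exists (msubst (fun i => 'X_(enum_val i)) p) => s.
by rewrite Hp meval_msubst; apply: meval_eq => i; rewrite mevalXU.
Qed.

(** The polynomial representing a function is not unique a priori; its component
    of degree d represents the function too, by comparing the coefficients in
    c. *)
Lemma polyfun_dhomog n d (f : ('I_n -> K) -> K) : polyfun f ->
  (forall c s, f (fun i => c * s i) = c ^+ d * f s) ->
  exists2 p : {mpoly K[n]}, p \is d.-homog & forall s, f s = p.@[s].
Proof.
move=> /polyfun_mpoly[p Hp] hf; exists (pihomog mdeg d p); first exact: pihomogP.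
move=> s; apply/eqP; rewrite -subr_eq0; apply/eqP.
have : pihomog mdeg d (p - pihomog mdeg d p) = 0.
  by rewrite raddfB /= pihomog_id subrr.
pose q := p - pihomog mdeg d p => q0.
have -> : f s - (pihomog mdeg d p).@[s] = q.@[s] by rewrite /q mevalB -Hp.
pose k := maxn (msize q) d.+1.
have Eq (c : K) : q.@[fun i => c * s i] = c ^+ d * q.@[s].
  rewrite /q !mevalB (meval_dhomog c s (pihomogP _ _ _)) -Hp hf mulrBr; congr (_ - _).
  by rewrite Hp.
pose u := \poly_(i < k) (pihomog mdeg i q).@[s].
have dk : (d < k)%N by rewrite leq_max ltnS leqnn orbT.
have Equ : u = (q.@[s])%:P * 'X^d.
  apply/eqP; rewrite -subr_eq0; apply/eqP/poly_all_roots => t _.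
  rewrite hornerD hornerN hornerM hornerC hornerXn [_ * t ^+ d]mulrC -Eq.
  have /(congr1 (meval (fun i => t * s i)))-> : q = \sum_(i < k) pihomog mdeg i q.
    by apply: pihomog_partitionE; rewrite leq_maxl.
  apply/eqP; rewrite subr_eq0 horner_poly; apply/eqP; rewrite raddf_sum /=.
  by apply: eq_bigr => i _; rewrite (meval_dhomog t s (pihomogP _ _ _)) mulrC.
move/(congr1 (coefp d)): Equ; rewrite /= coef_poly dk q0 meval0 coefCM coefXn.
by rewrite eqxx mulr1.
Qed.

Lemma polyfun_mxvec m n (f : ('I_m * 'I_n -> K) -> K) : polyfun f ->
  exists p : {mpoly K[m * n]},
    forall t : 'M[K]_(m, n), f (fun x => t x.1 x.2) = p.@[mxvec t 0].
Proof.
move=> [p Hp].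
exists (msubst (fun i => 'X_(mxvec_index (enum_val i).1 (enum_val i).2)) p) => t.
by rewrite Hp meval_msubst; apply: meval_eq => i; rewrite mevalXU mxvecE.
Qed.

End PolyFun.

(** * Algebraic dependence *)

Section AlgDep.
Variables (K : numFieldType).

Lemma msize_prod_le n I (r : seq I) (F : I -> {mpoly K[n]}) b :
  (forall i, (msize (F i) <= b)%N) ->
  (msize (\prod_(i <- r) F i) <= (size r * b).+1)%N.
Proof.
move=> hF; elim: r => [|i r IHr]; first by rewrite big_nil msize1.
rewrite big_cons; set p := F i; set q := \prod_(j <- r) F j.
have [->|nzp] := eqVneq p 0; first by rewrite mul0r msize0.
have [->|nzq] := eqVneq q 0; first by rewrite mulr0 msize0.
rewrite msizeM //= mulSn -subn1 leq_subLR add1n -addnS leqW // leq_add //.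
exact: hF.
Qed.

(** With bounded exponents, the monomials in the n polynomials f i outnumber the
    monomials in m < n variables that can occur in them. *)
Lemma algebraic_dependence n m (f : 'I_n -> {mpoly K[m]}) : (m < n)%N ->
  exists2 P : {mpoly K[n]}, P != 0 & msubst f P = 0.
Proof.
move=> ltmn; pose D := \max_i msize (f i).
(* There are (d + 1) ^ n monomials with exponents at most d in the f i, and *)
(* their exponents are less than B, which grows linearly with d. *)
pose C := (n * D.+1).+2; pose d := (C ^ m)%N; pose B := (n * (d * D).+1).+1.
pose RT := {ffun 'I_n -> 'I_d.+1}; pose CT := {ffun 'I_m -> 'I_B}.
pose mon (e : RT) := \prod_(i < n) f i ^+ e i.
have szmon e : (msize (mon e) <= B)%N.
  rewrite /mon (leq_trans (msize_prod_le _ (b := (d * D).+1) _)) => [//|i|].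
    have := @msize_prod_le _ _ (nseq (e i) tt) (fun=> f i) D.
    rewrite size_nseq big_nseq -Monoid.iteropE -/(_ ^+ _) => /(_ _)/leq_trans; apply.
      by move=> _; apply: (@leq_bigmax _ (fun i => msize (f i))).
    by rewrite ltnS leq_mul2r -ltnS ltn_ord orbT.
  by rewrite -[index_enum _]enumT size_enum_ord.
pose Mx := \matrix_(i < #|RT|, j < #|CT|)
  (mon (enum_val i))@_[multinom (enum_val j k : nat) | k < m].
have lt_card : (#|CT| < #|RT|)%N.
  rewrite !card_ffun !card_ord.
  have le_B : (B <= C * d.+1)%N.
    rewrite /B /C; nia.
  apply: (@leq_ltn_trans ((C * d.+1) ^ m)); first by case: {+}m => // m'; rewrite leq_exp2r.
  rewrite expnMn; apply: (@leq_trans (d.+1 * d.+1 ^ m)).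
    by rewrite ltn_pmul2r ?expn_gt0 // ltnS.
  by rewrite -expnS leq_pexp2l.
have : kermx Mx != 0.
  rewrite kermx_eq0 -row_leq_rank -ltnNge.
  by apply: leq_ltn_trans lt_card; apply: rank_leq_col.
case/rowV0Pn => v /sub_kermxP vM0 nzv.
pose ex (e : RT) := [multinom (e k : nat) | k < n].
exists (\sum_i v 0 i *: 'X_[ex (enum_val i)]).
  case/rV0Pn: nzv => i nzvi; apply: contra_neq nzvi => /(congr1 (mcoeff (ex (enum_val i)))).
  rewrite mcoeff0 raddf_sum (bigD1 i) //= mcoeffZ mcoeffX eqxx mulr1 big1 ?addr0 //.
  move=> j ne_ji; rewrite mcoeffZ mcoeffX; case: eqP => [/mnmP E|]; rewrite ?mulr0 //.
  case/eqP: ne_ji; apply: enum_val_inj; apply/ffunP=> k; apply/val_inj.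
  by have := E k; rewrite !mnmE.
have Emon i : msubst f (v 0 i *: 'X_[ex (enum_val i)]) = v 0 i *: mon (enum_val i).
  rewrite -!mul_mpolyC rmorphM /= msubstC; congr (_ * _).
  rewrite /msubst mmapX /mmap1 /mon; apply: eq_bigr => k _.
  by rewrite mnmE.
rewrite raddf_sum /=; under eq_bigr do rewrite Emon.
apply/mpolyP=> m0; rewrite mcoeff0 raddf_sum /=.
have [/forallP small|] := boolP [forall k, (m0 k < B)%N]; last first.
  rewrite negb_forall => /existsP[k]; rewrite -leqNgt => bigk.
  rewrite big1 // => i _; rewrite mcoeffZ.
  suff /memN_msupp_eq0-> : m0 \notin msupp (mon (enum_val i)) by rewrite mulr0.
  apply/negP => /msize_mdeg_lt /leq_trans/(_ (szmon _)).
  rewrite ltnNge (leq_trans bigk) //= mdegE (bigD1 k) //=; exact: leq_addr.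
pose j := enum_rank ([ffun k => Ordinal (small k)] : CT).
have Em0 : m0 = [multinom (enum_val j k : nat) | k < m].
  by apply/mnmP=> k; rewrite mnmE /j enum_rankK ffunE.
move/matrixP/(_ 0 j): vM0; rewrite mxE [in RHS]mxE => vM0.
rewrite -[RHS]vM0; apply: eq_bigr => i _.
by rewrite mcoeffZ [in RHS]mxE -Em0.
Qed.

End AlgDep.

(** * Closed cones, independent forms and chains *)

Section Projective.
Variables (K : numFieldType) (n : nat).
Implicit Types (X Z : set 'rV[K]_n) (x v h : 'rV[K]_n) (p : {mpoly K[n]}).

Lemma meval_rowZ p c x : p.@[(c *: x) 0] = p.@[fun i => c * x 0 i].
Proof. by apply: meval_eq => i; rewrite mxE. Qed.

Lemma meval_homogZ d p c x : p \is d.-homog -> p.@[(c *: x) 0] = c ^+ d * p.@[x 0].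
Proof. by move=> hp; rewrite meval_rowZ (meval_dhomog c _ hp). Qed.

Definition cone X := forall x c, X x -> c != 0 -> X (c *: x).

Lemma proj_closed_cone Z : proj_closed Z -> cone Z.
Proof.
move=> [S hS ->] x c [nzx Sx] nzc; split=> [|p Sp]; first by rewrite scaler_eq0 negb_or nzc.
by have [d hp] := hS p Sp; rewrite (meval_homogZ c x hp) Sx // mulr0.
Qed.

Lemma proj_closure_closed Z : proj_closed (proj_closure Z).
Proof.
exists [set p | homogeneous p /\ vanishes p Z] => [p []//|].
by apply/seteqP; split=> x [nzx h]; split=> // p; [case; exact: h | move=> ? ?; exact: h].
Qed.

Lemma sub_proj_closure Z : (forall x, Z x -> x != 0) -> Z `<=` proj_closure Z.
Proof. by move=> nz x Zx; split=> [|p _]; [exact: nz | apply]. Qed.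

Lemma vanishes_closure p Z : homogeneous p -> vanishes p Z -> vanishes p (proj_closure Z).
Proof. by move=> hp pZ x [_]; apply. Qed.

Lemma proj_closure_mono Z Z' : Z `<=` Z' -> proj_closure Z `<=` proj_closure Z'.
Proof. by move=> sZ x [nzx h]; split=> // p hp pZ; apply: h => // y /sZ; apply: pZ. Qed.

(** Forms are thus as good as arbitrary polynomials to describe cones. *)
Lemma vanishes_pihomog q X : cone X -> vanishes q X ->
  forall d, vanishes (pihomog mdeg d q) X.
Proof.
move=> cX qX d x Xx; apply: meval_pihomog_cone => c nzc.
by rewrite -meval_rowZ; apply/qX/cX.
Qed.

Lemma irreducible_prime Z p q : irreducible_closed Z -> homogeneous p -> homogeneous q ->
  vanishes (p * q) Z -> vanishes p Z \/ vanishes q Z.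
Proof.
move=> [clZ _ irr] hp hq pqZ.
have cl r : homogeneous r -> proj_closed [set x : 'rV[K]_n | x != 0 /\ r.@[x 0] = 0].
  move=> hr; exists [set r] => [_ ->//|].
  apply/seteqP; split=> x [nzx h]; split=> //; first by move=> _ ->.
  exact: h.
have [x Zx|h|h] := irr _ _ (cl p hp) (cl q hq).
- have nzx : x != 0 by case: clZ Zx => S _ -> [].
  have /eqP := pqZ x Zx; rewrite mevalM mulf_eq0 => /orP[]/eqP; first by left.
  by right.
- by left=> x /h[].
- by right=> x /h[].
Qed.

(** The largest such r is the transcendence degree of the homogeneous coordinate
    ring of X, that is dim X + 1 when X is irreducible. *)
Definition indep X r := exists2 g : 'I_r -> {mpoly K[n]},
  (forall i, homogeneous (g i)) &
  forall P : {mpoly K[r]}, vanishes (msubst g P) X -> P = 0.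

Lemma indep_sub X Z r : X `<=` Z -> indep X r -> indep Z r.
Proof. by move=> sXZ [g hg ind]; exists g => // P PZ; apply: ind => x /sXZ; apply: PZ. Qed.

(** Forms do not distinguish X from the image of psi: psi parametrizes a dense
    part of X, up to scaling. The values of psi may vanish. *)
Definition param (T : finType) (psi : (T -> K) -> 'rV[K]_n) X :=
  forall p, homogeneous p -> (vanishes p X <-> forall s, p.@[psi s 0] = 0).

Definition polymap (T : finType) (psi : (T -> K) -> 'rV[K]_n) :=
  forall i, polyfun (fun s => psi s 0 i).

(** The scaling factor is the extra parameter. *)
Lemma param_indep_le (T : finType) (psi : (T -> K) -> 'rV[K]_n) X r :
  polymap psi -> param psi X -> indep X r -> (r <= #|T|.+1)%N.
Proof.
move=> pmap par [g hg ind]; rewrite leqNgt -card_option; apply/negP => lt_r.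
have /choice[F HF] : forall i : 'I_r, exists p : {mpoly K[#|{: option T}|]}, forall s,
    (g i).@[(s None *: psi (fun y => s (Some y))) 0] = p.@[fun j => s (enum_val j)].
  move=> i; pose f j (s : option T -> K) := s None * psi (fun y => s (Some y)) 0 j.
  have [j|p Hp] := @polyfun_meval _ _ _ (g i) f.
    apply: polyfunM; first exact: polyfun_var.
    apply: (polyfun_comp (g := fun y s => s (Some y)) (pmap j)) => y.
    exact: polyfun_var.
  by exists p => s; rewrite meval_rowZ -Hp.
have [P nzP P0] := algebraic_dependence F lt_r.
case/eqP: nzP; apply: ind => x Xx; apply: meval_sum_pihomog => d.
have hd : homogeneous (pihomog mdeg d (msubst g P)) by exists d; apply: pihomogP.
suff /(par _ hd) : forall s, (pihomog mdeg d (msubst g P)).@[psi s 0] = 0 by apply.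
move=> s; apply: meval_pihomog_cone => c _; rewrite -meval_rowZ meval_msubst.
pose s' (y : option T) := if y is Some z then s z else c.
transitivity ((msubst F P).@[fun j => s' (enum_val j)]); last by rewrite P0 meval0.
by rewrite meval_msubst; apply: meval_eq => i; rewrite -HF.
Qed.

Definition option_form r (g : 'I_r -> {mpoly K[n]}) e (i : 'I_r.+1) :=
  oapp g e (unlift ord_max i).

End Projective.

Definition last_var (K : numFieldType) r (i : 'I_r.+1) : {poly {mpoly K[r]}} :=
  if unlift ord_max i is Some j then ('X_j)%:P else 'X.

(** A polynomial seen as univariate in the last variable. *)
Definition mpoly_last (K : numFieldType) r (P : {mpoly K[r.+1]}) : {poly {mpoly K[r]}} :=
  mmap (polyC \o @mpolyC r K) (@last_var K r) P.

HB.instance Definition _ (K : numFieldType) r := GRing.RMorphism.copy (@mpoly_last K r)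
  (mmap (polyC \o @mpolyC r K) (@last_var K r)).

Lemma mpoly_lastE (K : numFieldType) m r (g : 'I_r -> {mpoly K[m]}) e P :
  msubst (option_form g e) P = (map_poly (msubst g) (mpoly_last P)).[e].
Proof.
elim/mpoly_alg_ind: P => [c|i|p q IHp IHq|p q IHp IHq].
- by rewrite msubstC /mpoly_last mmapC /= map_polyC hornerC /= msubstC.
- rewrite msubstX /mpoly_last mmapX mmap1U /option_form /last_var.
  by case: (unlift _ _) => [j|] /=; rewrite ?map_polyX ?hornerX // map_polyC hornerC /= msubstX.
- by rewrite !raddfD /= IHp IHq hornerD.
- by rewrite !rmorphM /= IHp IHq hornerM.
Qed.

(** Substituting the variables themselves recovers the polynomial. *)
Lemma mpoly_last_inj (K : numFieldType) r (P : {mpoly K[r.+1]}) :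
  mpoly_last P = 0 -> P = 0.
Proof.
move=> P0; pose g j : {mpoly K[r.+1]} := 'X_(lift ord_max j).
have -> : P = msubst (option_form g 'X_ord_max) P.
  rewrite /option_form; elim/mpoly_alg_ind: P {P0} => [c|i|p q IHp IHq|p q IHp IHq].
  - by rewrite msubstC.
  - by rewrite msubstX; case: unliftP => [j|] ->.
  - by rewrite raddfD /= -IHp -IHq.
  - by rewrite rmorphM /= -IHp -IHq.
by rewrite mpoly_lastE P0 raddf0 horner0.
Qed.

Section Chains.
Variables (K : numFieldType) (n : nat).
Implicit Types (X Z : set 'rV[K]_n) (x v h : 'rV[K]_n) (p : {mpoly K[n]}).

(** A form e vanishing on Z and not on the larger irreducible Z' is
    transcendental over forms independent on Z: divide a relation by the largest
    power of e, which is not a zero divisor on Z', and restrict it to Z. *)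
Lemma indepS Z Z' r e : irreducible_closed Z' ->
  (forall q, homogeneous q -> vanishes q Z' -> vanishes q Z) ->
  homogeneous e -> vanishes e Z -> ~ vanishes e Z' ->
  indep Z r -> indep Z' r.+1.
Proof.
move=> irrZ' ZZ' he eZ eZ' [g hg ind].
exists (option_form g e) => [i|P PZ'].
  by rewrite /option_form; case: (unlift _ _) => /=.
have [->//|nzP] := eqVneq P 0; exfalso.
(* P = q X^m in the last variable, with q not divisible by it. *)
have [m [q]] := multiplicity_XsubC (mpoly_last P) 0.
have -> /= : mpoly_last P != 0 by apply: contra_neq nzP => /mpoly_last_inj.
rewrite rootE horner_coef0 subr0 => nzq EP.
pose R := (map_poly (msubst g) q).[e].
have ER : msubst (option_form g e) P = R * e ^+ m.
  by rewrite mpoly_lastE EP rmorphM /= rmorphXn /= map_polyX hornerM hornerXn.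
have clZ' : cone Z' by apply: proj_closed_cone; case: irrZ'.
have RdZ' d : vanishes (pihomog mdeg d R) Z'.
  have hR : homogeneous (pihomog mdeg d R) by exists d; apply: pihomogP.
  case: (@irreducible_prime _ _ Z' e (pihomog mdeg d R)) => // x Zx.
  rewrite mevalM; have [->|nzex] := eqVneq e.@[x 0] 0; first by rewrite mul0r.
  rewrite (meval_pihomog_cone _ d) ?mulr0 // => c nzc; rewrite -meval_rowZ.
  have /eqP := PZ' _ (clZ' x c Zx nzc); rewrite ER mevalM rmorphXn /= mulf_eq0.
  have [k hek] := he; rewrite (meval_homogZ c x hek) expf_eq0 mulf_eq0 (negPf nzex).
  by rewrite expf_eq0 (negPf nzc) !andbF orbF => /eqP.
case/eqP: nzq; apply: ind => x Zx.
have : R.@[x 0] = 0.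
  apply: meval_sum_pihomog => d; apply: ZZ' (RdZ' d) x Zx.
  by exists d; apply: pihomogP.
by rewrite /R -horner_map /= (eZ x Zx) horner_coef0 !coef_map.
Qed.

(** Each step of a chain of irreducible closed sets adds one independent form;
    the chain is started from the vertex 0 of the cones. *)
Lemma chain_indep X d : irreducible_chain X d -> indep X d.+1.
Proof.
move=> [c [hc hlt]].
suff H i : (i <= d)%N -> indep (c i) i.+1.
  by have := H d (leqnn d); apply: indep_sub; case: (hc d).
elim: i => [|i IHi] le_id.
  have [irr _] := hc 0%N le_id; have [clc [x cx] _] := irr.
  have nzx : x != 0 by case: clc cx => S _ -> [].
  have [i nzxi] : exists i, x 0 i != 0 by case/rV0Pn: nzx => i; exists i.
  apply: (@indepS [set 0] (c 0%N) 0 'X_i irr).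
  - move=> q [k hq] q0 _ ->; rewrite -(scale0r x) (meval_homogZ 0 x hq).
    by rewrite q0 ?mulr0.
  - by exists 1%N; rewrite dhomogX /= mdeg1.
  - by move=> _ ->; rewrite mevalXU mxE.
  - by move/(_ x cx)/eqP; rewrite mevalXU (negPf nzxi).
  - exists (fun i => 0) => [j|P /(_ 0 erefl)]; first by exists 0%N; apply: dhomog0.
    rewrite meval_msubst -[P]mpolyKC mevalC => ->; exact: mpolyC0.
have [[clc _ _] _] := hc i (ltnW le_id); have [irr' _] := hc _ le_id.
have [sub nsub] := hlt i le_id.
have [p [hp pZ pZ']] : exists p, [/\ homogeneous p, vanishes p (c i) & ~ vanishes p (c i.+1)].
  have [S hS Ec] := clc; apply: contra_notP nsub => none x cx; rewrite Ec; split.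
    by case: irr' => [[S' _ Ec'] _ _]; move: cx; rewrite Ec' => -[].
  move=> p Sp; apply: contra_notP none => nzp; exists p; split; first exact: hS.
    by rewrite Ec => y [_]; apply.
  by move/(_ x cx).
apply: (indepS irr' _ hp pZ pZ') (IHi (ltnW le_id)).
by move=> q _ qZ' x /sub; apply: qZ'.
Qed.

End Chains.

(** * Tangent spaces at general points *)

Section Tangent.
Variables (K : numFieldType) (n : nat).
Implicit Types (X Z : set 'rV[K]_n) (v h : 'rV[K]_n) (p : {mpoly K[n]}).

(** The bilinear form by which row vectors are both points and hyperplanes. *)
Definition pairing h v := \sum_i h 0 i * v 0 i.

Lemma tangent_mulmx X x m (W : 'M[K]_(m, n)) v :
  (forall i, tangent_space X x (row i W)) -> (v <= W)%MS -> tangent_space X x v.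
Proof.
move=> TW /submxP[c ->] p hp pX.
under eq_bigr do rewrite mxE mulr_sumr.
rewrite exchange_big big1 //= => j _.
rewrite -[RHS](mulr0 (c 0 j)) -[in RHS](TW j p hp pX) mulr_sumr.
by apply: eq_bigr => i _; rewrite mxE mulrCA.
Qed.

Lemma tangent_line X x v :
  (forall p, homogeneous p -> vanishes p X -> forall t, p.@[(x + t *: v) 0] = 0) ->
  tangent_space X x v.
Proof.
move=> line p hp pX; have [r Hr] := meval_line p (x 0) (v 0).
apply: (@poly_mulX_eq0 _ _ r) => t.
rewrite -[RHS](line p hp pX t).
have := line p hp pX 0; rewrite scale0r addr0 => px0.
transitivity (p.@[fun i => x 0 i + t * v 0 i]); first by rewrite Hr px0 add0r.
by apply: meval_eq => i; rewrite !mxE.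
Qed.

(** In characteristic zero, a form involves only the coordinates of U when its
    other partial derivatives vanish. *)
Definition dep X (U : {set 'I_n}) := exists p,
  [/\ homogeneous p, p != 0, vanishes p X & forall i, i \notin U -> p^`M(i) = 0].

Lemma indep_coord X (S : {set 'I_n}) : cone X -> ~ dep X S -> indep X #|S|.
Proof.
move=> cX nd; exists (fun i => 'X_(enum_val i)) => [i|P PX].
  by exists 1%N; rewrite dhomogX /= mdeg1.
set R := msubst _ P in PX.
have dR i : i \notin S -> R^`M(i) = 0.
  move=> niS; rewrite /R; elim/mpoly_alg_ind: P {R PX} => [c|j|p q IHp IHq|p q IHp IHq].
  - by rewrite msubstC mderivC.
  - rewrite msubstX mderivX mnm1E; case: eqP => [E|_]; last by rewrite scale0r.
    by case/negP: niS; rewrite -E enum_valP.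
  - by rewrite raddfD mderivD IHp IHq addr0.
  - by rewrite rmorphM mderivM IHp IHq mulr0 mul0r addr0.
have R0 d : pihomog mdeg d R = 0.
  apply/eqP; apply: contra_notT nd => nzR; exists (pihomog mdeg d R); split=> //.
  - by exists d; apply: pihomogP.
  - exact: vanishes_pihomog.
  - by move=> i /dR /mderiv_pihomog0.
apply: meval_eq0 => y; pose z j := \sum_i y i * (enum_val i == j)%:R.
have -> : P.@[y] = R.@[z].
  rewrite meval_msubst; apply: meval_eq => i; rewrite mevalXU /z (bigD1 i) //= eqxx.
  rewrite mulr1 big1 ?addr0 // => j ne_ji; rewrite (inj_eq enum_val_inj) (negPf ne_ji).
  by rewrite mulr0.
by apply: meval_sum_pihomog => d; rewrite R0 meval0.
Qed.

(** Derive a relation along j as long as the derivative vanishes on X; a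
    relation that becomes zero in this way does not involve j, against the
    independence of S. *)
Lemma dep_witness X (S : {set 'I_n}) j : ~ dep X S -> dep X (j |: S) -> exists p,
  [/\ homogeneous p, vanishes p X, ~ vanishes (p^`M(j)) X &
      forall i, i \notin j |: S -> p^`M(i) = 0].
Proof.
move=> nd [p [[d hp] nzp pX dp]]; elim: d p hp nzp pX dp => [|d IHd] p hp nzp pX dp.
  case: nd; exists p; split=> // [|i _]; first by exists 0%N.
  apply/mpolyP=> m; rewrite mcoeff0 mcoeff_deriv (dhomog_nemf_coeff hp) ?mul0rn //.
  by rewrite /= mdegD mdeg1 addn1.
have [pjX|npjX] := pselect (vanishes (p^`M(j)) X); last first.
  by exists p; split=> //; exists d.+1.
have [pj0|nzpj] := eqVneq (p^`M(j)) 0.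
  case: nd; exists p; split=> // [|i niS]; first by exists d.+1.
  have [->//|ne_ij] := eqVneq i j; apply: dp.
  by rewrite !inE negb_or ne_ij.
apply: (IHd (p^`M(j))) => // [|i nij]; first exact: dhomog_deriv hp.
by rewrite mderiv_comm dp // mderiv0.
Qed.

(** A transcendence basis S of the coordinates controls the tangent space at a
    general point: each other coordinate satisfies a relation of least degree,
    and its gradient has a nonzero component along that coordinate. *)
Lemma generic_tangent (T : finType) (psi : (T -> K) -> 'rV[K]_n) X :
  polymap psi -> param psi X -> cone X -> X !=set0 ->
  exists S : {set 'I_n}, indep X #|S| /\ exists Q : (T -> K) -> K,
    [/\ polyfun Q, exists s, Q s != 0 & forall s, Q s != 0 ->
      forall v, tangent_space X (psi s) v -> (forall i, i \in S -> v 0 i = 0) -> v = 0].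
Proof.
move=> pmap par cX [x0 Xx0].
have nd0 : ~ dep X finset.set0.
  move=> [p [_ nzp pX dp]]; case/eqP: nzp.
  have Ep : p = (p@_0)%:MP by apply: mderiv0_mpolyC => i; rewrite dp ?inE.
  by have := pX _ Xx0; rewrite Ep mevalC => ->; rewrite mpolyC0.
have nd0b : `[< ~ dep X finset.set0 >] by apply/asboolP.
pose S := [arg max_(S > (finset.set0 : {set 'I_n}) | `[< ~ dep X S >]) #|S|].
have [ndS maxS] : ~ dep X S /\ forall S', ~ dep X S' -> (#|S'| <= #|S|)%N.
  rewrite /S; case: arg_maxnP => // S1 /asboolP ndS1 max1; split=> // S' ndS'.
  by apply: max1; apply/asboolP.
exists S; split; first exact: indep_coord.
have /choice[P HP] : forall j : 'I_n, exists p : {mpoly K[n]}, j \notin S ->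
    [/\ homogeneous p, vanishes p X, ~ vanishes (p^`M(j)) X &
      forall i, i \notin j |: S -> p^`M(i) = 0].
  move=> j; have [jS|njS] := boolP (j \in S); first by exists 0.
  have /(dep_witness ndS)[p Hp] : dep X (j |: S); last by exists p.
  apply: contrapT => /maxS; rewrite cardsU1 njS add1n ltnn //.
pose f j s := if j \in S then 1 else ((P j)^`M(j)).@[psi s 0].
have pf j : polyfun (f j).
  rewrite /f; case: (j \in S); first exact: polyfun_cst.
  exact: (@polyfun_meval _ _ _ _ (fun i s => psi s 0 i)).
have nzf j : exists s, f j s != 0.
  rewrite /f; have [jS|njS] := boolP (j \in S); first by exists (fun=> 0); exact: oner_neq0.
  have [[d hP] PX nPX _] := HP j njS; apply: contra_notP nPX => none.
  have hPj : homogeneous ((P j)^`M(j)) by exists d.-1; apply: dhomog_deriv hP.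
  apply/(par _ hPj) => s; apply/eqP; apply: contra_notT none => nz; exists s; exact: nz.
exists (fun s => \prod_j f j s); split; first exact: polyfun_prod.
  elim: (index_enum _) => [|j r [s1 IHr]].
    by exists (fun=> 0); rewrite big_nil oner_neq0.
  have [s2 nz2] := nzf j.
  have pprod : polyfun (fun s => \prod_(j <- r) f j s) by apply: polyfun_prod.
  have [s [nz1 nz]] := polyfun_dense pprod (pf j) IHr nz2.
  by exists s; rewrite big_cons mulf_neq0.
move=> s /prodf_neq0 nzQ v Tv vS; apply/rowP=> j; rewrite mxE.
have [/vS//|njS] := boolP (j \in S).
have [hP PX _ dP] := HP j njS; have := Tv _ hP PX.
rewrite (bigD1 j) //= big1 ?addr0 => [/eqP|i ne_ij].
  rewrite mulf_eq0; have := nzQ j isT; rewrite /f (negPf njS) => /negPf-> /=.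
  by move/eqP.
have [/vS->|niS] := boolP (i \in S); first by rewrite mulr0.
by rewrite dP ?meval0 ?mul0r // !inE negb_or ne_ij.
Qed.

Section Multiaffine.
Variables (T : finType) (psi : (T -> K) -> 'rV[K]_n) (dpsi : T -> (T -> K) -> 'rV[K]_n).

Definition shift (s : T -> K) x t := fun y => s y + t * (y == x)%:R.

(** Sums of exterior products have this form with respect to the entries of
    their factors, which provides their partial derivatives dpsi without
    calculus. *)
Definition multiaffine := forall s x t, psi (shift s x t) = psi s + t *: dpsi x s.

(** The affine tangent space of a cone contains the point itself, hence the
    additional index. *)
Definition frame s (x : option T) := if x is Some y then dpsi y s else psi s.

Definition frame_mx s : 'M[K]_(#|{: option T}|, n) :=
  \matrix_(a < #|{: option T}|) frame s (enum_val a).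

(** Linear independence of the frame is stated through a dual family, so that it
    is checked by computing pairings. *)
Definition framed s := exists u : option T -> 'rV[K]_n,
  forall x y, pairing (frame s x) (u y) = (x == y)%:R.

Hypotheses (pmap : polymap psi) (maff : multiaffine).

Lemma polyfun_frame x i : polyfun (fun s => frame s x 0 i).
Proof.
case: x => [x|]; last exact: pmap.
have E s : frame s (Some x) 0 i = psi (shift s x 1) 0 i - psi s 0 i.
  by rewrite maff scale1r mxE [RHS]addrC addKr.
under eq_fun do rewrite E; apply: polyfunB => //.
apply: (polyfun_comp (f := fun s => psi s 0 i) (g := fun y s => shift s x 1 y)) => // y.
by apply: polyfunD; [exact: polyfun_var | exact: polyfun_cst].
Qed.

Lemma frame_tangent X s x : param psi X -> tangent_space X (psi s) (frame s x).
Proof.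
move=> par; apply: tangent_line => p hp pX t; have /(par p hp) psi0 := pX.
case: x => [x|] /=; first by rewrite -maff.
rewrite -[X in X + _]scale1r -scalerDl.
by have [d hd] := hp; rewrite (meval_homogZ _ _ hd) psi0 mulr0.
Qed.

Lemma generic_framed s0 : framed s0 -> exists Q : (T -> K) -> K,
  [/\ polyfun Q, exists s, Q s != 0 & forall s, Q s != 0 -> row_free (frame_mx s)].
Proof.
move=> [u Hu]; pose U : 'M[K]_(n, #|{: option T}|) := \matrix_(i, b) u (enum_val b) 0 i.
exists (fun s => \det (frame_mx s *m U)); split.
- apply: polyfun_det => a b; apply: polyfun_mulmx => i j.
    under eq_fun do rewrite mxE; exact: polyfun_frame.
  exact: polyfun_cst.
- exists s0; rewrite (_ : _ *m _ = 1%:M) ?det1 ?oner_neq0 //.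
  apply/matrixP=> a b; rewrite !mxE; under eq_bigr do rewrite !mxE.
  by have := Hu (enum_val a) (enum_val b); rewrite /pairing (inj_eq enum_val_inj).
- move=> s nzdet; have /row_freeP[B HB] : row_free (frame_mx s *m U).
    by rewrite row_free_unit unitmxE unitfE.
  by apply/row_freeP; exists (U *m B); rewrite mulmxA.
Qed.

Lemma rank_injective_colsub m (W : 'M[K]_(m, n)) (S : {set 'I_n}) :
  (forall v, (v <= W)%MS -> (forall i, i \in S -> v 0 i = 0) -> v = 0) ->
  (\rank W <= #|S|)%N.
Proof.
move=> inj; pose W' := row_base W; pose C := colsub (fun a : 'I_#|S| => enum_val a) W'.
have : row_free C.
  rewrite -kermx_eq0; apply/eqP/row_matrixP=> i; rewrite row0.
  set y := row i _; have yC : y *m C = 0.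
    by rewrite /y -row_mul mulmx_ker row0.
  have yW : y *m W' = 0.
    apply: inj => [|j jS]; first by rewrite (submx_trans (submxMl _ _)) ?eq_row_base.
    move/matrixP/(_ 0 (enum_rank_in jS j)): yC.
    rewrite mxE [X in _ = X -> _]mxE => yC; rewrite mxE -[RHS]yC.
    by apply: eq_bigr => k _; congr (_ * _); rewrite [RHS]mxE enum_rankK_in.
  by apply: (row_free_inj (row_base_free W)); rewrite mul0mx.
by move=> /eqP E; rewrite -E; apply: rank_leq_col.
Qed.

(** The tangent space contains the frame, hence has dimension at least one more
    than the number of parameters. It has dimension at most that of a set of
    independent coordinates, whose number is bounded by the parametrization. *)
Lemma framed_tangent X s0 : param psi X -> cone X -> X !=set0 -> framed s0 ->
  indep X #|T|.+1 /\ exists Q : (T -> K) -> K,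
    [/\ polyfun Q, exists s, Q s != 0 & forall s, Q s != 0 ->
      row_free (frame_mx s) /\
      forall v, tangent_space X (psi s) v <-> (v <= frame_mx s)%MS].
Proof.
move=> par cX X0 fr.
have [S [indS [Q [pQ [s1 Qs1] HQ]]]] := generic_tangent pmap par cX X0.
have [Q' [pQ' [s2 Qs2] HQ']] := generic_framed fr.
have Tfr s v : (v <= frame_mx s)%MS -> tangent_space X (psi s) v.
  by apply: tangent_mulmx => i; rewrite rowK; apply: frame_tangent.
have rkT s m (W : 'M_(m, n)) : Q s != 0 ->
    (forall i, tangent_space X (psi s) (row i W)) -> (\rank W <= #|S|)%N.
  move=> Qs TW; apply: rank_injective_colsub => v vW; apply: (HQ s Qs).
  exact: tangent_mulmx TW vW.
have rkf s : Q' s != 0 -> \rank (frame_mx s) = #|T|.+1.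
  by move=> /HQ' /eqP->; apply: card_option.
have cardS : #|S| = #|T|.+1.
  apply/eqP; rewrite eqn_leq (param_indep_le pmap par indS) /=.
  have [s [Qs Q's]] := polyfun_dense pQ pQ' Qs1 Qs2.
  rewrite -(rkf s Q's).
  by apply: (rkT s) => // i; rewrite rowK; apply: frame_tangent.
split; first by rewrite -cardS.
exists (fun s => Q s * Q' s); split; first exact: polyfunM.
  have [s [Qs Q's]] := polyfun_dense pQ pQ' Qs1 Qs2.
  by exists s; rewrite mulf_neq0.
move=> s; rewrite mulf_eq0 negb_or => /andP[Qs Q's]; split; first exact: HQ'.
move=> v; split=> [Tv|]; last exact: Tfr.
have rk1 : (\rank (col_mx (frame_mx s) v) <= \rank (frame_mx s))%N.
  rewrite (rkf s Q's) -cardS; apply: (rkT s) => // i.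
  rewrite -(splitK i); case: (split i) => j /=.
    by rewrite rowKu rowK; apply: frame_tangent.
  by rewrite rowKd (_ : row j v = v) //; apply/rowP=> k; rewrite mxE ord1.
have sub1 : (frame_mx s <= col_mx (frame_mx s) v)%MS.
  by rewrite -addsmxE addsmxSl.
have : (col_mx (frame_mx s) v <= frame_mx s)%MS.
  by rewrite -(geq_leqif (mxrank_leqif_sup sub1)).
by apply: submx_trans; rewrite -addsmxE addsmxSr.
Qed.

End Multiaffine.

End Tangent.

(** * Dimension and smoothness from a parametrization *)

Section Dimension.
Variables (K : numFieldType) (n : nat).
Implicit Types (X Z : set 'rV[K]_n) (v h : 'rV[K]_n) (p : {mpoly K[n]}).

(** Two forms not vanishing on the image of psi do not vanish at a common
    parameter. *)
Lemma irreducible_param (T : finType) (psi : (T -> K) -> 'rV[K]_n) X :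
  polymap psi -> param psi X -> proj_closed X -> X !=set0 -> irreducible_closed X.
Proof.
move=> pmap par clX X0; split=> // A B [SA hSA EA] [SB hSB EB] sub.
have wit (S : set {mpoly K[n]}) : S `<=` @homogeneous K n ->
    ~ X `<=` [set y : 'rV[K]_n | y != 0 /\ forall p, S p -> p.@[y 0] = 0] ->
    exists p s, S p /\ p.@[psi s 0] != 0.
  move=> hS; apply: contra_notP => none y Xy; split.
    by case: clX Xy => S' _ -> [].
  move=> p Sp; have hp := hS p Sp.
  suff /(par p hp) : forall s, p.@[psi s 0] = 0 by apply.
  by move=> s; apply/eqP; apply: contra_notT none => nz; exists p, s.
have [?|nA] := pselect (X `<=` A); [by left|right].
rewrite EB; apply: contrapT => nB.
have [p [s1 [Sp nzp]]] : exists p s, SA p /\ p.@[psi s 0] != 0.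
  by apply: (wit SA hSA); rewrite -EA.
have [q [s2 [Sq nzq]]] := wit SB hSB nB.
have pf (r : {mpoly K[n]}) : polyfun (fun s => r.@[psi s 0]).
  exact: (@polyfun_meval _ _ _ _ (fun i s => psi s 0 i)).
have [s [ps qs]] := polyfun_dense (pf p) (pf q) nzp nzq.
have hpq : homogeneous (p * q).
  have [d hp] := hSA p Sp; have [e hq] := hSB q Sq.
  by exists (d + e)%N; apply: dhomogM.
suff /(par _ hpq)/(_ s)/eqP : vanishes (p * q) X.
  by rewrite mevalM mulf_eq0 (negPf ps) (negPf qs).
move=> y /sub; rewrite EA EB mevalM => -[[_ h]|[_ h]].
  by rewrite (h p Sp) mul0r.
by rewrite (h q Sq) mulr0.
Qed.

Lemma param_image (T : finType) (psi : (T -> K) -> 'rV[K]_n) s0 :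
  psi s0 != 0 -> param psi (proj_closure [set y | y != 0 /\ exists s, y = psi s]).
Proof.
move=> nz0 p [d hp]; split=> [pX s|p0]; last first.
  by apply: vanishes_closure; [exists d | move=> _ [_ [s ->]]].
have in_cl s' : psi s' != 0 -> p.@[psi s' 0] = 0.
  by move=> nz; apply: pX; apply: sub_proj_closure => [_ []//|]; split=> //; exists s'.
have [E|/in_cl//] := eqVneq (psi s) 0.
by rewrite E -(scale0r (psi s0)) (meval_homogZ _ _ hp) in_cl // mulr0.
Qed.

Lemma param_mem (T : finType) (psi : (T -> K) -> 'rV[K]_n) X s :
  proj_closed X -> param psi X -> psi s != 0 -> X (psi s).
Proof.
move=> [S hS E] par nz; rewrite E; split=> // p Sp.
have pX : vanishes p X by rewrite E => y [_]; apply.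
by have /(par p (hS p Sp)) := pX.
Qed.

Section Flag.
Variables (T : finType) (psi : (T -> K) -> 'rV[K]_n) (dpsi : T -> (T -> K) -> 'rV[K]_n).
Hypotheses (pmap : polymap psi) (maff : multiaffine psi dpsi).
Variable s0 : T -> K.

(** The first i parameters vary and the others keep their value at s0: the
    images form a flag of irreducible subvarieties. The free parameters are
    numbered, so that the result is again a parametrization by a finite type. *)
Definition freeze i (s : 'I_i -> K) : T -> K :=
  fun y => if insub (enum_rank y : nat) is Some j then s j else s0 y.

Lemma freeze_shift i (le_iT : (i <= #|T|)%N) (s : 'I_i -> K) j t :
  freeze (shift s j t) = shift (freeze s) (enum_val (widen_ord le_iT j)) t.
Proof.
apply/funext => y; rewrite /freeze /shift.
case: insubP => [j' _ Ej'|niy]; last first.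
  case: eqP => [Ey|_]; last by rewrite mulr0 addr0.
  by case/negP: niy; rewrite Ey enum_valK /=.
congr (_ + _ * _%:R); congr nat_of_bool; apply/eqP/eqP => [Ej|Ey].
  by rewrite -(enum_rankK y) -Ej; congr enum_val; apply/val_inj => /=; rewrite Ej'.
by apply/val_inj; rewrite Ej' Ey enum_valK.
Qed.

Lemma freeze_start i (le_iT : (i <= #|T|)%N) :
  freeze (fun j : 'I_i => s0 (enum_val (widen_ord le_iT j))) = s0.
Proof.
apply/funext => y; rewrite /freeze; case: insubP => [j _ Ej|//].
congr s0; rewrite -[RHS]enum_rankK; congr enum_val.
exact/val_inj.
Qed.

Lemma freeze_widen i (lt_iT : (i < #|T|)%N) (s : 'I_i -> K) :
  freeze (fun j : 'I_i.+1 => freeze s (enum_val (widen_ord lt_iT j))) = freeze s.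
Proof.
apply/funext => y; rewrite {1}/freeze; case: insubP => [j _ Ej|]; last first.
  rewrite -leqNgt => lt_iy; rewrite /freeze insubF //.
  by apply/negbTE; rewrite -leqNgt ltnW.
congr freeze; rewrite -[RHS]enum_rankK; congr enum_val; exact/val_inj.
Qed.

Definition flag i : set 'rV[K]_n :=
  proj_closure [set y | y != 0 /\ exists s : 'I_i -> K, y = psi (freeze s)].

Hypothesis fr0 : framed psi dpsi s0.

Let nz0 : psi s0 != 0.
Proof.
have [u Hu] := fr0; have := Hu None None; rewrite eqxx /=.
case: eqVneq => // ->; rewrite /pairing big1 => [/eqP|j _]; last by rewrite mxE mul0r.
by rewrite eq_sym oner_eq0.
Qed.

(** The frame of the restricted parametrization is a part of the frame of
    psi. *)
Lemma flag_spec i : (i <= #|T|)%N -> [/\ polymap (fun s : 'I_i -> K => psi (freeze s)),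
  param (fun s : 'I_i -> K => psi (freeze s)) (flag i), flag i !=set0 & indep (flag i) i.+1].
Proof.
move=> le_iT; pose psi_i (s : 'I_i -> K) := psi (freeze s).
pose s1 (j : 'I_i) := s0 (enum_val (widen_ord le_iT j)).
have E1 : freeze s1 = s0 by apply: freeze_start.
have pmi : polymap psi_i.
  move=> k; apply: (polyfun_comp (f := fun s => psi s 0 k) (g := fun y s => freeze s y)) => // y.
  by rewrite /freeze; case: insub => [j|]; [exact: polyfun_var | exact: polyfun_cst].
have nz1 : psi_i s1 != 0 by rewrite /psi_i E1.
have pari : param psi_i (flag i) by apply: param_image nz1.
have ne : flag i !=set0.
  by exists (psi_i s1); apply: sub_proj_closure => [_ []//|]; split=> //; exists s1.
split=> //.
have mai : multiaffine psi_i (fun j s => dpsi (enum_val (widen_ord le_iT j)) (freeze s)).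
  by move=> s j t; rewrite /psi_i (freeze_shift le_iT) maff.
have := @framed_tangent _ _ _ psi_i _ pmi mai (flag i) s1 pari _ ne.
rewrite card_ord; case=> //.
  exact: (proj_closed_cone (@proj_closure_closed _ _ _)).
have [u Hu] := fr0; exists (fun a => u (omap (fun j => enum_val (widen_ord le_iT j)) a)).
move=> a b; rewrite -(inj_eq (f := omap (fun j => enum_val (widen_ord le_iT j)))); last first.
  by case=> [c|] [d|] //= [] /enum_val_inj/(congr1 val) /= E; congr Some; apply/val_inj.
by rewrite -Hu; case: a => [a|] /=; rewrite /psi_i E1.
Qed.

(** The flag of the frozen parametrizations is a chain of the right length, and
    a longer chain would give more independent forms than the parameters
    allow. *)
Theorem has_dim_param X : proj_closed X -> param psi X -> has_dim X #|T|.
Proof.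
move=> clX par; split; last first.
  by move/chain_indep/(param_indep_le pmap par); rewrite ltnn.
have sub_flag i : flag i `<=` X.
  move=> y [nzy hy]; case: (clX) => S hS E; rewrite E; split=> // p Sp.
  apply: hy; first exact: hS.
  move=> _ [_ [s ->]]; have pX : vanishes p X by rewrite E => z [_]; apply.
  by have /(par p (hS p Sp)) := pX.
exists flag; split=> [i le_iT|i lt_iT].
  have [pmi pari ne _] := flag_spec le_iT; split=> //.
  by apply: (irreducible_param pmi pari) => //; apply: proj_closure_closed.
split.
  apply: proj_closure_mono => y [nz [s E]]; split=> //.
  by exists (fun j => freeze s (enum_val (widen_ord lt_iT j))); rewrite freeze_widen.
move=> sub; have [_ _ _ /(indep_sub sub)] := flag_spec lt_iT.
have [pmi pari _ _] := flag_spec (ltnW lt_iT).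
by move/(param_indep_le pmi pari); rewrite card_ord ltnn.
Qed.

(** At a general parameter the tangent space is spanned by the frame, whose
    dimension is the expected one. *)
Theorem smooth_param X : proj_closed X -> param psi X ->
  exists Q : (T -> K) -> K, [/\ polyfun Q, exists s, Q s != 0 & forall s, Q s != 0 ->
    [/\ psi s != 0, smooth_point X (psi s) &
        forall v, tangent_space X (psi s) v <-> (v <= frame_mx psi dpsi s)%MS]].
Proof.
move=> clX par; have X0 : X !=set0 by exists (psi s0); apply: (param_mem clX par nz0).
have [_ [Q [pQ nQ HQ]]] := framed_tangent pmap maff par (proj_closed_cone clX) X0 fr0.
exists Q; split=> // s Qs; have [free_s HT] := HQ s Qs.
have nzs : psi s != 0.
  apply: contraTneq free_s => E; apply/negP => /row_freeP[B HB].
  pose a : 'I_#|{: option T}| := enum_rank None.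
  have : delta_mx 0 a *m (frame_mx psi dpsi s *m B) = 0 :> 'rV_ _.
    by rewrite mulmxA -rowE rowK /= enum_rankK /= E mul0mx.
  rewrite HB mulmx1 => /matrixP/(_ 0 a)/eqP; rewrite !mxE !eqxx /=.
  by rewrite oner_eq0.
split=> //; split; first exact: (param_mem clX par nzs).
exists #|T|; split; first exact: has_dim_param.
pose U := [tuple row i (frame_mx psi dpsi s) | i < #|{: option T}|].
have EUi (i : 'I_#|{: option T}|) : U`_i = row i (frame_mx psi dpsi s).
  by rewrite -tnth_nth tnth_mktuple.
exists <<U>>%VS.
have EU v : (v \in <<U>>%VS) = (v <= frame_mx psi dpsi s)%MS.
  apply/idP/idP => [/coord_span->|/submxP[c ->]].
    by apply: summx_sub => i _; apply: scalemx_sub; rewrite EUi row_sub.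
  rewrite mulmx_sum_row; apply: memv_suml => i _; apply: memvZ.
  by rewrite -EUi memv_span // mem_nth // size_tuple.
split; last by apply/seteqP; split=> v; rewrite /= EU => /HT.
have : free U.
  apply/freeP => k; under eq_bigr do rewrite EUi.
  have -> : \sum_i k i *: row i (frame_mx psi dpsi s) = (\row_i k i) *m frame_mx psi dpsi s.
    by rewrite mulmx_sum_row; apply: eq_bigr => i _; rewrite mxE.
  rewrite -[RHS](mul0mx _ (frame_mx psi dpsi s)) => /(row_free_inj free_s)/rowP E i.
  by have := E i; rewrite !mxE.
by rewrite /free => /eqP->; rewrite size_tuple; apply: card_option.
Qed.

End Flag.

End Dimension.

(** * Linear changes of coordinates *)

Section Homogeneity.
Variables (K : numFieldType) (n : nat).
Implicit Types (X Z : set 'rV[K]_n) (v h : 'rV[K]_n) (p : {mpoly K[n]}) (L : 'M[K]_n).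

Lemma form_mulmx p L : homogeneous p ->
  exists2 q, homogeneous q & forall y : 'rV[K]_n, q.@[y 0] = p.@[(y *m L) 0].
Proof.
move=> [d hp]; pose f (s : 'I_n -> K) := p.@[fun j => \sum_i s i * L i j].
have [||q hq Hq] := @polyfun_dhomog _ n d f.
- apply: (@polyfun_meval _ _ _ _ (fun j s => \sum_i s i * L i j)) => j.
  by apply: polyfun_sum => i; apply: polyfunM; [exact: polyfun_var | exact: polyfun_cst].
- move=> c s; rewrite /f -(meval_dhomog c _ hp); apply: meval_eq => j.
  by rewrite mulr_sumr; apply: eq_bigr => i _; rewrite mulrA.
- by exists q => [|y]; [exists d | rewrite -Hq; apply: meval_eq => j; rewrite mxE].
Qed.

Definition stable X L := forall y, X y -> X (y *m L).

(** Compare the first order terms of a form along the line through y and along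
    its image. *)
Lemma tangent_space_mulmx X L y v : stable X L ->
  tangent_space X y v -> tangent_space X (y *m L) (v *m L).
Proof.
move=> stX Tv p hp pX; have [q hq Hq] := form_mulmx L hp.
have qX : vanishes q X by move=> z Xz; rewrite Hq; apply/pX/stX.
have [r Hr] := meval_line p ((y *m L) 0) ((v *m L) 0).
have [r' Hr'] := meval_line q (y 0) (v 0).
apply: (poly_mulX_eq0 (r := r - r')) => t.
have : q.@[fun i => y 0 i + t * v 0 i] = p.@[fun i => (y *m L) 0 i + t * (v *m L) 0 i].
  transitivity (q.@[(y + t *: v) 0]); first by apply: meval_eq => i; rewrite !mxE.
  rewrite Hq mulmxDl -scalemxAl; apply: meval_eq => i.
  by rewrite [in LHS]mxE [X in _ + X]mxE.
rewrite Hr Hr' (Tv q hq qX) Hq hornerD hornerN; set a := \sum_i _.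
by move/eqP; rewrite mulr0 addr0 -addrA (inj_eq (addrI _)) => /eqP E; rewrite mulrBr E; ring.
Qed.

Lemma smooth_point_mulmx X L y : L \in unitmx -> stable X L -> stable X (invmx L) ->
  smooth_point X y -> smooth_point X (y *m L).
Proof.
move=> uL st st' [Xy [d [dimX [U [dimU TU]]]]]; split; first exact: st.
exists d; split=> //; exists (linfun (mulmxr L : 'rV[K]_n -> 'rV[K]_n) @: U)%VS; split.
  rewrite limg_dim_eq //; apply/eqP; rewrite -subv0; apply/subvP => v.
  rewrite memv_cap memv_ker lfunE /= memv0 => /andP[_ /eqP vL0].
  by rewrite -(mulmxK uL v) vL0 mul0mx.
apply/seteqP; split=> v /=.
  move=> /(tangent_space_mulmx st'); rewrite mulmxK //.
  rewrite TU /= => vU; apply/memv_imgP; exists (v *m invmx L) => //.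
  by rewrite lfunE /= mulmxKV.
move=> /memv_imgP[u uU ->]; rewrite lfunE /=; apply: tangent_space_mulmx => //.
by rewrite TU.
Qed.

Lemma stable_closure Z L : stable Z L -> L \in unitmx -> stable (proj_closure Z) L.
Proof.
move=> st uL y [nzy hy]; split.
  by apply: contra_neq nzy => E; rewrite -(mulmxK uL y) E mul0mx.
move=> p hp pZ; have [q hq Hq] := form_mulmx L hp.
by rewrite -Hq; apply: hy => // z Zz; rewrite Hq; apply/pZ/st.
Qed.

Lemma pairing_mulmx (h x : 'rV[K]_n) L : pairing (h *m L) x = pairing h (x *m L^T).
Proof.
rewrite /pairing; under eq_bigr do rewrite mxE mulr_suml.
rewrite exchange_big; apply: eq_bigr => i _ /=; rewrite mxE mulr_sumr.
by apply: eq_bigr => j _; rewrite mxE mulrA mulrAC.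
Qed.

Lemma pairingC (h x : 'rV[K]_n) : pairing h x = pairing x h.
Proof. by apply: eq_bigr => i _; rewrite mulrC. Qed.

Lemma pairing_sumr h I r (P : pred I) (F : I -> 'rV[K]_n) :
  pairing h (\sum_(i <- r | P i) F i) = \sum_(i <- r | P i) pairing h (F i).
Proof.
by rewrite exchange_big; apply: eq_bigr => j _; rewrite summxE mulr_sumr.
Qed.

Lemma pairing_submx h v m (W : 'M[K]_(m, n)) :
  (v <= W)%MS -> (forall i, pairing h (row i W) = 0) -> pairing h v = 0.
Proof.
move=> /submxP[c ->] h0; rewrite mulmx_sum_row pairing_sumr big1 // => i _.
rewrite -[RHS](mulr0 (c 0 i)) -(h0 i) /pairing mulr_sumr.
by apply: eq_bigr => j _; rewrite !mxE mulrCA.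
Qed.

Lemma pairingDr h (x y : 'rV[K]_n) a : pairing h (a *: x + y) = a * pairing h x + pairing h y.
Proof.
rewrite /pairing mulr_sumr -big_split; apply: eq_bigr => i _ /=.
by rewrite !mxE mulrDr mulrCA.
Qed.

End Homogeneity.

(** * Exterior products and compound matrices *)

Section Wedge.
Variables (K : fieldType).

Section CauchyBinet.
Variables (k n : nat).
Implicit Types (A B : 'M[K]_(k, n)).

(** Each injective family of k indices is an increasing one, permuted. *)
Lemma sum_injective_ffun (G : {ffun 'I_k -> 'I_n} -> K) :
  (forall f : {ffun _}, ~~ injectiveb f -> G f = 0) ->
  \sum_f G f = \sum_(t in increasing k n) \sum_(u : 'S_k) G [ffun i => tnth t (u i)].
Proof.
move=> G0; rewrite (bigID (fun f : {ffun _} => injectiveb f)) /= addrC big1 ?add0r //.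
pose le (i j : 'I_n) := (i <= j)%N.
have le_tr : transitive le by move=> ? ? ?; apply: leq_trans.
have le_anti : antisymmetric le by move=> i j /anti_leq/val_inj.
have le_tot : total le by move=> i j; apply: leq_total.
have incE (t : k.-tuple 'I_n) : (t \in increasing k n) = uniq t && sorted le t.
  by rewrite inE /= ltn_sorted_uniq_leq map_inj_uniq ?sorted_map //; apply: val_inj.
pose srt (f : {ffun 'I_k -> 'I_n}) := [tuple of sort le [tuple f i | i < k]].
rewrite (partition_big srt (fun t => t \in increasing k n)) => [|f /injectiveP injf]; last first.
  rewrite incE /= sort_uniq sort_sorted // andbT.
  by rewrite map_inj_uniq ?enum_uniq.
apply: eq_bigr => t; rewrite incE => /andP[ut st].
pose h (u : 'S_k) := [ffun i => tnth t (u i)].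
have injh : injective h.
  move=> u v /ffunP E; apply/permP => i; have := E i; rewrite !ffunE.
  by move/tuple_uniqP: ut; apply.
transitivity (\sum_(f in [set h u | u in [set: 'S_k]]%SET) G f); last first.
  by rewrite big_imset /= => [|? ? _ _ /injh//]; apply: eq_bigl => u; rewrite inE.
apply: eq_bigl => f; apply/andP/imsetP => [[/injectiveP injf /eqP Et]|[u _ ->]].
  have /tuple_permP[u Eu] : perm_eq [tuple f i | i < k] t by rewrite -Et perm_sym perm_sort.
  exists u => //; apply/ffunP=> i; rewrite ffunE.
  have /val_inj E : val [tuple f i | i < k] = val [tuple tnth t (u i) | i < k] by [].
  by move/(congr1 (fun s => tnth s i)): E; rewrite !tnth_mktuple.
split.
  apply/injectiveP => i j; rewrite !ffunE => E; apply: (@perm_inj _ u).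
  by move/tuple_uniqP: ut; apply.
apply/eqP/val_inj => /=; apply: (sorted_eq le_tr le_anti) => //; first exact: sort_sorted.
rewrite perm_sort; apply/tuple_permP; exists u; rewrite /=.
by apply: eq_map => i; rewrite ffunE.
Qed.

(** The Cauchy-Binet formula. *)
Lemma det_mul_tr A B : \det (A *m B^T) =
  \sum_(t in increasing k n) \det (colsub (tnth t) A) * \det (colsub (tnth t) B).
Proof.
pose G (f : {ffun 'I_k -> 'I_n}) := (\prod_i A i (f i)) * \det (colsub f B).
transitivity (\sum_f G f).
  rewrite /determinant.
  under eq_bigr do under eq_bigr do rewrite mxE.
  under eq_bigr do rewrite bigA_distr_bigA mulr_sumr.
  rewrite exchange_big /=; apply: eq_bigr => f _; rewrite /G -det_tr mulr_sumr.
  apply: eq_bigr => u _; rewrite big_split /= mulrCA; congr (_ * (_ * _)).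
  by apply: eq_bigr => i _; rewrite !mxE.
rewrite sum_injective_ffun => [|f /injectivePn[i [j ne_ij Eij]]]; last first.
  rewrite /G -det_tr (determinant_alternate ne_ij) ?mulr0 // => l.
  by rewrite !mxE Eij.
apply: eq_bigr => t _; rewrite [\det (colsub _ A)]/determinant mulr_suml; apply: eq_bigr => u _.
rewrite /G; have -> : colsub [ffun i => tnth t (u i)] B = col_perm u (colsub (tnth t) B).
  by apply/matrixP=> i j; rewrite !mxE ffunE.
rewrite col_permE det_mulmx det_perm odd_permV.
have -> : \prod_i A i ([ffun i => tnth t (u i)] i) = \prod_i colsub (tnth t) A i (u i).
  by apply: eq_bigr => i _; rewrite !mxE ffunE.
by rewrite [X in _ * X]mulrC mulrA; congr (_ * _); rewrite mulrC.
Qed.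

Lemma pairing_wedge A B : \sum_i wedge A 0 i * wedge B 0 i = \det (A *m B^T).
Proof.
rewrite det_mul_tr [RHS]big_enum_val.
by apply: eq_bigr => s _; rewrite !mxE.
Qed.

End CauchyBinet.

Definition setrow k n (A : 'M[K]_(k, n)) r (v : 'rV[K]_n) : 'M[K]_(k, n) :=
  \matrix_(i, j) if i == r then v 0 j else A i j.

Lemma setrowE k n (A : 'M[K]_(k, n)) r v i j :
  setrow A r v i j = if i == r then v 0 j else A i j.
Proof. exact: mxE. Qed.

Section Compound.
Variables (k n : nat).
Implicit Types (A B : 'M[K]_(k, n)) (g : 'M[K]_n).

(** The matrix of the k-th exterior power of g. *)
Definition compound g : 'M[K]_(pluecker_dim k n) :=
  \matrix_(s, t) \det (mxsub (tnth (enum_val s)) (tnth (enum_val t)) g).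

Lemma wedge_mulmx A g : wedge (A *m g) = wedge A *m compound g.
Proof.
apply/rowP=> t; rewrite !mxE.
have -> : colsub (tnth (enum_val t)) (A *m g) =
    A *m ((colsub (tnth (enum_val t)) g)^T)^T.
  by apply/matrixP=> i j; rewrite !mxE; apply: eq_bigr => l _; rewrite !mxE.
rewrite -pairing_wedge; apply: eq_bigr => s _; rewrite !mxE; congr (_ * _).
by rewrite -det_tr; congr (\det _); apply/matrixP=> i j; rewrite !mxE.
Qed.

Lemma compoundM g1 g2 : compound (g1 *m g2) = compound g1 *m compound g2.
Proof.
have E g s : row s (compound g) = wedge (rowsub (tnth (enum_val s)) g).
  apply/rowP=> t; rewrite !mxE; congr (\det _).
  by apply/matrixP=> i j; rewrite !mxE.
by apply/row_matrixP=> s; rewrite row_mul !E -wedge_mulmx mul_rowsub_mx.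
Qed.

Lemma compoundT g : compound g^T = (compound g)^T.
Proof.
apply/matrixP=> s t; rewrite !mxE -det_tr; congr (\det _).
by apply/matrixP=> i j; rewrite !mxE.
Qed.

Lemma compound1 : compound 1%:M = 1%:M.
Proof.
apply/matrixP=> s t; rewrite !mxE; case: eqP => [->|ne_st].
  rewrite (_ : mxsub _ _ _ = 1%:M) ?det1 //; apply/matrixP=> i j; rewrite !mxE.
  rewrite (inj_eq (f := tnth (enum_val t))) //.
  apply/tuple_uniqP; have := enum_valP t; rewrite inE /= ltn_sorted_uniq_leq.
  by case/andP => /map_uniq.
have /existsP[i nit] : [exists i, tnth (enum_val s) i \notin enum_val t].
  apply: contra_notT ne_st; rewrite negb_exists => /forallP st.
  apply: enum_val_inj; apply/val_inj/(inj_map val_inj).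
  have /andP[us _] : uniq (map val (enum_val s)) && sorted leq (map val (enum_val s)).
    by rewrite -ltn_sorted_uniq_leq; have := enum_valP s; rewrite inE.
  apply: (irr_sorted_eq ltn_trans ltnn); [exact: enum_valP s|exact: enum_valP t|].
  have sub : {subset map val (enum_val s) <= map val (enum_val t)}.
    move=> _ /mapP[j /tnthP[l ->] ->]; rewrite mem_map; last exact: val_inj.
    by have := st l; rewrite negbK.
  have [|_ E] := uniq_min_size us sub; first by rewrite !size_map !size_tuple.
  by move=> z; apply: E.
rewrite (expand_det_row _ i) big1 // => j _; rewrite !mxE.
case: eqP => [E|_]; last by rewrite mul0r.
by case/negP: nit; rewrite E mem_tnth.
Qed.

Lemma compound_unit g : g \in unitmx -> compound g \in unitmx.
Proof.
move=> ug; have := compoundM g (invmx g); rewrite mulmxV // compound1 => /esym.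
by case/mulmx1_unit.
Qed.

Lemma compoundV g : g \in unitmx -> compound (invmx g) = invmx (compound g).
Proof.
move=> ug; have uc := compound_unit ug.
by rewrite -[LHS]mulmx1 -(mulmxV uc) mulmxA -compoundM mulVmx // compound1 mul1mx.
Qed.

Lemma wedge_mul_det (R : 'M[K]_k) A : wedge (R *m A) = \det R *: wedge A.
Proof.
apply/rowP=> s; rewrite !mxE -det_mulmx; congr (\det _).
by apply/matrixP=> i j; rewrite !mxE; apply: eq_bigr => l _; rewrite !mxE.
Qed.

Lemma setrow_id A r : setrow A r (row r A) = A.
Proof. by apply/matrixP=> i j; rewrite !mxE; case: eqP => // ->. Qed.

Lemma setrow_mul m A r v (g : 'M[K]_(n, m)) : setrow A r v *m g = setrow (A *m g) r (v *m g).
Proof.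
apply/matrixP=> i j; rewrite !mxE; case: eqP => [->|/eqP ne].
  by apply: eq_bigr => l _; rewrite mxE eqxx.
by apply: eq_bigr => l _; rewrite mxE (negPf ne).
Qed.

Lemma wedge_setrowP A r a u v :
  wedge (setrow A r (a *: u + v)) = a *: wedge (setrow A r u) + wedge (setrow A r v).
Proof.
apply/rowP=> s; rewrite !mxE -[X in _ = _ + X]mul1r.
apply: (determinant_multilinear (i0 := r)).
- by apply/rowP=> j; rewrite !mxE eqxx mul1r.
- by apply/matrixP=> i j; rewrite !mxE eq_sym (negPf (neq_lift _ _)).
- by apply/matrixP=> i j; rewrite !mxE eq_sym (negPf (neq_lift _ _)).
Qed.

Lemma wedge_eq0 A r r' : r != r' -> row r A = row r' A -> wedge A = 0.
Proof.
move=> ne E; apply/rowP=> s; rewrite !mxE; apply: (determinant_alternate ne) => j.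
by move/rowP/(_ (tnth (enum_val s) j)): E; rewrite !mxE.
Qed.

End Compound.

End Wedge.

(** * Closed sets and parametrizations given by formulas *)

Section Covers.
Variables (K : numFieldType) (n : nat).
Implicit Types (X Z : set 'rV[K]_n) (v h : 'rV[K]_n) (p : {mpoly K[n]}).

(** Functions given by formulas rather than as polynomials define closed sets as
    well. *)
Definition isform (f : 'rV[K]_n -> K) :=
  exists2 p, homogeneous p & forall w : 'rV[K]_n, f w = p.@[w 0].

Lemma isform_polyfun d (f : 'rV[K]_n -> K) :
  polyfun (fun s : 'I_n -> K => f (\row_i s i)) ->
  (forall c w, f (c *: w) = c ^+ d * f w) -> isform f.
Proof.
move=> pf hf; have [|p hp Hp] := polyfun_dhomog (d := d) pf.
  by move=> c s; rewrite -hf; congr f; apply/rowP=> i; rewrite !mxE.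
exists p => [|w]; first by exists d.
by rewrite -Hp; congr f; apply/rowP=> i; rewrite mxE.
Qed.

Lemma proj_closed_forms (I : Type) (f : I -> 'rV[K]_n -> K) : (forall i, isform (f i)) ->
  proj_closed [set w : 'rV[K]_n | w != 0 /\ forall i, f i w = 0].
Proof.
move=> ff; exists [set p | homogeneous p /\ exists i, forall w : 'rV[K]_n, f i w = p.@[w 0]].
  by move=> p [].
apply/seteqP; split=> w [nzw hw]; split=> //.
  by move=> p [_ [i <-]].
by move=> i; have [p hp Hp] := ff i; rewrite Hp; apply: hw; split=> //; exists i.
Qed.

Lemma proj_closure_id Z : proj_closed Z -> proj_closure Z = Z.
Proof.
move=> [S hS E]; apply/seteqP; split; last first.
  by apply: sub_proj_closure => y; rewrite E => -[].
move=> y [nzy hy]; rewrite E; split=> // p Sp; apply: hy; first exact: hS.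
by move=> z; rewrite E => -[_]; apply.
Qed.

(** A parametrization psi of a dense part of the image of phi, up to scaling, is
    enough. *)
Lemma param_cover (I T : finType) (phi : (I -> K) -> 'rV[K]_n) (psi : (T -> K) -> 'rV[K]_n)
    X (D : (I -> K) -> K) a :
  param phi X -> polymap phi -> (forall u, exists s, psi u = phi s) ->
  polyfun D -> D a != 0 -> (forall s, D s != 0 -> exists c u, phi s = c *: psi u) ->
  param psi X.
Proof.
move=> par pmap sub pD Da cov p hp; split=> [/(par p hp) phi0 u|psi0].
  by have [s ->] := sub u; apply: phi0.
apply/(par p hp); have pp : polyfun (fun s => p.@[phi s 0]).
  exact: (@polyfun_meval _ _ _ _ (fun i s => phi s 0 i)).
apply: (polyfun_eq0 pp pD Da) => s /cov[c [u ->]].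
by have [d hd] := hp; rewrite (meval_homogZ _ _ hd) psi0 mulr0.
Qed.

End Covers.

(** * Hyperplanes as alternating forms *)

Section Contraction.
Variables (K : numFieldType) (k n : nat).
Implicit Types (A : 'M[K]_(k, n)) (f : 'I_k -> 'I_n).
Local Notation N := (pluecker_dim k n).
Implicit Types (h w : 'rV[K]_N).

(** The alternating form with coefficients h, evaluated at the rows of A. *)
Definition ev h A := pairing h (wedge A).

(** The hyperplane h contains the affine tangent space of the Grassmannian at
    wedge A, which is spanned by the exterior products of A with one row
    replaced. *)
Definition tang h A := forall r v, ev h (setrow A r v) = 0.

Lemma ev_mulmx h A g : ev (h *m compound k g) A = ev h (A *m g^T).
Proof. by rewrite /ev pairing_mulmx -compoundT -wedge_mulmx. Qed.

Lemma ev_wedge A B : ev (wedge A) B = \det (A *m B^T).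
Proof. exact: pairing_wedge. Qed.

(** The action on hyperplanes is contragredient to the action on points; using
    the transpose instead of the inverse keeps the formula polynomial. *)
Lemma tang_mulmx h A g : g \in unitmx -> tang (h *m compound k g) A <-> tang h (A *m g^T).
Proof.
move=> ug; split=> th r v; last by rewrite ev_mulmx setrow_mul; apply: th.
have ugT : g^T \in unitmx by rewrite unitmx_tr.
by rewrite -(mulmxKV ugT v) -setrow_mul -ev_mulmx.
Qed.

Lemma ev_setrowP h A r a u v :
  ev h (setrow A r (a *: u + v)) = a * ev h (setrow A r u) + ev h (setrow A r v).
Proof. by rewrite /ev wedge_setrowP pairingDr. Qed.

Lemma ev_setrow0 h A r : ev h (setrow A r 0) = 0.
Proof. by have := ev_setrowP h A r (-1) 0 0; rewrite scaler0 addr0 mulN1r addNr. Qed.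

Lemma tang_ev h A (r : 'I_k) : tang h A -> ev h A = 0.
Proof. by move=> th; rewrite -(setrow_id A r); apply: th. Qed.

Lemma evD h h' A : ev (h + h') A = ev h A + ev h' A.
Proof.
rewrite /ev /pairing -big_split; apply: eq_bigr => i _ /=.
by rewrite [(h + h') 0 i]mxE mulrDl.
Qed.

Lemma evZ c w A : ev (c *: w) A = c * ev w A.
Proof. by rewrite /ev /pairing mulr_sumr; apply: eq_bigr => i _; rewrite mxE mulrA. Qed.

Lemma evN h A : ev (- h) A = - ev h A.
Proof. by rewrite -scaleN1r evZ mulN1r. Qed.

Lemma tangD h h' A : tang h A -> tang h' A -> tang (h + h') A.
Proof. by move=> t t' r v; rewrite evD t t' addr0. Qed.

Lemma tangZ c h A : tang h A -> tang (c *: h) A.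
Proof. by move=> t r v; rewrite evZ t mulr0. Qed.

Lemma tangN h A : tang h A -> tang (- h) A.
Proof. by move=> t r v; rewrite evN t oppr0. Qed.

Lemma wedge_std (s : 'I_N) : wedge (rowsub (tnth (enum_val s)) 1%:M) = delta_mx 0 s :> 'rV[K]_N.
Proof.
apply/rowP=> t; have /matrixP/(_ s t) := compound1 K k n; rewrite !mxE eq_sym /= => <-.
by congr (\det _); apply/matrixP=> i j; rewrite !mxE.
Qed.

Lemma pairing_delta h s : pairing h (delta_mx 0 s) = h 0 s.
Proof.
rewrite /pairing (bigD1 s) //= mxE !eqxx mulr1 big1 ?addr0 // => j ne.
by rewrite mxE (negPf ne) andbF mulr0.
Qed.

Lemma ev_eq0 h : (forall f, ev h (rowsub f 1%:M) = 0) -> h = 0.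
Proof.
move=> h0; apply/rowP=> s; rewrite mxE -(pairing_delta h s) -wedge_std.
exact: h0.
Qed.

Lemma ev_rowsub A f : ev (wedge A) (rowsub f 1%:M) = \det (colsub f A).
Proof.
rewrite ev_wedge; congr (\det _); apply/matrixP=> i j; rewrite mxE (bigD1 (f j)) //=.
rewrite !mxE eqxx mulr1 big1 ?addr0 // => l ne; rewrite !mxE eq_sym (negPf ne).
by rewrite mulr0.
Qed.

Lemma wedge_neq0 A : wedge A != 0 -> exists f, \det (colsub f A) != 0.
Proof.
move=> nz; have [//|none] := pselect (exists f, \det (colsub f A) != 0).
case/eqP: nz; apply: ev_eq0 => f; rewrite ev_rowsub; apply/eqP.
by apply: contra_notT none => ?; exists f.
Qed.

Lemma wedge_neq0_colsub f A : \det (colsub f A) != 0 -> wedge A != 0.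
Proof.
apply: contra_neq => A0; rewrite -ev_rowsub A0 /ev /pairing big1 // => i _.
by rewrite mxE mul0r.
Qed.

(** The contractions of w with all but one of the coordinates of f; they span
    the subspace of w when w is decomposable and its coordinate at f does not
    vanish. *)
Definition contraction f w : 'M[K]_(k, n) :=
  \matrix_(r, c) ev w (setrow (rowsub f 1%:M) r (delta_mx 0 c)).

Lemma det_setrow m (M : 'M[K]_m) r v : \det (setrow M r v) = \sum_j v 0 j * cofactor M r j.
Proof.
rewrite (expand_det_row _ r); apply: eq_bigr => j _; rewrite mxE eqxx; congr (_ * _).
rewrite /cofactor; congr (_ * \det _); apply/matrixP=> a b; rewrite !mxE.
by rewrite eq_sym (negPf (neq_lift _ _)).
Qed.

Lemma contraction_wedge f A : contraction f (wedge A) = \adj (colsub f A) *m A.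
Proof.
apply/matrixP=> r c; rewrite !mxE ev_wedge -det_tr trmx_mul trmxK setrow_mul det_setrow.
apply: eq_bigr => j _; rewrite mulrC; congr (_ * _).
  rewrite [in RHS]mxE -cofactor_tr; congr (cofactor _ _ _); apply/matrixP=> a b.
  rewrite !mxE (bigD1 (f b)) //= !mxE eqxx mul1r big1 ?addr0 // => l ne.
  by rewrite !mxE eq_sym (negPf ne) mul0r.
rewrite mxE (bigD1 c) //= !mxE !eqxx mul1r big1 ?addr0 // => l ne.
by rewrite !mxE (negPf ne) andbF mul0r.
Qed.

End Contraction.

(** * Charts for sums of exterior products *)

Section Charts.
Variables (K : numFieldType) (q k n : nat).
Variables (E : 'I_q -> 'M[K]_(k, n)) (a : pred ('I_q * 'I_k * 'I_n)) (g : 'M[K]_n).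
Local Notation T := {x | a x}.
Local Notation N := (pluecker_dim k n).

(** Varying some entries only removes the redundancy due to row operations, so
    that the parameters can be as many as the dimension. *)
Definition chart (s : T -> K) i : 'M[K]_(k, n) :=
  \matrix_(r, c) if insub (i, r, c) is Some x then s x else E i r c.

Definition chart_sum s : 'rV[K]_N := \sum_i wedge (chart s i *m g).

Definition chart_dsum (x : T) s : 'rV[K]_N :=
  wedge (setrow (chart s (val x).1.1) (val x).1.2 (delta_mx 0 (val x).2) *m g).

Definition chart_origin (x : T) := E (val x).1.1 (val x).1.2 (val x).2.

Lemma chart_originE : chart chart_origin = E.
Proof.
apply/funext => i; apply/matrixP=> r c; rewrite mxE.
by case: insubP => [x _|//]; rewrite /chart_origin => ->.
Qed.

Lemma polyfun_wedge (U : finType) (M : (U -> K) -> 'M[K]_(k, n)) i :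
  (forall r c, polyfun (fun s => M s r c)) -> polyfun (fun s => wedge (M s) 0 i).
Proof.
move=> pM; under eq_fun do rewrite mxE; apply: polyfun_det => r c.
by under eq_fun do rewrite mxE.
Qed.

Lemma polymap_chart_sum : polymap chart_sum.
Proof.
move=> j; under eq_fun do rewrite summxE; apply: polyfun_sum => i.
apply: polyfun_wedge => r c; apply: polyfun_mulmx => [r' c'|r' c'].
  under eq_fun do rewrite mxE; case: insub => [x|]; last exact: polyfun_cst.
  exact: polyfun_var.
exact: polyfun_cst.
Qed.

Lemma multiaffine_chart : multiaffine chart_sum chart_dsum.
Proof.
move=> s x t; pose i0 := (val x).1.1; pose r0 := (val x).1.2; pose c0 := (val x).2.
have Ex : val x = (i0, r0, c0) by rewrite /i0 /r0 /c0; case: (val x) => [[]].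
have Echart i : chart (shift s x t) i = if i == i0 then
    setrow (chart s i) r0 (t *: delta_mx 0 c0 + row r0 (chart s i)) else chart s i.
  apply/matrixP=> r c; rewrite [LHS]mxE; case: insubP => [y _ Ey|nir].
    have -> : (if i == i0 then setrow (chart s i) r0 (t *: delta_mx 0 c0 + row r0 (chart s i))
        else chart s i) r c = chart s i r c + t * ((i, r, c) == (i0, r0, c0))%:R.
      rewrite !xpair_eqE; case: (i == i0); last by rewrite /= mulr0 addr0.
      rewrite mxE; case: eqP => [->|_]; last by rewrite /= mulr0 addr0.
      by rewrite !mxE eqxx /= addrC.
    rewrite mxE -Ey valK /shift -(inj_eq val_inj) Ex; congr (_ + _).
  case: eqP => [Ei|_]; last by rewrite mxE insubF //; apply/negbTE.
  rewrite !mxE; case: eqP => [Er|_]; last by rewrite insubF //; apply/negbTE.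
  rewrite !eqxx /= -Er insubF; last exact/negbTE.
  case: eqP => [Ec|_]; last by rewrite mulr0 add0r.
  by case/negP: nir; rewrite Ei Er Ec -Ex (valP x).
rewrite /chart_sum (bigD1 i0) //= [in RHS](bigD1 i0) //= Echart eqxx.
rewrite setrow_mul mulmxDl -scalemxAl wedge_setrowP -!setrow_mul setrow_id.
rewrite (eq_bigr (fun i => wedge (chart s i *m g))) => [|i /negPf ne].
  by rewrite -addrA addrC.
by rewrite Echart ne.
Qed.

End Charts.

Section OneChart.
Variables (K : numFieldType) (k n : nat).
Variables (E : 'M[K]_(k, n)) (a : pred ('I_1 * 'I_k * 'I_n)) (g : 'M[K]_n).
Hypotheses (E1 : E *m E^T = 1%:M) (Ea : forall i r c r', a (i, r, c) -> E r' c = 0).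
Hypothesis ug : g \in unitmx.

Local Notation T := {x | a x}.
Local Notation E_ := (fun _ : 'I_1 => E).

Lemma chart_sum1 (s : T -> K) : chart_sum E_ g s = wedge (chart E_ s ord0 *m g).
Proof. by rewrite /chart_sum big_ord1. Qed.

Let W (x : option T) : 'M[K]_(k, n) :=
  if x is Some y then setrow E (val y).1.2 (delta_mx 0 (val y).2) else E.

Let frameE x : frame (chart_sum E_ g) (chart_dsum E_ g) (chart_origin E_ (a := a)) x = wedge (W x *m g).
Proof.
case: x => [x|] /=; last by rewrite chart_sum1 chart_originE.
by rewrite /chart_dsum chart_originE.
Qed.

Let EE r r' : \sum_l E r l * E r' l = (r == r')%:R.
Proof. by move/matrixP/(_ r r'): E1; rewrite !mxE => <-; apply: eq_bigr => l _; rewrite mxE. Qed.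

Let Ee (x : T) r : \sum_l E r l * (delta_mx 0 (val x).2 : 'rV[K]_n) 0 l = 0.
Proof.
apply: big1 => l _; rewrite mxE eqxx /=; case: eqP => [->|_]; rewrite ?mulr0 // mulr1.
by case: x => [[[i r'] c] ax] /=; apply: Ea ax.
Qed.

Let eE (x : T) r : \sum_l (delta_mx 0 (val x).2 : 'rV[K]_n) 0 l * E r l = 0.
Proof. by rewrite -[RHS](Ee x r); apply: eq_bigr => l _; rewrite mulrC. Qed.

Let ee (x y : T) : \sum_l (delta_mx 0 (val x).2 : 'rV[K]_n) 0 l *
  (delta_mx 0 (val y).2 : 'rV[K]_n) 0 l = ((val x).2 == (val y).2)%:R.
Proof.
rewrite (bigD1 (val x).2) //= big1 => [|l ne]; rewrite !mxE ?eqxx ?mul1r ?addr0 //.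
by rewrite (negPf ne) andbF mul0r.
Qed.

Let det_row0 (M : 'M[K]_k) r : (forall j, M r j = 0) -> \det M = 0.
Proof. by move=> M0; rewrite (expand_det_row _ r) big1 // => j _; rewrite M0 mul0r. Qed.

Let WE x y i j : (W x *m (W y)^T) i j = \sum_l W x i l * W y j l.
Proof. by rewrite mxE; apply: eq_bigr => l _; rewrite [X in _ * X]mxE. Qed.

Let gram x y : \det (W x *m (W y)^T) = (x == y)%:R.
Proof.
case: x y => [x|] [y|]; last by rewrite /= E1 det1.
- have [Er|ne_r] := eqVneq (val x).1.2 (val y).1.2; last first.
    rewrite (@det_row0 _ (val y).1.2) => [|j].
      by case: eqP => // -[E0]; rewrite E0 eqxx in ne_r.
    rewrite WE /=; under eq_bigr do rewrite !setrowE eq_sym (negPf ne_r).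
    have [Ej|ne_j] := eqVneq j (val y).1.2; first by rewrite Ee.
    by rewrite EE eq_sym (negPf ne_j).
  set r := (val x).1.2 in Er; pose d : K := ((val x).2 == (val y).2)%:R.
  have -> : W (Some x) *m (W (Some y))^T = setrow 1%:M r (d *: row r 1%:M).
    apply/matrixP=> i j; rewrite WE /= -Er -/r [RHS]setrowE.
    under eq_bigr do rewrite !setrowE.
    have [Ei|ne_i] := eqVneq i r; have [Ej|ne_j] := eqVneq j r.
    - by rewrite ee Ej !mxE eqxx mulr1.
    - by rewrite eE !mxE eq_sym (negPf ne_j) mulr0.
    - by rewrite Ee !mxE Ej (negPf ne_i).
    - by rewrite EE !mxE.
  rewrite det_setrow; under eq_bigr do rewrite mxE -mulrA.
  rewrite -mulr_sumr -det_setrow setrow_id det1 mulr1 /d; congr (_%:R); congr nat_of_bool.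
  apply/eqP/eqP => [Ec|[->//]]; congr Some; apply/val_inj.
  move: Er Ec; rewrite /r; case: (val x) (val y) => [[i1 r1] c1] [[i2 r2] c2] /= -> ->.
  by rewrite (ord1 i1) (ord1 i2).
- rewrite (@det_row0 _ (val x).1.2) // => j.
  by rewrite WE /=; under eq_bigr do rewrite setrowE eqxx; rewrite eE.
- rewrite -det_tr (@det_row0 _ (val y).1.2) // => j.
  by rewrite mxE WE /=; under eq_bigr do rewrite setrowE eqxx; rewrite Ee.
Qed.

(** The frame consists of exterior products of orthonormal systems of vectors,
    hence is orthonormal itself by the Cauchy-Binet formula. *)
Lemma framed_chart : framed (chart_sum E_ g) (chart_dsum E_ g) (chart_origin E_ (a := a)).
Proof.
exists (fun x => wedge (W x *m (invmx g)^T)) => x y; rewrite frameE -gram -ev_wedge /ev.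
rewrite !wedge_mulmx pairing_mulmx -mulmxA -compoundT -compoundM -trmx_mul mulmxV //.
by rewrite trmx1 compound1 mulmx1.
Qed.

End OneChart.

(** * Grassmannians *)

Section Grassmannian.
Variables (K : numFieldType) (k n : nat).
Local Notation N := (pluecker_dim k.+1 n).
Local Notation G := (grassmannian K k.+1 n).
Implicit Types (A : 'M[K]_(k.+1, n)) (f : 'I_k.+1 -> 'I_n) (h w : 'rV[K]_N).

Lemma wedge_setrowZ A r c : wedge (setrow A r (c *: row r A)) = c *: wedge A.
Proof.
have := wedge_setrowP A r (c - 1) (row r A) (row r A).
by rewrite -{2}[row r A]scale1r -scalerDl subrK setrow_id -{2}[wedge A]scale1r -scalerDl subrK.
Qed.

Lemma wedge_neq0_row_free A : wedge A != 0 -> row_free A.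
Proof.
case/wedge_neq0 => f nzd; have uC : colsub f A \in unitmx by rewrite unitmxE unitfE.
apply/row_freeP; exists ((rowsub f 1%:M)^T *m invmx (colsub f A)).
rewrite mulmxA (_ : A *m _ = colsub f A) ?mulmxV //.
apply/matrixP=> i j; rewrite !mxE (bigD1 (f j)) //= !mxE eqxx mulr1 big1 ?addr0 // => l ne.
by rewrite !mxE eq_sym (negPf ne) mulr0.
Qed.

Lemma polyfun_ev (T : finType) (w : (T -> K) -> 'rV[K]_N) (A : (T -> K) -> 'M[K]_(k.+1, n)) :
  (forall i, polyfun (fun s => w s 0 i)) -> (forall r c, polyfun (fun s => A s r c)) ->
  polyfun (fun s => ev (w s) (A s)).
Proof.
by move=> pw pA; apply: polyfun_sum => i; apply: polyfunM => //; apply: polyfun_wedge.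
Qed.

Lemma rowZE c w i : (c *: w) 0 i = c * w 0 i.
Proof. exact: mxE. Qed.

Lemma contractionZ f c w : contraction f (c *: w) = c *: contraction f w.
Proof. by apply/matrixP=> i j; rewrite !mxE evZ. Qed.

Lemma wedgeZ c A : wedge (c *: A) = c ^+ k.+1 *: wedge A.
Proof. by rewrite -mul_scalar_mx wedge_mul_det det_scalar. Qed.

(** The equations of the Grassmannian: w is proportional to the exterior product
    of its contractions with the coordinates of f. The factors make both terms
    homogeneous. *)
Definition pluecker_form (x : ('I_k.+1 -> 'I_n) * 'I_N) (w : 'rV[K]_N) :=
  ev w (rowsub x.1 1%:M) ^+ k.+1 * w 0 x.2
    - ev w (rowsub x.1 1%:M) * wedge (contraction x.1 w) 0 x.2.

Lemma isform_pluecker x : isform (pluecker_form x).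
Proof.
have pr i : polyfun (fun s : 'I_N -> K => (\row_i s i) 0 i).
  by under eq_fun do rewrite mxE; apply: polyfun_var.
have pe (B : 'M[K]_(k.+1, n)) : polyfun (fun s : 'I_N -> K => ev (\row_i s i) B).
  by apply: polyfun_ev => // r c; apply: polyfun_cst.
apply: (isform_polyfun (d := k.+2)); last first.
  move=> c w; rewrite /pluecker_form contractionZ wedgeZ evZ exprMn !rowZE.
  rewrite [c ^+ k.+2]exprSr; ring.
apply: polyfunB; first by apply: polyfunM => //; apply: polyfunX.
apply: polyfunM => //; apply: polyfun_wedge => r c.
by under eq_fun do rewrite mxE.
Qed.

Lemma pluecker_form_wedge x A : pluecker_form x (wedge A) = 0.
Proof.
case: x => f s; rewrite /pluecker_form /= ev_rowsub contraction_wedge wedge_mul_det rowZE.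
apply/eqP; rewrite subr_eq0 mulrA; apply/eqP; congr (_ * _).
by rewrite -det_mulmx mul_mx_adj det_scalar.
Qed.

Lemma pluecker_coord_neq0 w : w != 0 -> exists f, ev w (rowsub f 1%:M) != 0.
Proof.
move=> nz; have [//|none] := pselect (exists f, ev w (rowsub f 1%:M) != 0).
case/eqP: nz; apply: ev_eq0 => f; apply/eqP.
by apply: contra_notT none => ?; exists f.
Qed.

(** Up to a power of the coordinate at f, which is absorbed by a row, w is the
    exterior product of its contractions. *)
Lemma decomposable w f : (forall s, pluecker_form (f, s) w = 0) ->
  ev w (rowsub f 1%:M) != 0 -> exists A, w = wedge A.
Proof.
move=> w0 nz; set c := ev w _ in nz.
have E : wedge (contraction f w) = c ^+ k *: w.
  apply/rowP=> s; rewrite rowZE; apply: (mulfI nz); rewrite mulrA -exprS.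
  by apply/eqP; rewrite -subr_eq0 -oppr_eq0 opprB; apply/eqP/w0.
exists (setrow (contraction f w) ord0 (c ^- k *: row ord0 (contraction f w))).
by rewrite wedge_setrowZ E scalerA mulVf ?scale1r // expf_neq0.
Qed.

Lemma grassmannianE :
  G = [set w : 'rV[K]_N | w != 0 /\ forall x, pluecker_form x w = 0].
Proof.
apply/seteqP; split=> [w [nz [A E]]|w [nz w0]]; split=> //.
  by move=> x; rewrite E pluecker_form_wedge.
by have [f nzf] := pluecker_coord_neq0 nz; apply: decomposable nzf.
Qed.

Lemma grassmannian_closed : proj_closed G.
Proof. by rewrite grassmannianE; apply/proj_closed_forms/isform_pluecker. Qed.

Lemma stable_grassmannian (g : 'M[K]_n) : g \in unitmx -> stable G (compound k.+1 g).
Proof.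
move=> ug w [nz [A E]]; split; last by exists (A *m g); rewrite wedge_mulmx -E.
by apply: contra_neq nz => E0; rewrite -(mulmxK (compound_unit k.+1 ug) w) E0 mul0mx.
Qed.

Lemma wedge_mulmx_neq0 A (g : 'M[K]_n) : g \in unitmx -> wedge A != 0 -> wedge (A *m g) != 0.
Proof.
move=> ug; apply: contra_neq; rewrite wedge_mulmx => E0.
by rewrite -(mulmxK (compound_unit k.+1 ug) (wedge A)) E0 mul0mx.
Qed.

Definition mat_of (s : 'I_k.+1 * 'I_n -> K) : 'M[K]_(k.+1, n) := \matrix_(r, c) s (r, c).

Lemma mat_ofK A : mat_of (fun x => A x.1 x.2) = A.
Proof. by apply/matrixP=> r c; rewrite mxE. Qed.

Lemma polymap_wedge : polymap (fun s => wedge (mat_of s)).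
Proof.
move=> i; apply: polyfun_wedge => r c.
by under eq_fun do rewrite mxE; apply: polyfun_var.
Qed.

Lemma param_grassmannian : (k < n)%N -> param (fun s => wedge (mat_of s)) G.
Proof.
move=> ltkn; rewrite -(proj_closure_id grassmannian_closed).
pose A : 'M[K]_(k.+1, n) := rowsub (widen_ord ltkn) 1%:M.
have nzA : wedge A != 0.
  apply: (@wedge_neq0_colsub _ _ _ (widen_ord ltkn)).
  rewrite (_ : colsub _ _ = 1%:M) ?det1 ?oner_neq0 //.
  by apply/matrixP=> i j; rewrite !mxE (inj_eq (f := widen_ord ltkn)) // => ? ? [] /val_inj.
have := @param_image _ _ _ (fun s => wedge (mat_of s)) (fun x => A x.1 x.2).
rewrite mat_ofK => /(_ nzA); congr (param _ (proj_closure _)).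
apply/seteqP; split=> w [nz [y E]]; split=> //; first by exists (mat_of y).
by exists (fun x => y x.1 x.2); rewrite mat_ofK.
Qed.

End Grassmannian.

Lemma row_free_pid (F : fieldType) k m (A : 'M[F]_(k, k + m)) : row_free A ->
  exists2 U, U \in unitmx & A = pid_mx k *m U.
Proof.
move=> /eqP rkA; pose D := block_mx (col_ebase A) 0 0 (1%:M : 'M_m).
exists (D *m row_ebase A).
  rewrite unitmx_mul row_ebase_unit andbT unitmxE det_ublock det1 mulr1 -unitmxE.
  exact: col_ebase_unit.
rewrite -{1}(mulmx_ebase A) rkA mulmxA; congr (_ *m _).
by rewrite pid_mx_row mul_mx_row mul_row_block !mulmx0 !mul0mx !mul1mx !addr0 mulmx1.
Qed.

(** By Gaussian elimination both are in the orbit of the partial identity. *)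
Lemma row_free_transitive (F : fieldType) k m (A B : 'M[F]_(k, k + m)) :
  row_free A -> row_free B -> exists2 g, g \in unitmx & A = B *m g.
Proof.
move=> /row_free_pid[U uU ->] /row_free_pid[V uV ->].
exists (invmx V *m U); first by rewrite unitmx_mul unitmx_inv uV.
by rewrite mulmxA mulmxK.
Qed.

Lemma chart_fill (K : numFieldType) q k n (E B : 'I_q -> 'M[K]_(k, n))
    (a : pred ('I_q * 'I_k * 'I_n)) :
  (forall i r c, ~~ a (i, r, c) -> B i r c = E i r c) ->
  chart E (chart_origin B (a := a)) = B.
Proof.
move=> EB; apply/funext => i; apply/matrixP=> r c; rewrite mxE.
by case: insubP => [x _ Ex|/EB //]; rewrite /chart_origin Ex.
Qed.

Section TangentGrassmannian.
Variables (K : numFieldType) (k m : nat).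
Local Notation n := (k.+1 + m)%N.
Local Notation N := (pluecker_dim k.+1 n).
Local Notation G := (grassmannian K k.+1 n).
Implicit Types (A : 'M[K]_(k.+1, n)) (h w : 'rV[K]_N).

Let f0 : 'I_k.+1 -> 'I_n := lshift m.
Let E0 : 'M[K]_(k.+1, n) := rowsub f0 1%:M.
Let a0 : pred ('I_1 * 'I_k.+1 * 'I_n) := fun x => (k < x.2)%N.
Let psi := chart_sum (fun _ => E0) 1%:M (a := a0).
Let dpsi := chart_dsum (fun _ => E0) 1%:M (a := a0).

Let param_chart : param psi G.
Proof.
have colE : colsub f0 E0 = 1%:M.
  by apply/matrixP=> i j; rewrite !mxE (inj_eq (@lshift_inj _ _)).
apply: (@param_cover _ _ _ _ (fun s => wedge (mat_of s)) psi G
  (fun s => \det (colsub f0 (mat_of s))) (fun x => E0 x.1 x.2)).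
- by apply: param_grassmannian; rewrite leq_addr.
- exact: polymap_wedge.
- move=> u; rewrite /psi chart_sum1 mulmx1; exists (fun x => chart (fun _ => E0) u ord0 x.1 x.2).
  by rewrite mat_ofK.
- apply: polyfun_det => r c; under eq_fun do rewrite !mxE; exact: polyfun_var.
- by rewrite mat_ofK colE det1 oner_neq0.
move=> s nzd; set C := colsub f0 _ in nzd; have uC : C \in unitmx by rewrite unitmxE unitfE.
pose B (i : 'I_1) := invmx C *m mat_of s.
have EB : chart (fun _ => E0) (chart_origin B (a := a0)) = B.
  apply: chart_fill => i r c; rewrite /a0 /= -leqNgt => lec.
  have -> : c = f0 (Ordinal (lec : (c < k.+1)%N)) by apply/val_inj.
  have : colsub f0 (B i) = 1%:M.
    by rewrite -(mulVmx uC); apply/matrixP=> r' c'; rewrite !mxE; apply: eq_bigr => l _; rewrite !mxE.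
  set c' := Ordinal _; move/matrixP/(_ r c'); rewrite -colE => E; move: E; rewrite [LHS]mxE.
  by move=> ->; rewrite mxE.
exists (\det C), (chart_origin B (a := a0)).
by rewrite /psi chart_sum1 EB mulmx1 /B -wedge_mul_det mulKVmx.
Qed.

Lemma grassmannian_line A r v t : exists B, wedge A + t *: wedge (setrow A r v) = wedge B.
Proof.
exists (setrow A r (t *: v + row r A)).
by rewrite wedge_setrowP setrow_id addrC.
Qed.

Lemma vanishes_grassmannian p A : homogeneous p -> vanishes p G -> p.@[wedge A 0] = 0.
Proof.
move=> hp pG; have par := @param_grassmannian K k n (leq_addr _ _).
by have /(par p hp)/(_ (fun x => A x.1 x.2)) := pG; rewrite mat_ofK.
Qed.

(** Smoothness and the tangent space are known at a general point of a chart,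
    and the group acts transitively. *)
Lemma grassmannian_tangent A : wedge A != 0 -> smooth_point G (wedge A) /\
  forall h, tangent_at G h (wedge A) <-> tang h A.
Proof.
move=> nzA.
have E1 : E0 *m E0^T = 1%:M.
  apply/matrixP=> i j; rewrite mxE (bigD1 (f0 i)) //= !mxE eqxx mul1r eq_sym.
  rewrite (inj_eq (@lshift_inj _ _)) big1 ?addr0 // => l ne; rewrite !mxE.
  by rewrite eq_sym (negPf ne) mul0r.
have Ea (i : 'I_1) (r : 'I_k.+1) (c : 'I_n) (r' : 'I_k.+1) : a0 (i, r, c) -> E0 r' c = 0.
  rewrite /a0 /= => lt; rewrite !mxE; case: eqP => // Ec; move: lt; rewrite -Ec /=.
  by rewrite ltnNge -ltnS ltn_ord.
have fr := framed_chart E1 Ea (unitmx1 _ _).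
have [Q [_ [s Qs] /(_ s Qs)[nzs sm Ts]]] := smooth_param (@polymap_chart_sum _ _ _ _ _ _ _)
  (@multiaffine_chart _ _ _ _ _ _ _) fr (@grassmannian_closed K k n) param_chart.
pose B := chart (fun _ : 'I_1 => E0) s ord0.
have EB : psi s = wedge B by rewrite /psi chart_sum1 mulmx1.
rewrite -/psi EB in nzs sm Ts.
have [g ug EA] := row_free_transitive (wedge_neq0_row_free nzA) (wedge_neq0_row_free nzs).
have uL := compound_unit k.+1 ug.
have stV : stable G (invmx (compound k.+1 g)).
  by rewrite -compoundV //; apply: stable_grassmannian; rewrite unitmx_inv.
have stL := stable_grassmannian (k := k) ug.
split; first by rewrite EA wedge_mulmx; apply: smooth_point_mulmx.
move=> h; split=> [tan_h r v|th v].
  apply: tan_h; apply: tangent_line => p hp pG t.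
  by have [C ->] := grassmannian_line A r v t; apply: vanishes_grassmannian.
rewrite EA wedge_mulmx => /(tangent_space_mulmx stV); rewrite mulmxK // => /Ts.
move=> vW; change (pairing h v = 0).
rewrite -(mulmxKV uL v) -[X in _ *m X]trmxK -pairing_mulmx.
apply: (pairing_submx vW) => j; rewrite rowK pairing_mulmx trmxK.
have [r [u ->]] : exists r u, frame psi dpsi s (enum_val j) = wedge (setrow B r u).
  case: (enum_val j) => [x|] /=; last by exists ord0, (row ord0 B); rewrite setrow_id.
  rewrite /dpsi /chart_dsum mulmx1 /B (ord1 (val x).1.1).
  by exists (val x).1.2, (delta_mx 0 (val x).2).
rewrite -wedge_mulmx setrow_mul -EA; exact: th.
Qed.

Lemma tangent_spaceZ (X : set 'rV[K]_N) (y v : 'rV[K]_N) c :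
  cone X -> tangent_space X y v -> c != 0 -> tangent_space X (c *: y) v.
Proof.
move=> cX Ty nzc.
have st : stable X c%:M by move=> z Xz; rewrite mul_mx_scalar; apply: cX.
have := tangent_space_mulmx st Ty; rewrite !mul_mx_scalar => Tcv.
apply: (@tangent_mulmx _ _ _ _ 1 (c *: v)) => [i|].
  by rewrite (_ : row i (c *: v) = c *: v) //; apply/rowP=> j; rewrite !mxE ord1.
by rewrite (eqmx_scale v nzc).
Qed.

(** The tangent space only depends on the point of the projective space. *)
Lemma tang_row_equiv h A (R : 'M[K]_k.+1) : R \in unitmx -> wedge A != 0 ->
  tang h A -> tang h (R *m A).
Proof.
move=> uR nzA /(grassmannian_tangent nzA).2 tA.
have nzd : \det R != 0 by rewrite -unitfE -unitmxE.
have nzRA : wedge (R *m A) != 0 by rewrite wedge_mul_det scaler_eq0 negb_or nzd.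
apply/(grassmannian_tangent nzRA).2; rewrite wedge_mul_det => v Tv; apply: tA.
have cG := proj_closed_cone (@grassmannian_closed K k n).
by have := tangent_spaceZ cG Tv (invr_neq0 nzd); rewrite scalerA mulVf // scale1r.
Qed.

End TangentGrassmannian.

(** * Secant varieties of Grassmannians *)

Section Secant.
Variables (K : numFieldType) (r k n : nat).
Local Notation N := (pluecker_dim k.+1 n).
Local Notation G := (grassmannian K k.+1 n).
Implicit Types (A : 'I_r -> 'M[K]_(k.+1, n)) (h w x : 'rV[K]_N).

Definition wedge_sum A := \sum_i wedge (A i).

(** The coefficients of a linear combination of decomposable tensors are
    absorbed by rows; in the converse direction zero summands are replaced by
    copies of a nonzero one. *)
Lemma secant_set x : x != 0 ->
  (exists t : 'M[K]_(r, N), (forall i, G (row i t)) /\ (x <= t)%MS) <->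
  exists A, x = wedge_sum A.
Proof.
move=> nzx; split=> [[t [Gt /submxP[c Ex]]]|[A EA]].
  have /choice[A HA] : forall i, exists B : 'M[K]_(k.+1, n), row i t = wedge B.
    by move=> i; have [_ [B E]] := Gt i; exists B.
  exists (fun i => setrow (A i) ord0 (c 0 i *: row ord0 (A i))).
  rewrite Ex mulmx_sum_row; apply: eq_bigr => i _.
  by rewrite wedge_setrowZ HA.
have [i0 nzi0] : exists i, wedge (A i) != 0.
  have [//|none] := pselect (exists i, wedge (A i) != 0).
  case/eqP: nzx; rewrite EA /wedge_sum big1 // => i _; apply/eqP.
  by apply: contra_notT none => ?; exists i.
pose t : 'M[K]_(r, N) := \matrix_i if wedge (A i) == 0 then wedge (A i0) else wedge (A i).
exists t; split=> [i|].
  by rewrite rowK; case: ifP => [_|/negbT nzi]; split=> //; [exists (A i0) | exists (A i)].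
rewrite EA; apply: summx_sub => i _; have [->|nzi] := eqVneq (wedge (A i)) 0.
  exact: sub0mx.
by have := row_sub i t; rewrite rowK (negPf nzi).
Qed.

Lemma secant_varietyE :
  secant_variety r G = proj_closure [set x : 'rV[K]_N | x != 0 /\ exists A, x = wedge_sum A].
Proof.
congr (proj_closure _); apply/seteqP; split=> x [nzx Hx]; split=> //.
  exact/(secant_set nzx).
exact/(secant_set nzx).
Qed.

Definition mats_of (s : 'I_r * 'I_k.+1 * 'I_n -> K) i : 'M[K]_(k.+1, n) :=
  \matrix_(a, c) s (i, a, c).

Definition of_mats A (y : 'I_r * 'I_k.+1 * 'I_n) := A y.1.1 y.1.2 y.2.

Lemma mats_ofK A : mats_of (of_mats A) = A.
Proof. by apply/funext => i; apply/matrixP=> a c; rewrite mxE. Qed.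

Lemma polyfun_mats_of i a c : polyfun (fun s => mats_of s i a c).
Proof. by under eq_fun do rewrite mxE; apply: polyfun_var. Qed.

Lemma polymap_wedge_sum : polymap (fun s => wedge_sum (mats_of s)).
Proof.
move=> j; under eq_fun do rewrite summxE; apply: polyfun_sum => i.
by apply: polyfun_wedge => a c; apply: polyfun_mats_of.
Qed.

Lemma param_secant A0 : wedge_sum A0 != 0 ->
  param (fun s => wedge_sum (mats_of s)) (secant_variety r G).
Proof.
move=> nz0; rewrite secant_varietyE.
have := @param_image _ _ _ (fun s => wedge_sum (mats_of s)) (of_mats A0).
rewrite mats_ofK => /(_ nz0); congr (param _ (proj_closure _)).
apply/seteqP; split=> w [nz [y E]]; split=> //; first by exists (mats_of y).
by exists (of_mats y); rewrite mats_ofK.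
Qed.

Lemma vanishes_secant A0 p A : wedge_sum A0 != 0 -> homogeneous p ->
  vanishes p (secant_variety r G) -> p.@[wedge_sum A 0] = 0.
Proof.
move=> nz0 hp pS; have /(param_secant nz0 hp)/(_ (of_mats A)) := pS.
by rewrite mats_ofK.
Qed.

Lemma wedge_sum_mulmx A (g : 'M[K]_n) :
  wedge_sum (fun i => A i *m g) = wedge_sum A *m compound k.+1 g.
Proof. by rewrite mulmx_suml; apply: eq_bigr => i _; rewrite wedge_mulmx. Qed.

Lemma stable_secant (g : 'M[K]_n) : g \in unitmx ->
  stable (secant_variety r G) (compound k.+1 g).
Proof.
move=> ug; have uL := compound_unit k.+1 ug.
rewrite secant_varietyE; apply: stable_closure => // x [nzx [A EA]]; split.
  by apply: contra_neq nzx => E0; rewrite -(mulmxK uL x) E0 mul0mx.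
by exists (fun i => A i *m g); rewrite wedge_sum_mulmx -EA.
Qed.

(** The line directed by a tangent vector at one of the summands lies in the
    secant variety: this is the elementary half of the lemma of Terracini. *)
Lemma tangent_secant A0 A i a v : wedge_sum A0 != 0 ->
  tangent_space (secant_variety r G) (wedge_sum A) (wedge (setrow (A i) a v)).
Proof.
move=> nz0; apply: tangent_line => p hp pS t.
pose B j := if j == i then setrow (A i) a (t *: v + row a (A i)) else A j.
have -> : wedge_sum A + t *: wedge (setrow (A i) a v) = wedge_sum B.
  rewrite /wedge_sum (bigD1 i) //= [in RHS](bigD1 i) //= /B eqxx wedge_setrowP setrow_id.
  rewrite [in RHS](eq_bigr (fun j => wedge (A j))) => [|j /negPf-> //].
  by rewrite [LHS]addrC [LHS]addrA.
exact: (vanishes_secant _ nz0 hp pS).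
Qed.

Lemma tangent_at_secant_tang A0 A h : wedge_sum A0 != 0 ->
  tangent_at (secant_variety r G) h (wedge_sum A) -> forall i, tang h (A i).
Proof. by move=> nz0 th i a v; apply/th/(tangent_secant _ _ _ _ nz0). Qed.

End Secant.

(** The tangent space is the annihilator of the gradients, and finitely many of
    them span the same space as all of them. *)
Lemma conormal_gradients (K : numFieldType) n (X : set 'rV[K]_n) x h : tangent_at X h x ->
  exists m (p : 'I_m -> {mpoly K[n]}) (c : 'I_m -> K),
    (forall j, homogeneous (p j) /\ vanishes (p j) X) /\
    forall i, h 0 i = \sum_j c j * ((p j)^`M(i)).@[x 0].
Proof.
move=> th; pose grad (p : {mpoly K[n]}) : 'rV[K]_n := \row_i (p^`M(i)).@[x 0].
(* A family of equations whose gradients have the largest possible rank. *)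
pose good m (p : 'I_m -> {mpoly K[n]}) := forall j, homogeneous (p j) /\ vanishes (p j) X.
pose M m (p : 'I_m -> {mpoly K[n]}) : 'M[K]_(m, n) := \matrix_j grad (p j).
pose P r := `[< exists m (p : 'I_m -> {mpoly K[n]}), good m p /\ \rank (M m p) = r >].
have P0 : exists r, P r.
  exists (\rank (M 0%N (fun=> 0))); apply/asboolP; exists 0%N, (fun=> 0).
  by split=> // -[].
have Pn r : P r -> (r <= n)%N by move=> /asboolP[m [p [_ <-]]]; apply: rank_leq_col.
have [r /asboolP[m [p [gp rkM]]] maxr] := ex_maxnP P0 Pn.
have sub q : homogeneous q -> vanishes q X -> (grad q <= M m p)%MS.
  move=> hq qX; pose p' (i : 'I_(m + 1)) := if split i is inl j then p j else q.
  have EM : M (m + 1)%N p' = col_mx (M m p) (grad q).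
    apply/row_matrixP=> i; rewrite rowK /p'; case: splitP => j Ej.
      by have -> : i = lshift 1 j by [exact/val_inj]; rewrite rowKu rowK.
    have -> : i = rshift m j by [exact/val_inj]; rewrite rowKd (ord1 j).
    by apply/rowP=> l; rewrite !mxE.
  have gp' : good (m + 1)%N p' by move=> i; rewrite /p'; case: (split i).
  have le_rk : (\rank (col_mx (M m p) (grad q)) <= \rank (M m p))%N.
    by rewrite rkM; apply: maxr; apply/asboolP; exists (m + 1)%N, p'; rewrite EM.
  have sub1 : (M m p <= col_mx (M m p) (grad q))%MS by rewrite -addsmxE addsmxSl.
  have : (col_mx (M m p) (grad q) <= M m p)%MS.
    by rewrite -(geq_leqif (mxrank_leqif_sup sub1)).
  by apply: submx_trans; rewrite -addsmxE addsmxSr.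
have /submxP[c Ec] : (h <= M m p)%MS.
  rewrite submxE; apply/eqP/rowP=> j; rewrite mxE [RHS]mxE.
  have : tangent_space X x (col j (cokermx (M m p)))^T.
    move=> q hq qX; have /submxP[c Ec] := sub q hq qX.
    have : grad q *m cokermx (M m p) = 0 by rewrite Ec -mulmxA mulmx_coker mulmx0.
    move/rowP/(_ j); rewrite mxE [RHS]mxE => E; rewrite -[RHS]E; apply: eq_bigr => i _.
    by rewrite [in RHS]mxE; congr (_ * _); rewrite !mxE.
  by move/th => E; rewrite -[RHS]E; apply: eq_bigr => i _; congr (_ * _); rewrite !mxE.
exists m, p, (fun j => c 0 j); split=> // i.
by rewrite Ec mxE; apply: eq_bigr => j _; congr (_ * _); rewrite !mxE.
Qed.

(** * Alternating trilinear forms *)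

Definition rows_of (K : fieldType) n m (l : seq 'rV[K]_n) : 'M[K]_(m, n) := \matrix_(i < m) l`_i.

Section Rows.
Variables (K : fieldType) (n : nat).

Lemma rows_ofE m (l : seq 'rV[K]_n) i j : rows_of m l i j = l`_i 0 j.
Proof. exact: mxE. Qed.

Lemma row_rows_of m (l : seq 'rV[K]_n) i : row i (rows_of m l) = l`_i.
Proof. exact: rowK. Qed.

Lemma rows_of_sub m (l : seq 'rV[K]_n) i : (i < m)%N -> (l`_i <= rows_of m l)%MS.
Proof. by move=> lti; rewrite -[l`_i]/(l`_(Ordinal lti)) -row_rows_of row_sub. Qed.

Lemma rows_of_mulmx m p (l : seq 'rV[K]_n) (g : 'M[K]_(n, p)) :
  rows_of m l *m g = rows_of m [seq v *m g | v <- l].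
Proof.
apply/row_matrixP=> i; rewrite row_mul !rowK.
have [lt_i|le_i] := ltnP i (size l); first by rewrite (nth_map 0).
by rewrite !nth_default ?size_map // mul0mx.
Qed.

Lemma rows_of3 (A : 'M[K]_(3, n)) :
  A = rows_of 3 [:: row ord0 A; row (lift ord0 ord0) A; row ord_max A].
Proof.
apply/row_matrixP=> i; rewrite row_rows_of.
by case: i => [[|[|[|//]]] lti] /=; congr row; apply/val_inj.
Qed.

Lemma setrow_rows_of3 (u v w x : 'rV[K]_n) :
  [/\ setrow (rows_of 3 [:: u; v; w]) ord0 x = rows_of 3 [:: x; v; w],
      setrow (rows_of 3 [:: u; v; w]) (lift ord0 ord0) x = rows_of 3 [:: u; x; w] &
      setrow (rows_of 3 [:: u; v; w]) ord_max x = rows_of 3 [:: u; v; x]].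
Proof.
by split; apply/matrixP=> i j; rewrite setrowE !rows_ofE; case: i => [[|[|[|//]]] lti].
Qed.

End Rows.

Section Trilinear.
Variables (K : numFieldType) (n : nat).
Local Notation N := (pluecker_dim 3 n).
Implicit Types (h y : 'rV[K]_N) (u v w x : 'rV[K]_n).

(** The alternating trilinear form with coefficients y. *)
Definition tri y u v w := ev y (rows_of 3 [:: u; v; w]).

Lemma tangP y u v w : tang y (rows_of 3 [:: u; v; w]) <->
  forall x, [/\ tri y x v w = 0, tri y u x w = 0 & tri y u v x = 0].
Proof.
have S := setrow_rows_of3 u v w.
split=> [th x|th r x].
  by have [E1 E2 E3] := S x; rewrite /tri -E1 -E2 -E3; split; apply: th.
have [E1 E2 E3] := S x; have [t1 t2 t3] := th x.
case: r => [[|[|[|//]]] lti].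
- by rewrite (_ : Ordinal _ = ord0) ?E1 //; apply/val_inj.
- by rewrite (_ : Ordinal _ = lift ord0 ord0) ?E2 //; apply/val_inj.
- by rewrite (_ : Ordinal _ = ord_max) ?E3 //; apply/val_inj.
Qed.

Lemma tri_linear1 y a u u' v w : tri y (a *: u + u') v w = a * tri y u v w + tri y u' v w.
Proof.
have [E _ _] := setrow_rows_of3 u v w (a *: u + u'); rewrite /tri -E ev_setrowP.
by have [-> _ _] := setrow_rows_of3 u v w u; have [-> _ _] := setrow_rows_of3 u v w u'.
Qed.

Lemma tri_linear2 y a u v v' w : tri y u (a *: v + v') w = a * tri y u v w + tri y u v' w.
Proof.
have [_ E _] := setrow_rows_of3 u v w (a *: v + v'); rewrite /tri -E ev_setrowP.
by have [_ -> _] := setrow_rows_of3 u v w v; have [_ -> _] := setrow_rows_of3 u v w v'.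
Qed.

Lemma tri_linear3 y a u v w w' : tri y u v (a *: w + w') = a * tri y u v w + tri y u v w'.
Proof.
have [_ _ E] := setrow_rows_of3 u v w (a *: w + w'); rewrite /tri -E ev_setrowP.
by have [_ _ ->] := setrow_rows_of3 u v w w; have [_ _ ->] := setrow_rows_of3 u v w w'.
Qed.

Let ev_rep y (A : 'M[K]_(3, n)) r r' : r != r' -> row r A = row r' A -> ev y A = 0.
Proof.
by move=> ne E; rewrite /ev (wedge_eq0 ne E) /pairing big1 // => i _; rewrite mxE mulr0.
Qed.

Lemma tri_alt12 y u w : tri y u u w = 0.
Proof. by apply: (@ev_rep y _ ord0 (lift ord0 ord0)) => //; rewrite !row_rows_of. Qed.

Lemma tri_alt13 y u v : tri y u v u = 0.
Proof. by apply: (@ev_rep y _ ord0 ord_max) => //; rewrite !row_rows_of. Qed.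

Lemma tri_alt23 y u v : tri y u v v = 0.
Proof. by apply: (@ev_rep y _ (lift ord0 ord0) ord_max) => //; rewrite !row_rows_of. Qed.

Lemma tri_swap12 y u v w : tri y v u w = - tri y u v w.
Proof.
have := tri_alt12 y (1 *: u + v) w; rewrite tri_linear1 !tri_linear2 !tri_alt12.
by rewrite !mul1r add0r addr0 addrC => /eqP; rewrite addr_eq0 => /eqP.
Qed.

Lemma tri_swap23 y u v w : tri y u w v = - tri y u v w.
Proof.
have := tri_alt23 y u (1 *: v + w); rewrite tri_linear2 !tri_linear3 !tri_alt23.
by rewrite !mul1r add0r addr0 addrC => /eqP; rewrite addr_eq0 => /eqP.
Qed.

Lemma tri_swap13 y u v w : tri y w v u = - tri y u v w.
Proof. by rewrite tri_swap12 tri_swap23 tri_swap12 opprK. Qed.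

(** Indices are natural numbers so that explicit families of vectors can be
    written. *)
Definition bv i : 'rV[K]_n := \row_j (j == i :> nat)%:R.

Lemma rowsub_bv (f : 'I_3 -> 'I_n) :
  rowsub f 1%:M = rows_of 3 [:: bv (f ord0); bv (f (lift ord0 ord0)); bv (f ord_max)].
Proof.
apply/matrixP=> i j; rewrite !mxE.
by case: i => [[|[|[|//]]] lti]; rewrite /= mxE eq_sym; congr (_ == _)%:R; congr (f _);
   apply/val_inj.
Qed.

(** The increasing triples of indices give all coefficients up to sign. *)
Lemma tri_eq0 y : (forall i j l, (i < j < l)%N -> (l < n)%N -> tri y (bv i) (bv j) (bv l) = 0) ->
  y = 0.
Proof.
move=> y0; apply: ev_eq0 => f; rewrite rowsub_bv -/(tri y _ _ _).
have sorted_case i j l : (i <= j <= l)%N -> (l < n)%N -> tri y (bv i) (bv j) (bv l) = 0.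
  move=> /andP[]; rewrite leq_eqVlt => /orP[/eqP->|ltij]; first by rewrite tri_alt12.
  rewrite leq_eqVlt => /orP[/eqP->|ltjl]; first by rewrite tri_alt23.
  by move=> ltl; apply: y0; rewrite ?ltij.
have half a b c : (a <= b)%N -> (a < n)%N -> (b < n)%N -> (c < n)%N ->
    tri y (bv a) (bv b) (bv c) = 0.
  move=> leab lta ltb ltc; have [lebc|ltcb] := leqP b c; first by rewrite sorted_case ?leab.
  have [leac|ltca] := leqP a c; first by rewrite tri_swap23 sorted_case ?leac ?(ltnW ltcb) ?oppr0.
  by rewrite tri_swap23 tri_swap12 sorted_case ?leab ?(ltnW ltca) ?oppr0.
move: (f ord0) (f (lift ord0 ord0)) (f ord_max) => a b c.
have [leab|/ltnW leba] := leqP a b; first by rewrite half.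
by rewrite tri_swap12 half ?oppr0.
Qed.

Lemma triD1 y u u' v w : tri y (u + u') v w = tri y u v w + tri y u' v w.
Proof. by rewrite -[u]scale1r tri_linear1 mul1r scale1r. Qed.

End Trilinear.

Section Matrices3.
Variables (K : fieldType).

Definition mat3 (l : seq (seq K)) : 'M[K]_3 := \matrix_(i, j) (nth [::] l i)`_j.

Lemma det_mat3_upper a b c d e f :
  \det (mat3 [:: [:: a; b; c]; [:: 0; d; e]; [:: 0; 0; f]]) = a * d * f.
Proof.
rewrite -det_tr det_trig ?big_ord_recl ?big_ord0.
  by rewrite !mxE /= mulr1 !mulrA.
apply/is_trig_mxP => i j; rewrite !mxE.
by case: i => [[|[|[|//]]] ?]; case: j => [[|[|[|//]]] ?].
Qed.

Lemma mat3_mulmx n a b c d e f h i j (A : 'M[K]_(3, n)) u v w :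
  A = rows_of 3 [:: u; v; w] ->
  mat3 [:: [:: a; b; c]; [:: d; e; f]; [:: h; i; j]] *m A = rows_of 3
    [:: a *: u + b *: v + c *: w; d *: u + e *: v + f *: w; h *: u + i *: v + j *: w].
Proof.
move=> ->; apply/row_matrixP=> l; rewrite row_mul row_rows_of mulmx_sum_row.
rewrite !big_ord_recl big_ord0 !row_rows_of !mxE /= addr0 addrA.
by case: l => [[|[|[|//]]] ?].
Qed.

Lemma det_setrow1 m j (x : 'rV[K]_m) : \det (setrow 1%:M j x) = x 0 j.
Proof.
rewrite (expand_det_row _ j) (bigD1 j) //= big1 => [|l ne].
  rewrite setrowE eqxx addr0 /cofactor addnn -signr_odd odd_double expr0 mul1r.
  rewrite (_ : row' _ _ = 1%:M) ?det1 ?mulr1 //; apply/matrixP=> a b; rewrite !mxE.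
  by rewrite eq_sym (negPf (neq_lift _ _)) (inj_eq lift_inj).
have /matrixP/(_ l j) := adj1 K m; rewrite !mxE (negPf ne) => E.
have -> : cofactor (setrow 1%:M j x) j l = 0; last by rewrite mulr0.
transitivity (cofactor (1%:M : 'M[K]_m) j l) => //; rewrite /cofactor; congr (_ * \det _).
by apply/matrixP=> a b; rewrite !mxE eq_sym (negPf (neq_lift _ _)).
Qed.

End Matrices3.

(** * Triples of planes in general position *)

Section Configuration.
Variables (K : numFieldType).
Local Notation N := (pluecker_dim 3 8).
Local Notation e i := (bv K 8 i).
Implicit Types (y h : 'rV[K]_N).

(** Three planes of a projective space of dimension 7 in general position, in
    adapted coordinates: the third plane meets the join of the other two in one
    point, and this point is the sum of a vector of each of them. *)
Definition triple : seq 'M[K]_(3, 8) :=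
  [:: rows_of 3 [:: e 0; e 1; e 2]; rows_of 3 [:: e 3; e 4; e 5];
      rows_of 3 [:: e 0 + e 3; e 6; e 7]].

Definition base (i : 'I_3) : 'M[K]_(3, 8) := triple`_i.

Lemma ord3P (P : 'I_3 -> Prop) :
  P ord0 -> P (lift ord0 ord0) -> P ord_max -> forall i, P i.
Proof.
move=> P0 P1 P2; case=> [[|[|[|//]]] lti].
- by rewrite (_ : Ordinal _ = ord0) //; apply/val_inj.
- by rewrite (_ : Ordinal _ = lift ord0 ord0) //; apply/val_inj.
- by rewrite (_ : Ordinal _ = ord_max) //; apply/val_inj.
Qed.

(** Tangency at the first two planes kills the coefficients with two indices
    among 0, 1, 2 or among 3, 4, 5; tangency at the third one kills those with
    indices 6 and 7, and relates the coefficients with index 0 to those with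
    index 3, which all vanish then. The coefficients left form a 2 x 2 x 2
    tensor. *)
Lemma tang_base_eq0 y : (forall i, tang y (base i)) ->
  (forall i j l, i \in [:: 1; 2]%N -> j \in [:: 4; 5]%N -> l \in [:: 6; 7]%N ->
     tri y (e i) (e j) (e l) = 0) -> y = 0.
Proof.
move=> th t0.
have /tangP T1 := th ord0; have /tangP T2 := th (lift ord0 ord0); have /tangP T3 := th ord_max.
have cyc u v w : tri y v w u = tri y u v w by rewrite tri_swap23 tri_swap12 opprK.
have F1 i j x : (i < j < 3)%N -> tri y (e i) (e j) x = 0.
  have [a b c] := T1 x => lt_ij.
  have [[-> ->]|[[-> ->]|[-> ->]]] : (i = 0 /\ j = 1 \/ i = 0 /\ j = 2 \/ i = 1 /\ j = 2)%N by lia.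
  - exact: c.
  - by rewrite tri_swap23 b oppr0.
  - by rewrite cyc.
have F2 i j x : (2 < i < j)%N -> (j < 6)%N -> tri y (e i) (e j) x = 0.
  have [a b c] := T2 x => lt_ij lt_j.
  have [[-> ->]|[[-> ->]|[-> ->]]] : (i = 3 /\ j = 4 \/ i = 3 /\ j = 5 \/ i = 4 /\ j = 5)%N by lia.
  - exact: c.
  - by rewrite tri_swap23 b oppr0.
  - by rewrite cyc.
(* The relation coming from the vector e 0 + e 3 of the third plane. *)
have F3 x l : l \in [:: 6; 7]%N -> tri y (e 0) x (e l) = - tri y (e 3) x (e l).
  have [_ b c] := T3 x; rewrite !inE => /orP[]/eqP->; apply/eqP; rewrite -addr_eq0 -triD1.
    by rewrite tri_swap23 c oppr0.
  by rewrite b.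
apply: tri_eq0 => i j l /andP[ltij ltjl] ltl.
have [lt3|ge3] := ltnP j 3; first by rewrite F1 ?ltij.
have [lt3i|le3i] := leqP 3 i.
  have [lt6|ge6] := ltnP j 6; first by rewrite F2 ?lt3i.
  have [-> ->] : (j = 6 /\ l = 7)%N by lia.
  by have [-> _ _] := T3 (e i).
have [lt6l|ge6l] := ltnP l 6; first by rewrite -cyc F2 ?ltjl ?andbT.
have [lt6j|ge6j] := ltnP j 6; last first.
  have [-> ->] : (j = 6 /\ l = 7)%N by lia.
  by have [-> _ _] := T3 (e i).
have l67 : l \in [:: 6; 7]%N by rewrite !inE; lia.
have [->|nzi] := eqVneq i 0%N.
  rewrite F3 //; have [->|n3] := eqVneq j 3%N; first by rewrite tri_alt12 oppr0.
  by rewrite F2 ?oppr0 //; lia.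
have [->|n3] := eqVneq j 3%N; last first.
  by apply: t0; rewrite // !inE; lia.
have := F3 (e i) l l67; rewrite F1; last by lia.
by move=> E; rewrite tri_swap12 -E.
Qed.

(** When the planes are in general position, these rows form a basis of the
    whole space. *)
Definition stack (A : 'I_3 -> 'M[K]_(3, 8)) : 'M[K]_8 :=
  let r i j : 'rV[K]_8 := row (inord j) (A (inord i)) in
  rows_of 8 [:: r 0 0; r 0 1; r 0 2; r 1 0; r 1 1; r 1 2; r 2 1; r 2 2]%N.

(** By Cramer's rule the last two factors are, up to the first one, coordinates
    of the first row of the third matrix; its components in the first two planes
    do not vanish then. *)
Definition general_position A := \det (stack A) *
  \det (setrow (stack A) ord0 (row ord0 (A ord_max))) *
  \det (setrow (stack A) (inord 3) (row ord0 (A ord_max))).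

Lemma bv_mulmx i (l : seq 'rV[K]_8) : (i < 8)%N -> e i *m rows_of 8 l = l`_i.
Proof.
move=> lti; rewrite -[l`_i]/(l`_(Ordinal lti)) -row_rows_of rowE; congr (_ *m _).
by apply/rowP=> j; rewrite !mxE.
Qed.

Lemma rows_of_bv : rows_of 8 [:: e 0; e 1; e 2; e 3; e 4; e 5; e 6; e 7] = 1%:M.
Proof.
apply/matrixP=> i j; rewrite !mxE -val_eqE /=.
by case: i => [[|[|[|[|[|[|[|[|//]]]]]]]] ?]; rewrite /= !mxE eq_sym.
Qed.

Lemma base_mulmx (l : seq 'rV[K]_8) i : base i *m rows_of 8 l =
  [:: rows_of 3 [:: l`_0; l`_1; l`_2]; rows_of 3 [:: l`_3; l`_4; l`_5];
      rows_of 3 [:: l`_0 + l`_3; l`_6; l`_7]]`_i.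
Proof.
by elim/ord3P: i; rewrite /base /= rows_of_mulmx /= ?mulmxDl !bv_mulmx.
Qed.

(** Let p and q be the components of the first row of the third matrix in the
    first two planes. Replacing a basis vector of each plane by p and q, and
    subtracting from the third plane its own vectors, brings the triple to its
    normal form. The other vectors are rescaled so that the changes of basis
    have determinant 1. *)
Lemma general_position_adapted A : general_position A != 0 ->
  exists2 g, g \in unitmx & forall i, exists R, \det R = 1 /\ R *m A i = base i *m g.
Proof.
rewrite /general_position !mulf_eq0 !negb_or => /andP[/andP[nz0 nzx0] nzx3].
pose r i j : 'rV[K]_8 := row (inord j) (A (inord i)).
pose c0 := row ord0 (A ord_max).
have u0 : stack A \in unitmx by rewrite unitmxE unitfE.
pose x := c0 *m invmx (stack A); have Ex : c0 = x *m stack A by rewrite mulmxKV.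
have det_x j : \det (setrow (stack A) j c0) = x 0 j * \det (stack A).
  by rewrite Ex -{1}[stack A]mul1mx -setrow_mul det_mulmx det_setrow1.
rewrite -/c0 !det_x !mulf_eq0 !negb_or in nzx0 nzx3.
have /andP[{}nzx0 _] := nzx0; have /andP[{}nzx3 _] := nzx3.
pose X i := x 0 (inord i).
have X0 : X 0%N != 0 by rewrite /X (_ : inord 0 = ord0) //; apply/val_inj; rewrite /= inordK.
have Ec : c0 = X 0%N *: r 0 0 + X 1 *: r 0 1 + X 2 *: r 0 2 + (X 3 *: r 1 0 + X 4 *: r 1 1 +
    X 5 *: r 1 2) + X 6 *: r 2 1 + X 7 *: r 2 2.
  rewrite Ex mulmx_sum_row !big_ord_recl big_ord0 !row_rows_of /= addr0 !addrA.
  rewrite /X /r; do ![congr (_ + _)]; congr (_ *: _); congr (x 0 _); apply/val_inj => /=;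
    by rewrite inordK.
(* The components of c0 in the first two planes. *)
pose p := X 0%N *: r 0%N 0%N + X 1%N *: r 0%N 1%N + X 2 *: r 0%N 2.
pose q := X 3 *: r 1%N 0%N + X 4 *: r 1%N 1%N + X 5 *: r 1%N 2.
pose l := [:: p; (X 0%N)^-1 *: r 0%N 1%N; r 0%N 2; q; (X 3)^-1 *: r 1%N 1%N; r 1%N 2; r 2 1%N; r 2 2].
pose g := rows_of 8 l.
have X3 : X 3 != 0 by [].
have EA i : (i < 3)%N -> A (inord i) = rows_of 3 [:: r i 0; r i 1; r i 2]%N.
  move=> lti; apply/row_matrixP => j; rewrite row_rows_of.
  by case: j => [[|[|[|//]]] ?] /=; congr row; apply/val_inj; rewrite /= inordK.
have Eo (i : 'I_3) : i = inord i by apply/val_inj; rewrite /= inordK.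
exists g.
  have G i (lti : (i < 8)%N) : (l`_i <= g)%MS by exact: rows_of_sub.
  have S a (v : 'rV[K]_8) : a != 0 -> (a^-1 *: v <= g)%MS -> (v <= g)%MS.
    by move=> nza; rewrite eqmx_scale // invr_eq0.
  have B (v w : 'rV[K]_8) b : (v <= g)%MS -> (w <= g)%MS -> (v - b *: w <= g)%MS.
    by move=> vg wg; rewrite addmx_sub // eqmx_opp scalemx_sub.
  have g01 : (r 0 1 <= g)%MS by apply: (S _ _ X0); apply: (G 1%N).
  have g02 : (r 0 2 <= g)%MS by apply: (G 2).
  have g11 : (r 1 1 <= g)%MS by apply: (S _ _ X3); apply: (G 4).
  have g12 : (r 1 2 <= g)%MS by apply: (G 5).
  have g00 : (r 0 0 <= g)%MS.
    rewrite -(eqmx_scale _ X0) (_ : _ *: _ = p - X 1 *: r 0 1 - X 2 *: r 0 2).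
      by apply: (B) => //; apply: (B) => //; apply: (G 0%N).
    by rewrite /p addrAC addrK addrK.
  have g10 : (r 1 0 <= g)%MS.
    rewrite -(eqmx_scale _ X3) (_ : _ *: _ = q - X 4 *: r 1 1 - X 5 *: r 1 2).
      by apply: (B) => //; apply: (B) => //; apply: (G 3).
    by rewrite /q addrAC addrK addrK.
  have /mxrankS : (stack A <= g)%MS.
    apply/row_subP => i; rewrite row_rows_of.
    case: i => [[|[|[|[|[|[|[|[|//]]]]]]]] ?] //=; [exact: (G 6)|exact: (G 7)].
  rewrite -row_free_unit /row_free eqn_leq rank_leq_row /= => le.
  by apply: leq_trans le; rewrite mxrank_unit.
have simp3 := (scale0r, add0r, addr0, scale1r).
elim/ord3P.
- exists (mat3 [:: [:: X 0%N; X 1; X 2]; [:: 0; (X 0%N)^-1; 0]; [:: 0; 0; 1]]).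
  rewrite det_mat3_upper mulr1 divff //; split=> //.
  by rewrite base_mulmx /= (Eo ord0) (mat3_mulmx _ _ _ _ _ _ _ _ _ (EA 0%N isT)) !simp3.
- exists (mat3 [:: [:: X 3; X 4; X 5]; [:: 0; (X 3)^-1; 0]; [:: 0; 0; 1]]).
  rewrite det_mat3_upper mulr1 divff //; split=> //.
  by rewrite base_mulmx /= (Eo (lift _ _)) (mat3_mulmx _ _ _ _ _ _ _ _ _ (EA 1%N isT)) !simp3.
- exists (mat3 [:: [:: 1; - X 6; - X 7]; [:: 0; 1; 0]; [:: 0; 0; 1]]).
  rewrite det_mat3_upper !mulr1; split=> //.
  rewrite base_mulmx /= (Eo ord_max) (mat3_mulmx _ _ _ _ _ _ _ _ _ (EA 2 isT)) !simp3.
  congr (rows_of 3 [:: _; _; _]); have -> : r 2 0 = c0.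
    by rewrite /c0 (Eo ord_max) /r; congr row; apply/val_inj; rewrite /= inordK.
  by rewrite Ec !scaleNr -/p -/q addrAC addrK addrK.
Qed.

(** The coordinates in which the planes of the base triple have the identity as
    minor. *)
Definition pivots : seq (seq nat) := [:: [:: 0; 1; 2]; [:: 3; 4; 5]; [:: 0; 6; 7]]%N.

Definition pivot (i j : 'I_3) : 'I_8 := inord (nth 0%N (nth [::] pivots i) j).

Definition base_point : 'M[K]_(3, N) := \matrix_i wedge (base i).

Lemma base_pivot i : colsub (pivot i) (base i) = 1%:M.
Proof.
apply/matrixP=> a b; rewrite mxE [RHS]mxE -val_eqE.
by elim/ord3P: i; elim/ord3P: b; elim/ord3P: a; rewrite /base /= rows_ofE /pivot /= !mxE
  !inordK //= ?addr0.
Qed.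

Lemma rescale (c : 'I_3 -> K) : (forall i, c i != 0) ->
  exists2 d, d \in unitmx & forall i, wedge (base i *m d) = c i *: wedge (base i).
Proof.
move=> nzc; pose d (c : 'I_3 -> K) := rows_of 8 [:: e 0; c ord0 *: e 1; e 2; e 3;
  c (lift ord0 ord0) *: e 4; e 5; c ord_max *: e 6; e 7].
exists (d c).
  have : d c *m d (fun i => (c i)^-1) = 1%:M.
    by rewrite rows_of_mulmx /= -!scalemxAl !bv_mulmx //= !scalerA !mulfV // !scale1r rows_of_bv.
  by case/mulmx1_unit.
move=> i; rewrite base_mulmx -(wedge_setrowZ (base i) (lift ord0 ord0) (c i)); congr wedge.
elim/ord3P: i; rewrite /base /=.
- by have [_ -> _] := setrow_rows_of3 (e 0) (e 1) (e 2) (c ord0 *: row (lift ord0 ord0) (rows_of 3 [:: e 0; e 1; e 2])); rewrite row_rows_of.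
- by have [_ -> _] := setrow_rows_of3 (e 3) (e 4) (e 5) (c (lift ord0 ord0) *: row (lift ord0 ord0) (rows_of 3 [:: e 3; e 4; e 5])); rewrite row_rows_of.
- by have [_ -> _] := setrow_rows_of3 (e 0 + e 3) (e 6) (e 7) (c ord_max *: row (lift ord0 ord0) (rows_of 3 [:: e 0 + e 3; e 6; e 7])); rewrite row_rows_of.
Qed.

(** The conditions on the planes are polynomial in the coordinates of the
    tensors, since a basis of each plane consists of contractions of its tensor.
    The scaling of the tensors is absorbed by a diagonal matrix. *)
Lemma general_triple : exists F : {mpoly K[3 * N]},
  F.@[mxvec base_point 0] != 0 /\
  forall A : 'I_3 -> 'M[K]_(3, 8), F.@[mxvec (\matrix_i wedge (A i)) 0] != 0 ->
  exists2 g, g \in unitmx & forall i, wedge (A i) = wedge (base i *m g).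
Proof.
pose tm (s : 'I_3 * 'I_N -> K) : 'M[K]_(3, N) := \matrix_(i, j) s (i, j).
pose C s i := contraction (pivot i) (row i (tm s)).
pose f s := general_position (C s) * \prod_i ev (row i (tm s)) (rowsub (pivot i) 1%:M).
have pr i j : polyfun (fun s => row i (tm s) 0 j).
  by under eq_fun do rewrite !mxE; apply: polyfun_var.
have pe i (B : 'M[K]_(3, 8)) : polyfun (fun s => ev (row i (tm s)) B).
  by apply: polyfun_ev => // *; apply: polyfun_cst.
have pC i a b : polyfun (fun s => C s i a b) by under eq_fun do rewrite mxE.
have pst a b : polyfun (fun s => stack (C s) a b).
  under eq_fun do rewrite rows_ofE.
  by case: a => [[|[|[|[|[|[|[|[|//]]]]]]]] ?] /=; under eq_fun do rewrite mxE.
have pset j : polyfun (fun s => \det (setrow (stack (C s)) j (row ord0 (C s ord_max)))).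
  apply: polyfun_det => r c; under eq_fun do rewrite setrowE.
  by case: (r == j) => //; under eq_fun do rewrite mxE.
have pf : polyfun f.
  apply: polyfunM; last exact: polyfun_prod.
  rewrite /general_position; apply: polyfunM => //; apply: polyfunM => //.
  exact: polyfun_det.
have [F HF] := polyfun_mxvec pf.
have tmK (t : 'M[K]_(3, N)) : tm (fun x => t x.1 x.2) = t.
  by apply/matrixP=> i j; rewrite mxE.
exists F; split.
  rewrite -HF /f /C tmK.
  have EC i : contraction (pivot i) (row i base_point) = base i.
    by rewrite rowK contraction_wedge base_pivot adj1 mul1mx.
  have EB : (fun i => contraction (pivot i) (row i base_point)) = base by apply/funext.
  rewrite -/(general_position (fun i => contraction (pivot i) (row i base_point))) EB.
  rewrite big1 => [|i _]; last by rewrite rowK ev_rowsub base_pivot det1.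
  have Er i j : (i < 3)%N -> (j < 3)%N -> row (inord j) (base (inord i)) =
      (nth [::] [:: [:: e 0; e 1; e 2]; [:: e 3; e 4; e 5]; [:: e 0 + e 3; e 6; e 7]] i)`_j.
    move=> lti ltj; rewrite /base inordK //.
    by case: i lti => [|[|[|//]]] _; rewrite /= row_rows_of inordK.
  have -> : general_position base = 1.
    have S1 : stack base = 1%:M by rewrite /stack !Er // rows_of_bv.
    rewrite /general_position S1 det1 !det_setrow1 mul1r.
    have -> : row ord0 (base ord_max) = e 0 + e 3 by rewrite row_rows_of.
    by rewrite !mxE /= inordK //= addr0 add0r mulr1.
  by rewrite mulr1 oner_neq0.
move=> A; rewrite -HF /f tmK mulf_eq0 negb_or => /andP[nzD /prodf_neq0 nzp].
have {}nzp i : \det (colsub (pivot i) (A i)) != 0.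
  by have := nzp i isT; rewrite rowK ev_rowsub.
have EC i : C (fun x => (\matrix_i wedge (A i) : 'M_(3, N)) x.1 x.2) i =
    \adj (colsub (pivot i) (A i)) *m A i.
  by rewrite /C tmK rowK contraction_wedge.
have [g ug Hg] := general_position_adapted nzD.
have nzadj i : \det (\adj (colsub (pivot i) (A i))) != 0.
  have := mul_mx_adj (colsub (pivot i) (A i)) => /(congr1 determinant).
  rewrite det_mulmx det_scalar => E; apply: contra_neq (nzp i) => E0.
  by move: E; rewrite E0 mulr0 => /esym/eqP; rewrite expf_eq0 /= => /eqP.
have [d ud Hd] := @rescale (fun i => (\det (\adj (colsub (pivot i) (A i))))^-1)
  (fun i => invr_neq0 (nzadj i)).
exists (d *m g); first by rewrite unitmx_mul ud.
move=> i; have [R [dR ER]] := Hg i.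
rewrite mulmxA wedge_mulmx Hd -scalemxAl -wedge_mulmx -ER EC wedge_mul_det dR scale1r.
by rewrite wedge_mul_det scalerA mulVf // scale1r.
Qed.

End Configuration.

(** * The third secant variety *)

Lemma pluecker_dimE k n : pluecker_dim k n = 'C(n, k).
Proof. by rewrite -card_ltn_sorted_tuples cardsE. Qed.

Section Terracini.
Variables (K : numFieldType).
Local Notation N := (pluecker_dim 3 8).
Local Notation G := (grassmannian K 3 8).
Local Notation e i := (bv K 8 i).
Local Notation base := (base K).
Implicit Types (y h : 'rV[K]_N).

(** The entries outside of the pivots parametrize the triples of planes; the
    first rows of the last two matrices are rescaled in addition, which gives
    the 3 * 15 + 2 = 47 parameters of the projective secant variety. *)
Definition free_entry : pred ('I_3 * 'I_3 * 'I_8) := fun x =>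
  (val x.2 \notin nth [::] pivots x.1.1) ||
  [&& x.1.1 != ord0, x.1.2 == ord0 & x.2 == pivot x.1.1 ord0].

Lemma card_free_entry : #|{: {x | free_entry x}}| = 47.
Proof.
rewrite card_sig -sum1_card big_mkcond /=.
rewrite -(pair_bigA _ (fun p c => if (p, c) \in free_entry then 1 else 0)%N) /=.
rewrite -(pair_bigA _ (fun i r => \sum_(c < 8) if (i, r, c) \in free_entry then 1 else 0)%N) /=.
rewrite !big_ord_recl !big_ord0 /in_mem /= /free_entry /pivot /=.
by rewrite -!val_eqE /= !inordK.
Qed.

Lemma bv_delta (c : 'I_8) : delta_mx 0 c = e c.
Proof. by apply/rowP=> j; rewrite !mxE. Qed.

Lemma tang_delta h' (A : 'M[K]_(3, 8)) :
  (forall r c, ev h' (setrow A r (delta_mx 0 c)) = 0) -> tang h' A.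
Proof.
move=> H r v; rewrite (row_sum_delta v).
elim/big_ind: _ => [|u w Hu Hw|c _]; first exact: ev_setrow0.
  by rewrite -[u]scale1r ev_setrowP Hu Hw mulr0 addr0.
by rewrite -[_ *: _]addr0 ev_setrowP H mulr0 add0r ev_setrow0.
Qed.

Let psi := chart_sum base 1%:M (a := free_entry).
Let dpsi := chart_dsum base 1%:M (a := free_entry).
Let s0 := chart_origin base (a := free_entry).

(** Replacing a row by the basis vector of a pivot gives a repeated vector or
    the summand itself; two summands are scaled by parameters, and the base
    point is the sum of all three. In the third plane the columns 0 and 3
    combine, its first row being e 0 + e 3. *)
Lemma frame_base_eq0 y : (forall x, pairing (frame psi dpsi s0 x) y = 0) ->
  forall i, tang y (base i).
Proof.
move=> y0.
have Hs i r (c : nat) (ltc : (c < 8)%N) : free_entry (i, r, Ordinal ltc) ->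
    ev y (setrow (base i) r (e c)) = 0.
  move=> ax; have := y0 (Some (Sub (i, r, Ordinal ltc) ax)); rewrite pairingC /= /dpsi /chart_dsum /=.
  by rewrite mulmx1 chart_originE bv_delta.
have Hn : \sum_i ev y (base i) = 0.
  have := y0 None; rewrite /= /psi /chart_sum chart_originE pairingC pairing_sumr => E0.
  by rewrite -[RHS]E0; apply: eq_bigr => i _; rewrite mulmx1.
have Hs1 (i r : 'I_3) (c : 'I_8) : val c \notin nth [::] pivots i -> ev y (setrow (base i) r (e c)) = 0.
  by move=> nc; rewrite (Hs i r c (ltn_ord c)) // /free_entry /= nc.
have Hs2 (i : 'I_3) : i != ord0 -> ev y (setrow (base i) ord0 (e (pivot i ord0))) = 0.
  by move=> nzi; rewrite (Hs _ _ _ (ltn_ord _)) // /free_entry nzi /= -val_eqE /= eqxx orbT.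
pose R (u v w x : 'rV[K]_8) := setrow_rows_of3 u v w x.
have Rt u v w : ev y (rows_of 3 [:: u; v; w]) = tri y u v w by [].
have T1 : tang y (base (lift ord0 ord0)).
  apply: tang_delta => r c; rewrite bv_delta.
  have [inp|nc] := boolP (val c \in [:: 3; 4; 5]%N); last exact: (Hs1 (lift ord0 ord0) r c nc).
  have E : tri y (e 3) (e 4) (e 5) = 0.
    have := Hs2 (lift ord0 ord0) isT; rewrite /base /pivot /= inordK //.
    by have [-> _ _] := R (e 3) (e 4) (e 5) (e 3).
  rewrite /base /=; have [E1 E2 E3] := R (e 3) (e 4) (e 5) (e c).
  elim/ord3P: r; rewrite ?E1 ?E2 ?E3 Rt; move: inp; rewrite !inE => /or3P[]/eqP->;
    by rewrite ?tri_alt12 ?tri_alt13 ?tri_alt23.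
have T2 : tang y (base ord_max).
  have pE x : [/\ tri y x (e 6) (e 7) = ev y (setrow (base ord_max) ord0 x),
      tri y (e 0 + e 3) x (e 7) = ev y (setrow (base ord_max) (lift ord0 ord0) x) &
      tri y (e 0 + e 3) (e 6) x = ev y (setrow (base ord_max) ord_max x)].
    by rewrite /base /=; have [-> -> ->] := R (e 0 + e 3) (e 6) (e 7) x.
  have E0 : tri y (e 0) (e 6) (e 7) = 0.
    by have [-> _ _] := pE (e 0); have := Hs2 ord_max isT; rewrite /pivot /= inordK.
  have [E3 E3' E3''] : [/\ tri y (e 3) (e 6) (e 7) = 0, tri y (e 0 + e 3) (e 3) (e 7) = 0 &
      tri y (e 0 + e 3) (e 6) (e 3) = 0].
    have [-> -> ->] := pE (e 3).
    by split; apply: (Hs1 _ _ (Ordinal (isT : (3 < 8)%N))).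
  rewrite triD1 tri_alt12 addr0 in E3'; rewrite triD1 tri_alt13 addr0 in E3''.
  have E : tri y (e 0 + e 3) (e 6) (e 7) = 0 by rewrite triD1 E0 E3 addr0.
  apply: tang_delta => r c; rewrite bv_delta.
  have [inp|nc] := boolP (val c \in [:: 0; 6; 7]%N); last exact: (Hs1 ord_max r c nc).
  have [F1 F2 F3] := pE (e c).
  elim/ord3P: r; rewrite -?F1 -?F2 -?F3; move: inp; rewrite !inE => /or3P[]/eqP->;
    rewrite ?tri_alt12 ?tri_alt13 ?tri_alt23 ?E ?E0 //.
    by rewrite triD1 tri_alt12 add0r tri_swap12 E3' oppr0.
  by rewrite triD1 tri_alt13 add0r tri_swap13 E3'' oppr0.
apply: ord3P => //; apply: tang_delta => r c; rewrite bv_delta.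
have [inp|nc] := boolP (val c \in [:: 0; 1; 2]%N); last exact: (Hs1 ord0 r c nc).
have E : tri y (e 0) (e 1) (e 2) = 0.
  move: Hn; rewrite !big_ord_recl big_ord0 (tang_ev ord0 T1).
  have -> : lift ord0 (lift ord0 ord0) = ord_max :> 'I_3 by apply/val_inj.
  by rewrite (tang_ev ord0 T2) !addr0.
rewrite /base /=; have [E1 E2 E3] := R (e 0) (e 1) (e 2) (e c).
elim/ord3P: r; rewrite ?E1 ?E2 ?E3 Rt; move: inp; rewrite !inE => /or3P[]/eqP->;
  by rewrite ?tri_alt12 ?tri_alt13 ?tri_alt23.
Qed.

(** The 48 vectors of the frame and 8 further coordinates determine a
    hyperplane, and 56 is the number of coordinates. *)
Lemma framed_base : framed psi dpsi s0.
Proof.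
have dims : (#|{: option {x | free_entry x}}| + 8 = N)%N.
  by rewrite card_option card_free_entry pluecker_dimE.
pose W := frame_mx psi dpsi s0.
(* The supplementary coordinates are those of the 2 x 2 x 2 tensor. *)
pose l := [:: [:: 1; 4; 6]; [:: 1; 4; 7]; [:: 1; 5; 6]; [:: 1; 5; 7];
  [:: 2; 4; 6]; [:: 2; 4; 7]; [:: 2; 5; 6]; [:: 2; 5; 7]]%N.
pose V : 'M[K]_(8, N) := \matrix_i wedge (rows_of 3 [seq e j | j <- nth [::] l i]).
have freeM : row_free (col_mx W V)^T.
  rewrite -kermx_eq0; apply/eqP/row_matrixP=> a; rewrite row0; set y := row a _.
  have : y *m (col_mx W V)^T = 0 by rewrite /y -row_mul mulmx_ker row0.
  rewrite tr_col_mx mul_mx_row -[RHS]row_mx0 => /eq_row_mx[yW yV].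
  have pyW x : pairing (frame psi dpsi s0 x) y = 0.
    move/rowP/(_ (enum_rank x)): yW; rewrite mxE [RHS]mxE => E; rewrite -[RHS]E pairingC.
    apply: eq_bigr => j _; congr (_ * _).
    by rewrite [RHS]mxE [RHS]mxE enum_rankK.
  have pyV (b : 'I_8) : ev y (rows_of 3 [seq e j | j <- nth [::] l b]) = 0.
    move/rowP/(_ b): yV; rewrite mxE [RHS]mxE => E; rewrite -[RHS]E.
    by apply: eq_bigr => j _; congr (_ * _); rewrite [RHS]mxE [RHS]mxE.
  apply: tang_base_eq0; first exact: frame_base_eq0.
  have pyV' k (ltk : (k < 8)%N) := pyV (Ordinal ltk).
  move=> i j k; rewrite !inE => /orP[]/eqP-> /orP[]/eqP-> /orP[]/eqP->.
  - exact: (pyV' 0%N).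
  - exact: (pyV' 1%N).
  - exact: (pyV' 2%N).
  - exact: (pyV' 3%N).
  - exact: (pyV' 4%N).
  - exact: (pyV' 5%N).
  - exact: (pyV' 6%N).
  - exact: (pyV' 7%N).
have : row_free (col_mx W V).
  by rewrite /row_free; move: freeM; rewrite /row_free mxrank_tr => /eqP->; rewrite dims.
case/row_freeP => B HB; pose B1 := lsubmx B.
have WB : W *m B1 = 1%:M.
  move: HB; rewrite -[B]hsubmxK mul_col_row -/B1 => /(congr1 ulsubmx).
  by rewrite block_mxKul scalar_mx_block block_mxKul.
exists (fun x => (col (enum_rank x) B1)^T) => x z.
move/matrixP/(_ (enum_rank x) (enum_rank z)): WB.
rewrite mxE [RHS]mxE (inj_eq enum_rank_inj) => <-; apply: eq_bigr => j _.
by rewrite !mxE enum_rankK.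
Qed.

Lemma base_neq0 i : wedge (base i) != 0.
Proof. by apply: (wedge_neq0_colsub (f := pivot i)); rewrite base_pivot det1 oner_neq0. Qed.

Lemma base_mulmx_neq0 i g : g \in unitmx -> wedge (base i *m g) != 0.
Proof. by move=> ug; apply: wedge_mulmx_neq0 => //; apply: base_neq0. Qed.

Lemma wedge_sum_base_neq0 : wedge_sum base != 0.
Proof.
apply/eqP => E; have [u Hu] := framed_base; have := Hu None None.
rewrite eqxx /= /psi /chart_sum chart_originE /pairing.
rewrite (eq_bigr (fun=> 0)) => [|j _]; last first.
  have -> : \sum_i wedge (base i *m 1%:M) = wedge_sum base.
    by apply: eq_bigr => i _; rewrite mulmx1.
  by rewrite E mxE mul0r.
by rewrite big1 // => /eqP; rewrite eq_sym oner_eq0.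
Qed.

(** Where the minors at the pivots do not vanish, the matrices are normalized to
    have the identity there; their determinants become a common factor and the
    two scaling parameters. *)
Lemma param_chart_secant : param psi (secant_variety 3 G).
Proof.
have par := param_secant wedge_sum_base_neq0.
pose D (s : 'I_3 * 'I_3 * 'I_8 -> K) := \prod_i \det (colsub (pivot i) (mats_of s i)).
apply: (@param_cover _ _ _ _ _ psi _ D (of_mats base) par).
- exact: polymap_wedge_sum.
- move=> u; exists (of_mats (chart base u)); rewrite mats_ofK.
  by apply: eq_bigr => i _; rewrite mulmx1.
- apply: polyfun_prod => i; apply: polyfun_det => r c.
  by under eq_fun do rewrite mxE; apply: polyfun_mats_of.
- by rewrite /D mats_ofK big1 ?oner_neq0 // => i _; rewrite base_pivot det1.
move=> s /prodf_neq0 nzD; pose M := mats_of s; pose C i := colsub (pivot i) (M i).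
have nzC i : \det (C i) != 0 by apply: nzD.
have uC i : C i \in unitmx by rewrite unitmxE unitfE.
pose B i := invmx (C i) *m M i.
have BP i : colsub (pivot i) (B i) = 1%:M.
  rewrite -(mulVmx (uC i)); apply/matrixP=> r c; rewrite mxE [RHS]mxE mxE.
  by apply: eq_bigr => l _; rewrite [in RHS]mxE.
(* The first summand is normalized by the common factor. *)
pose c i := \det (C i) / \det (C ord0).
pose B' i := setrow (B i) ord0 (c i *: row ord0 (B i)).
have EB : chart base (chart_origin B' (a := free_entry)) = B'.
  apply: chart_fill => i r j; rewrite /free_entry negb_or negbK /= => /andP[inp nsc].
  have [l Ej] : exists l, j = pivot i l.
    have szp : size (nth [::] pivots i) = 3%N by elim/ord3P: i {inp nsc}.
    have lt3 : (index (val j) (nth [::] pivots i) < 3)%N.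
      by move: inp; rewrite -index_mem szp.
    exists (Ordinal lt3); rewrite /pivot /= nth_index //.
    by apply/val_inj; rewrite /= inordK ?ltn_ord.
  have B1 r' : B i r' j = (r' == l)%:R.
    by have /matrixP/(_ r' l) := BP i; rewrite !mxE Ej.
  have b1 r' : base i r' j = (r' == l)%:R.
    by have /matrixP/(_ r' l) := base_pivot K i; rewrite !mxE Ej.
  rewrite setrowE b1; case: eqP => [Er|_]; last exact: B1.
  rewrite mxE [X in _ * X]mxE -Er B1; case: eqP => [El|_]; last by rewrite mulr0.
  have Ei : i = ord0.
    by apply/eqP; apply: contraR nsc => ->; rewrite Er eqxx Ej -El Er /=.
  by rewrite /c Ei mulfV ?nzC // mulr1.
exists (\det (C ord0)), (chart_origin B' (a := free_entry)).
rewrite /psi /chart_sum EB scaler_sumr; apply: eq_bigr => i _.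
rewrite mulmx1 /B' wedge_setrowZ scalerA /c mulrCA mulfV ?nzC // mulr1.
by rewrite -wedge_mul_det /B mulKVmx.
Qed.

(** By the parametrization, the tangent space at a general point of the chart is
    spanned by the tangent spaces of the Grassmannian at the summands. The
    general point is in the orbit of the base point, to which smoothness and
    tangency are transported. *)
Lemma secant3_base : smooth_point (secant_variety 3 G) (wedge_sum base) /\
  forall h, (forall i, tang h (base i)) -> tangent_at (secant_variety 3 G) h (wedge_sum base).
Proof.
have clX : proj_closed (secant_variety 3 G) by rewrite secant_varietyE; apply: proj_closure_closed.
have [Q [pQ [s1 Qs1] HQ]] := smooth_param (@polymap_chart_sum _ _ _ _ _ _ _)
  (@multiaffine_chart _ _ _ _ _ _ _) framed_base clX param_chart_secant.
have [F [nzF HF]] := general_triple K.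
pose f (s : {x | free_entry x} -> K) := F.@[mxvec (\matrix_i wedge (chart base s i)) 0].
have pf : polyfun f.
  apply: (@polyfun_meval _ _ _ _ (fun j s => mxvec (\matrix_i wedge (chart base s i)) 0 j)) => j.
  case/mxvec_indexP: j => i j; under eq_fun do rewrite mxvecE mxE.
  apply: polyfun_wedge => r c; under eq_fun do rewrite mxE.
  by case: insub => [x|]; [exact: polyfun_var | exact: polyfun_cst].
have fs0 : f s0 != 0 by rewrite /f chart_originE.
(* A parameter that is general in both senses. *)
have [s [Qs /HF[g ug Eg]]] := polyfun_dense pQ pf Qs1 fs0.
have [nzs sms Ts] := HQ s Qs.
have Epsi : psi s = wedge_sum base *m compound 3 g.
  rewrite -wedge_sum_mulmx /psi /chart_sum; apply: eq_bigr => i _.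
  by rewrite mulmx1 Eg.
pose L := compound 3 g; have uL : L \in unitmx by apply: compound_unit.
have stL : stable (secant_variety 3 G) L by apply: stable_secant.
have stV : stable (secant_variety 3 G) (invmx L).
  by rewrite -compoundV //; apply: stable_secant; rewrite unitmx_inv.
split.
  rewrite -[wedge_sum base](mulmxK uL) -Epsi; apply: smooth_point_mulmx => //.
    by rewrite unitmx_inv.
  by rewrite invmxK.
move=> h th v /(tangent_space_mulmx stL); rewrite -Epsi => /Ts vW.
pose h' := h *m compound 3 (invmx g)^T.
change (pairing h v = 0); rewrite -[v](mulmxK uL).
rewrite (_ : invmx L = (compound 3 (invmx g)^T)^T); last by rewrite -compoundT trmxK compoundV.
rewrite -pairing_mulmx -/h'.
have th' i : tang h' (chart base s i).
  have nzb : wedge (base i *m g) != 0 by apply: base_mulmx_neq0.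
  have tB : tang h' (base i *m g).
    apply/tang_mulmx; first by rewrite unitmx_tr unitmx_inv.
    by rewrite trmxK mulmxK.
  have nzc : wedge (chart base s i) != 0 by rewrite Eg.
  apply/(@grassmannian_tangent K 2 5 (chart base s i) nzc).2; rewrite Eg.
  exact/(@grassmannian_tangent K 2 5 (base i *m g) nzb).2.
apply: (pairing_submx vW) => j; rewrite rowK; case: (enum_val j) => [x|] /=.
  by rewrite /dpsi /chart_dsum mulmx1; apply: th'.
rewrite pairing_sumr big1 // => i _; rewrite mulmx1.
exact: (tang_ev ord0 (th' i)).
Qed.

Lemma secant3_indep r : indep (secant_variety 3 G) r -> (r <= 48)%N.
Proof.
by move/(param_indep_le (@polymap_chart_sum _ _ _ _ _ _ _) param_chart_secant);
  rewrite card_free_entry.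
Qed.

End Terracini.

(** * Matrices of rank one *)

Section RankOne.
Variable (K : numFieldType).

Definition rank_one m n (M : 'M[K]_(m, n)) := exists (u : 'cV_m) (v : 'rV_n), M = u *m v.

Lemma rank_oneP m n (M : 'M[K]_(m, n)) :
  (forall i j k l, M i k * M j l = M i l * M j k) -> rank_one M.
Proof.
move=> minors; have [[i0 [j0 nz]]|M0] := pselect (exists i j, M i j != 0).
  exists (\col_i (M i j0 / M i0 j0)), (row i0 M); apply/matrixP=> i j.
  by rewrite mxE big_ord1 !mxE mulrAC minors mulfK.
exists 0, 0; rewrite mul0mx; apply/matrixP=> i j; rewrite mxE; apply/eqP.
by apply: contra_notT M0 => nz; exists i, j.
Qed.

(** Covers the cases of equal indices as well, in the form needed for matrices
    of rank one. *)
Lemma det2_minors (M : 'M[K]_2) i j k l : \det M = 0 -> M i k * M j l = M i l * M j k.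
Proof.
move=> d0.
have E : M ord0 ord0 * M ord_max ord_max = M ord0 ord_max * M ord_max ord0.
  have := d0; rewrite (expand_det_row _ ord0) !big_ord_recl big_ord0 /cofactor !det_mx11 !mxE /=.
  have -> : lift ord0 ord0 = ord_max :> 'I_2 by apply/val_inj.
  have -> : lift ord_max ord0 = ord0 :> 'I_2 by apply/val_inj.
  by rewrite expr0 expr1 mul1r mulN1r mulrN addr0 => /eqP; rewrite subr_eq0 => /eqP.
have o2 (a : 'I_2) : a = ord0 \/ a = ord_max.
  by case: a => [[|[|//]] ?]; [left|right]; apply/val_inj.
have [->|->] := o2 i; have [->|->] := o2 j; have [->|->] := o2 k; have [->|->] := o2 l;
  first [by [] | by rewrite mulrC | by rewrite E | by rewrite -E | by rewrite mulrC -E mulrC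
    | by rewrite mulrC E mulrC].
Qed.

Lemma det_setrow_rank_one (M : 'M[K]_3) r v : rank_one M -> \det (setrow M r v) = 0.
Proof.
move=> [a [b ->]].
have [i [j [ne_ij ne_ir ne_jr]]] : exists i j, [/\ i != j, i != r & j != r].
  elim/ord3P: r; [exists (lift ord0 ord0), ord_max | exists ord0, ord_max
    | exists ord0, (lift ord0 ord0)]; by [].
have -> : setrow (a *m b) r v = setrow (setrow (setrow (a *m b) r v) i (a i 0 *: b)) j (a j 0 *: b).
  apply/matrixP=> k l; rewrite !setrowE; case: (k =P j) => [->|_].
    by rewrite (negPf ne_jr) !mxE big_ord1.
  by case: (k =P i) => [->|//]; rewrite (negPf ne_ir) !mxE big_ord1.
rewrite det_setrow; under eq_bigr do rewrite mxE -mulrA.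
rewrite -mulr_sumr -det_setrow.
have -> : setrow (setrow (setrow (a *m b) r v) i (a i 0 *: b)) j b =
    setrow (setrow (setrow (a *m b) r v) j b) i (a i 0 *: b).
  apply/matrixP=> k l; rewrite !setrowE; case: (k =P j) => // ->.
  by rewrite eq_sym (negPf ne_ij).
rewrite det_setrow; under eq_bigr do rewrite mxE -mulrA.
rewrite -mulr_sumr -det_setrow (determinant_alternate ne_ij) ?mulr0 // => l.
by rewrite !setrowE eqxx eq_sym (negPf ne_ij) eqxx.
Qed.

(** The cofactors are the determinants with a row replaced by a unit vector. *)
Lemma rank_one_det_setrow (M : 'M[K]_3) : (forall r v, \det (setrow M r v) = 0) -> rank_one M.
Proof.
move=> M0; have cof0 r l : \det (row' r (col' l M)) = 0.
  have := M0 r (delta_mx 0 l); rewrite det_setrow (bigD1 l) //= big1 => [|j ne].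
    rewrite mxE !eqxx mul1r addr0 /cofactor => /eqP.
    by rewrite mulf_eq0 signr_eq0 => /eqP.
  by rewrite mxE (negPf ne) andbF mul0r.
have third (i j : 'I_3) : exists r, r != i /\ r != j.
  by elim/ord3P: i; elim/ord3P: j; do [exists ord0; split=> //; fail | exists (lift ord0 ord0); split=> //; fail | exists ord_max; split=> //].
apply: rank_oneP => i j k l.
have [r [nri nrj]] := third i j; have [s [nsk nsl]] := third k l.
case: (unliftP r i) nri => [i' ->|->]; last by rewrite eqxx.
case: (unliftP r j) nrj => [j' ->|->]; last by rewrite eqxx.
case: (unliftP s k) nsk => [k' ->|->]; last by rewrite eqxx.
case: (unliftP s l) nsl => [l' ->|->]; last by rewrite eqxx.
by move=> _ _ _ _; have := det2_minors i' j' k' l' (cof0 r s); rewrite !mxE.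
Qed.

Lemma rank_one_coefs (a b c d : K) : a * d = b * c ->
  exists l0 l1 m0 m1, [/\ a = l0 * m0, b = l0 * m1, c = l1 * m0 & d = l1 * m1].
Proof.
move=> E; have [a0|nza] := eqVneq a 0; last first.
  exists 1, (c / a), a, b; split; rewrite ?mul1r ?mulfVK //.
  by apply: (mulfI nza); rewrite E; field.
have [b0|nzb] := eqVneq b 0; first by exists 0, 1, c, d; rewrite a0 b0 !mul0r !mul1r.
exists 1, (d / b), 0, b; rewrite !mul1r mulr0 mulfVK //; split=> //.
by apply: (mulfI nzb); rewrite -E a0 mul0r mulr0.
Qed.

End RankOne.

(** * Hyperplanes tangent along a triple of planes *)

Section Conormal.
Variables (K : numClosedFieldType).
Local Notation N := (pluecker_dim 3 8).
Local Notation e i := (bv K 8 i).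
Local Notation base := (base K).
Implicit Types (y h : 'rV[K]_N).

Definition det22 (M : nat -> nat -> K) := M 0 0 * M 1 1 - M 0 1 * M 1 0.

(** The discriminant of det (P + z Q) as a polynomial in z, times its leading
    coefficient: where it does not vanish the pencil has two distinct singular
    members. It is a multiple of the hyperdeterminant of Cayley. *)
Definition pencil_disc (P Q : nat -> nat -> K) :=
  let m := P 0 0 * Q 1 1 + P 1 1 * Q 0 0 - P 0 1 * Q 1 0 - P 1 0 * Q 0 1 in
  det22 Q * (m ^+ 2 - 4 * det22 P * det22 Q).

(** The two singular members of the pencil have rank one, and P and Q are
    combinations of them. *)
Lemma tensor222 (P Q : nat -> nat -> K) :
  pencil_disc P Q != 0 ->
  exists a b c a' b' c' : nat -> K,
    [/\ a 0 * a' 1 - a 1 * a' 0 != 0, b 0 * b' 1 - b 1 * b' 0 != 0,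
        c 0 * c' 1 - c 1 * c' 0 != 0 &
        forall i j, (i < 2)%N -> (j < 2)%N -> P i j = a i * b j * c 0 + a' i * b' j * c' 0 /\
          Q i j = a i * b j * c 1 + a' i * b' j * c' 1].
Proof.
rewrite /pencil_disc /=; set m := _ - P 1 0 * Q 0 1.
rewrite mulf_eq0 negb_or => /andP[nzQ nzdisc].
pose D := sqrtC (m ^+ 2 - 4 * det22 P * det22 Q).
have D2 : D ^+ 2 = m ^+ 2 - 4 * det22 P * det22 Q by rewrite sqrtCK.
have nzD : D != 0 by rewrite sqrtC_eq0.
have nz2 : (2 : K) != 0 by rewrite pnatr_eq0.
have root s : s ^+ 2 = D ^+ 2 -> let z := (- m + s) / (2 * det22 Q) in
    det22 (fun i j => P i j + z * Q i j) = 0.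
  move=> s2 z; have -> : det22 (fun i j => P i j + z * Q i j) = det22 P + z * m + z ^+ 2 * det22 Q.
    by rewrite /det22 /m; ring.
  have : (m ^+ 2 - s ^+ 2 - 4 * det22 P * det22 Q) = 0 by rewrite s2 D2; ring.
  move=> E; apply: (mulfI (_ : 4 * det22 Q != 0)); first by rewrite mulf_neq0 // pnatr_eq0.
  rewrite mulr0 -[RHS]oppr0 -[in RHS]E /z; field; exact: nzQ.
pose z := (- m + D) / (2 * det22 Q); pose z' := (- m - D) / (2 * det22 Q).
have rk w : det22 (fun i j => P i j + w * Q i j) = 0 -> exists a b : nat -> K,
    forall i j, (i < 2)%N -> (j < 2)%N -> P i j + w * Q i j = a i * b j.
  move=> /eqP; rewrite subr_eq0 => /eqP/rank_one_coefs[a0 [a1 [b0 [b1 [E0 E1 E2 E3]]]]].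
  exists (fun i => if i == 0%N then a0 else a1), (fun j => if j == 0%N then b0 else b1).
  by move=> [|[|//]] [|[|//]].
have [a [b Eab]] := rk z (root D erefl).
have [a' [b' Eab']] := rk z' (root (- D) (sqrrN D)).
pose d := z - z'; have Ed : d = D / det22 Q by rewrite /d /z /z'; field; exact: nzQ.
have nzd : d != 0 by rewrite Ed mulf_neq0 // invr_eq0.
(* The coefficients solving P + z Q = a b and P + z' Q = a' b' for P and Q. *)
pose c i := if i == 0%N then - z' / d else 1 / d.
pose c' i := if i == 0%N then z / d else - 1 / d.
exists a, b, c, a', b', c'.
have EQ i j : (i < 2)%N -> (j < 2)%N -> P i j = a i * b j * c 0%N + a' i * b' j * c' 0%N /\
    Q i j = a i * b j * c 1%N + a' i * b' j * c' 1%N.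
  move=> lti ltj; rewrite /c /c' /= -Eab // -Eab' // /d; split; field; exact: nzd.
have : det22 Q * d ^+ 2 = - (a 0%N * a' 1%N - a 1%N * a' 0%N) * (b 0%N * b' 1%N - b 1%N * b' 0%N).
  have EQ' i j : (i < 2)%N -> (j < 2)%N -> Q i j * d = a i * b j - a' i * b' j.
    by move=> lti ltj; rewrite -Eab // -Eab' // /d; ring.
  transitivity ((Q 0%N 0%N * d) * (Q 1%N 1%N * d) - (Q 0%N 1%N * d) * (Q 1%N 0%N * d)).
    by rewrite /det22; ring.
  by rewrite !EQ' //; ring.
move=> E; have : - (a 0%N * a' 1%N - a 1%N * a' 0%N) * (b 0%N * b' 1%N - b 1%N * b' 0%N) != 0.
  by rewrite -E mulf_neq0 // expf_neq0.
rewrite mulf_eq0 oppr_eq0 negb_or => /andP[nza nzb]; split=> //.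
rewrite /c /c' /= (_ : _ - _ = - d^-1) ?oppr_eq0 ?invr_eq0 //.
by rewrite /d; field; exact: nzd.
Qed.

(** The two slices of the 2 x 2 x 2 tensor of the coefficients left free by
    tangency along the base triple. *)
Definition coef6 y i j := tri y (e i.+1) (e (4 + j)%N) (e 6).
Definition coef7 y i j := tri y (e i.+1) (e (4 + j)%N) (e 7).

Definition hyperdet y := pencil_disc (coef6 y) (coef7 y).

(** As an alternating trilinear form: the sum of two decomposable forms in
    independent variables. *)
Definition split_form : 'rV[K]_N := wedge (base ord0) + wedge (base (lift ord0 ord0)).

(** Three linear forms, each in the two variables of one of the factors of the 2
    x 2 x 2 tensors. *)
Definition block_rows (a b c : nat -> K) : 'M[K]_(3, 8) :=
  rows_of 3 [:: a 0 *: e 1 + a 1 *: e 2; b 0 *: e 4 + b 1 *: e 5; c 0 *: e 6 + c 1 *: e 7].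

Let d3 r : 'rV[K]_3 := bv K 3 r.

(** Each basis vector is seen by one of the three linear forms at most. *)
Lemma bv_block_rows a b c : let B := (block_rows a b c)^T in
  [/\ e 0 *m B = 0 *: d3 0, e 3 *m B = 0 *: d3 0,
      e 1 *m B = a 0 *: d3 0 /\ e 2 *m B = a 1 *: d3 0,
      e 4 *m B = b 0 *: d3 1 /\ e 5 *m B = b 1 *: d3 1 &
      e 6 *m B = c 0 *: d3 2 /\ e 7 *m B = c 1 *: d3 2].
Proof.
move=> B; have E i (lti : (i < 8)%N) : e i *m B = \row_r block_rows a b c r (Ordinal lti).
  rewrite (_ : e i = delta_mx 0 (Ordinal lti)); first by apply/rowP=> r; rewrite -rowE !mxE.
  by apply/rowP=> j; rewrite !mxE.
have Es := (E 0%N isT, E 1%N isT, E 2%N isT, E 3%N isT, E 4%N isT, E 5%N isT, E 6%N isT, E 7%N isT).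
by split; [ | | split | split | split]; rewrite Es; apply/rowP; elim/ord3P;
  rewrite !mxE /= ?mxE /= ?mxE ?(mulr0, mul0r, mulr1, addr0, add0r).
Qed.

Lemma rank_one_rows3 n (v : 'rV[K]_n) (p q r : K) :
  rank_one (rows_of 3 [:: p *: v; q *: v; r *: v]).
Proof.
exists (\col_i [:: p; q; r]`_i), v; apply/matrixP; elim/ord3P => j;
  by rewrite [RHS]mxE big_ord1 !mxE /= ?mxE.
Qed.

Lemma tang_wedge_rank_one (A B : 'M[K]_(3, 8)) : rank_one (A *m B^T) -> tang (wedge B) A.
Proof. by move=> rk r v; rewrite ev_wedge -det_tr trmx_mul trmxK setrow_mul det_setrow_rank_one. Qed.

Lemma tang_block_rows a b c i : tang (wedge (block_rows a b c)) (base i).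
Proof.
apply: tang_wedge_rank_one; have [E0 E3 [E1 E2] [E4 E5] [E6 E7]] := bv_block_rows a b c.
elim/ord3P: i; rewrite /base /= rows_of_mulmx /= ?mulmxDl ?E0 ?E1 ?E2 ?E3 ?E4 ?E5 ?E6 ?E7.
- exact: rank_one_rows3.
- by rewrite !scale0r -(scale0r (d3 1)); apply: rank_one_rows3.
- by rewrite !scale0r addr0 -(scale0r (d3 2)); apply: rank_one_rows3.
Qed.

Lemma tri_block_rows a b c i j l : (i < 2)%N -> (j < 2)%N -> (l < 2)%N ->
  tri (wedge (block_rows a b c)) (e i.+1) (e (4 + j)%N) (e (6 + l)%N) = a i * b j * c l.
Proof.
have [_ _ [E1 E2] [E4 E5] [E6 E7]] := bv_block_rows a b c.
have diag (p q r : K) : \det (rows_of 3 [:: p *: d3 0; q *: d3 1; r *: d3 2]) = p * q * r.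
  rewrite -(det_mat3_upper p 0 0 q 0 r); congr (\det _); apply/matrixP.
  by elim/ord3P; elim/ord3P; rewrite !mxE /= ?mxE /= ?mulr1 ?mulr0.
move=> lti ltj ltl; rewrite /tri ev_wedge -det_tr trmx_mul trmxK rows_of_mulmx /=.
by case: i lti => [|[|//]] _; case: j ltj => [|[|//]] _; case: l ltl => [|[|//]] _;
  rewrite ?E1 ?E2 ?E4 ?E5 ?E6 ?E7 diag.
Qed.

(** Cramer's rule. *)
Lemma sub_span2 (M : 'M[K]_8) (u v : 'rV[K]_8) (a b c d : K) : a * d - b * c != 0 ->
  ((a *: u + b *: v)%R <= M)%MS -> ((c *: u + d *: v)%R <= M)%MS -> (u <= M)%MS && (v <= M)%MS.
Proof.
set D := _ - _ => nzD s1 s2.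
have sub (x w : 'rV[K]_8) (p q : K) : (x <= M)%MS -> (w <= M)%MS -> ((p *: x - q *: w)%R <= M)%MS.
  by move=> xM wM; rewrite addmx_sub ?eqmx_opp ?scalemx_sub.
have Eu : D *: u = d *: (a *: u + b *: v) - b *: (c *: u + d *: v).
  by apply/rowP=> j; rewrite !mxE /D; ring.
have Ev : D *: v = a *: (c *: u + d *: v) - c *: (a *: u + b *: v).
  by apply/rowP=> j; rewrite !mxE /D; ring.
have := sub _ _ d b s1 s2; have := sub _ _ a c s2 s1.
by rewrite -Eu -Ev !(eqmx_scale _ nzD) => -> ->.
Qed.

(** The coefficients left free by tangency form a 2 x 2 x 2 tensor, whose
    decomposition into two decomposable tensors decomposes the alternating form
    itself. The six linear forms that occur are independent of e 0 and e 3 and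
    of each other, since the two summands are not proportional in any factor. *)
Lemma conormal_split y : (forall i, tang y (base i)) -> hyperdet y != 0 ->
  exists2 P, P \in unitmx & y = split_form *m compound 3 P.
Proof.
move=> ty /tensor222[a [b [c [a' [b' [c' [nza nzb nzc Ey]]]]]]].
pose P := rows_of 8 [:: a 0 *: e 1 + a 1 *: e 2; b 0 *: e 4 + b 1 *: e 5; c 0 *: e 6 + c 1 *: e 7;
  a' 0 *: e 1 + a' 1 *: e 2; b' 0 *: e 4 + b' 1 *: e 5; c' 0 *: e 6 + c' 1 *: e 7; e 0; e 3].
have EP : split_form *m compound 3 P = wedge (block_rows a b c) + wedge (block_rows a' b' c').
  by rewrite /split_form mulmxDl -!wedge_mulmx !base_mulmx.
exists P.
  have S i (lti : (i < 8)%N) : (row (Ordinal lti) P <= P)%MS by exact: row_sub.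
  have s0 : ((a 0%N *: e 1 + a 1%N *: e 2)%R <= P)%MS by have := S 0%N isT; rewrite {1}/P row_rows_of.
  have s1 : ((b 0%N *: e 4 + b 1%N *: e 5)%R <= P)%MS by have := S 1%N isT; rewrite {1}/P row_rows_of.
  have s2 : ((c 0%N *: e 6 + c 1%N *: e 7)%R <= P)%MS by have := S 2%N isT; rewrite {1}/P row_rows_of.
  have s3 : ((a' 0%N *: e 1 + a' 1%N *: e 2)%R <= P)%MS by have := S 3%N isT; rewrite {1}/P row_rows_of.
  have s4 : ((b' 0%N *: e 4 + b' 1%N *: e 5)%R <= P)%MS by have := S 4%N isT; rewrite {1}/P row_rows_of.
  have s5 : ((c' 0%N *: e 6 + c' 1%N *: e 7)%R <= P)%MS by have := S 5%N isT; rewrite {1}/P row_rows_of.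
  have s6 : (e 0%N <= P)%MS by have := S 6%N isT; rewrite {1}/P row_rows_of.
  have s7 : (e 3%N <= P)%MS by have := S 7%N isT; rewrite {1}/P row_rows_of.
  have /andP[t1 t2] := sub_span2 nza s0 s3.
  have /andP[t4 t5] := sub_span2 nzb s1 s4.
  have /andP[t6 t7] := sub_span2 nzc s2 s5.
  have : (1%:M <= P)%MS.
    rewrite -rows_of_bv; apply/row_subP => i; rewrite row_rows_of.
    by case: i => [[|[|[|[|[|[|[|[|//]]]]]]]] ?].
  by rewrite sub1mx row_full_unit.
apply/eqP; rewrite EP -subr_eq0; apply/eqP; set y' := _ + wedge _.
apply: tang_base_eq0 => [i|i j l].
  by apply: tangD => //; apply: tangN; apply: tangD; apply: tang_block_rows.
have H i' j' : (i' < 2)%N -> (j' < 2)%N -> tri (y - y') (e i'.+1) (e (4 + j')%N) (e 6) = 0 /\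
    tri (y - y') (e i'.+1) (e (4 + j')%N) (e 7) = 0.
  move=> lti ltj; have [E6 E7] := Ey i' j' lti ltj; rewrite /tri !evD !evN !evD.
  have T d d' d'' := @tri_block_rows d d' d'' i' j' _ lti ltj.
  have T6 d d' d'' := T 0%N d d' d'' isT; have T7 d d' d'' := T 1%N d d' d'' isT.
  rewrite /tri /= in T6 T7; rewrite !T6 !T7; rewrite /coef6 /coef7 /tri in E6 E7.
  by rewrite E6 E7 !subrr.
rewrite !inE => /orP[]/eqP-> /orP[]/eqP-> /orP[]/eqP->;
  first [by have [] := H 0%N 0%N isT isT | by have [] := H 0%N 1%N isT isT
    | by have [] := H 1%N 0%N isT isT | by have [] := H 1%N 1%N isT isT].
Qed.

(** The tensor with slices diag(1, 1) and diag(1, -1). *)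
Definition hyper_witness : 'rV[K]_N :=
  wedge (block_rows (fun i => (i == 0%N)%:R) (fun i => (i == 0%N)%:R) (fun=> 1)) +
  wedge (block_rows (fun i => (i == 1%N)%:R) (fun i => (i == 1%N)%:R) (fun i => (-1) ^+ i)).

Lemma tang_hyper_witness i : tang hyper_witness (base i).
Proof. by apply: tangD; apply: tang_block_rows. Qed.

Lemma hyperdet_witness : hyperdet hyper_witness != 0.
Proof.
have T a b c i j (lti : (i < 2)%N) (ltj : (j < 2)%N) :
    ev (wedge (block_rows a b c)) (rows_of 3 [:: e i.+1; e (4 + j)%N; e 6]) = a i * b j * c 0%N /\
    ev (wedge (block_rows a b c)) (rows_of 3 [:: e i.+1; e (4 + j)%N; e 7]) = a i * b j * c 1%N.
  split; first by have := @tri_block_rows a b c i j 0%N lti ltj isT.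
  by have := @tri_block_rows a b c i j 1%N lti ltj isT.
have C6 i j : (i < 2)%N -> (j < 2)%N -> coef6 hyper_witness i j =
    (i == 0%N)%:R * (j == 0%N)%:R * 1 + (i == 1%N)%:R * (j == 1%N)%:R * (-1) ^+ 0.
  by move=> lti ltj; rewrite /coef6 /tri evD !(T _ _ _ i j lti ltj).1.
have C7 i j : (i < 2)%N -> (j < 2)%N -> coef7 hyper_witness i j =
    (i == 0%N)%:R * (j == 0%N)%:R * 1 + (i == 1%N)%:R * (j == 1%N)%:R * (-1) ^+ 1.
  by move=> lti ltj; rewrite /coef7 /tri evD !(T _ _ _ i j lti ltj).2.
rewrite /hyperdet /pencil_disc /det22 /= !C6 // !C7 //=.
rewrite ?(expr0, expr1) ?(mul0r, mulr0, mul1r, mulr1, addr0, add0r, subr0, subrr, mulrN1).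
by rewrite addNr expr0n /= sub0r opprK mulN1r oppr_eq0 pnatr_eq0.
Qed.

Lemma split_form_neq0 : split_form != 0.
Proof.
apply/eqP => E; have := ev_rowsub (base ord0) (pivot ord0).
have : ev split_form (rowsub (pivot ord0) 1%:M) = 0 by rewrite E -(scale0r 0) evZ mul0r.
rewrite evD !ev_rowsub base_pivot det1 (_ : \det _ = 0).
  by rewrite addr0 => /eqP; rewrite oner_eq0.
rewrite (expand_det_row _ ord0) big1 // => j _; rewrite mxE.
rewrite (_ : base _ _ _ = 0) ?mul0r //.
by elim/ord3P: j; rewrite /base /= rows_ofE /pivot /= !mxE !inordK.
Qed.

End Conormal.

(** * Singular loci of hyperplane sections *)

Section SingularLocus.
Variables (K : numFieldType) (k m : nat).
Local Notation n := (k.+1 + m)%N.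
Local Notation N := (pluecker_dim k.+1 n).
Local Notation G := (grassmannian K k.+1 n).
Implicit Types (A : 'M[K]_(k.+1, n)) (h w : 'rV[K]_N).

Definition tangency_locus h : set 'rV[K]_N :=
  [set w : 'rV[K]_N | w != 0 /\ exists2 A, w = wedge A & tang h A].

Lemma sing_sectionE h : sing_section G h = tangency_locus h.
Proof.
apply/seteqP; split=> [w [[nz [A E]] _ sm]|w [nz [A E th]]].
  split=> //; exists A => //; rewrite E in nz sm; have [smA tA] := grassmannian_tangent nz.
  exact/tA/sm.
rewrite E in nz *; have [smA tA] := grassmannian_tangent nz.
split=> [||_]; [by split=> //; exists A | exact: (tang_ev ord0 th) | exact/tA].
Qed.

(** The contractions of w span its subspace, so that tangency at w is tested on
    them; the coordinate of w at f, as a factor, makes the condition homogeneous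
    and void where the contractions degenerate. *)
Definition tangency_form h (x : ('I_k.+1 -> 'I_n) * 'I_k.+1 * 'rV[K]_n) (w : 'rV[K]_N) :=
  ev h (setrow (contraction x.1.1 w) x.1.2 (ev w (rowsub x.1.1 1%:M) *: x.2)).

Lemma isform_tangency h x : isform (tangency_form h x).
Proof.
case: x => [[f r] v].
have pr i : polyfun (fun s : 'I_N -> K => (\row_i s i) 0 i).
  by under eq_fun do rewrite mxE; apply: polyfun_var.
have pe (B : 'M[K]_(k.+1, n)) : polyfun (fun s : 'I_N -> K => ev (\row_i s i) B).
  by apply: polyfun_ev => // r' c; apply: polyfun_cst.
apply: (isform_polyfun (d := k.+1)); last first.
  move=> c w; rewrite /tangency_form /= contractionZ evZ -scalerA.
  rewrite (_ : setrow _ _ _ = c *: setrow (contraction f w) r (ev w (rowsub f 1%:M) *: v)).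
    by rewrite /ev wedgeZ /pairing mulr_sumr; apply: eq_bigr => i _; rewrite rowZE mulrCA.
  by apply/matrixP=> i j; rewrite [RHS]mxE !setrowE; case: ifP => _; rewrite [LHS]mxE.
apply: polyfun_ev => [i|r' c]; first exact: polyfun_cst.
under eq_fun do rewrite setrowE; case: eqP => _ /=.
  by under eq_fun do rewrite mxE; apply: polyfunM => //; apply: polyfun_cst.
by under eq_fun do rewrite mxE.
Qed.

Lemma tangency_locus_closed h : proj_closed (tangency_locus h).
Proof.
pose F (x : ('I_k.+1 -> 'I_n) * 'I_N + ('I_k.+1 -> 'I_n) * 'I_k.+1 * 'rV[K]_n) :=
  match x with inl y => pluecker_form y | inr y => tangency_form h y end.
have := @proj_closed_forms K N _ F; rewrite (_ : [set w | _] = tangency_locus h).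
  by apply; case=> x; [exact: isform_pluecker | exact: isform_tangency].
have adjU f A : \det (colsub f A) != 0 -> \adj (colsub f A) \in unitmx.
  move=> nzd; have /mulmx1_unit[] // : ((\det (colsub f A))^-1 *: colsub f A) *m \adj (colsub f A) = 1%:M.
  by rewrite -scalemxAl mul_mx_adj scale_scalar_mx mulVf.
apply/seteqP; split=> [w [nz w0]|w [nz [A E th]]]; split=> //.
  have [f nzf] := pluecker_coord_neq0 nz.
  have [A E] := decomposable (fun s => w0 (inl (f, s))) nzf; exists A => //.
  move: nz nzf; rewrite E ev_rowsub => nz nzd; have uA := adjU f A nzd.
  have th : tang h (\adj (colsub f A) *m A).
    move=> r v; have := w0 (inr (f, r, (\det (colsub f A))^-1 *: v)).
    by rewrite /= /tangency_form /= E ev_rowsub contraction_wedge scalerA mulfV // scale1r.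
  rewrite -(mulKmx uA A); apply: tang_row_equiv => //; first by rewrite unitmx_inv.
  by rewrite wedge_mul_det scaler_eq0 negb_or nz andbT -unitfE -unitmxE.
case=> [y|[[f r] v]] /=; first by rewrite E pluecker_form_wedge.
rewrite /tangency_form /= E ev_rowsub contraction_wedge.
have [->|nzd] := eqVneq (\det (colsub f A)) 0.
  by rewrite scale0r ev_setrow0.
by apply: tang_row_equiv th _ _ => //; [exact: adjU | rewrite -E].
Qed.

(** When the singular locus of the section is irreducible, it is its only
    component. *)
Lemma contact_locusE r h (t : 'M[K]_(r, N)) i : irreducible_closed (tangency_locus h) ->
  tangency_locus h (row i t) -> contact_locus G h t = tangency_locus h.
Proof.
rewrite /contact_locus sing_sectionE => irr ti; set Z := tangency_locus h in irr ti *.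
apply/seteqP; split=> [x [C [[_ sub _] _ Cx]]|x Zx]; first exact: sub.
exists Z; split=> //; last by exists i.
by split=> // D _ sDZ sZD; apply/seteqP.
Qed.

End SingularLocus.

(** * The contact locus *)

Section ContactLocus.
Variables (K : numClosedFieldType).
Local Notation N := (pluecker_dim 3 8).
Local Notation G := (grassmannian K 3 8).
Local Notation e i := (bv K 8 i).
Local Notation base := (base K).
Local Notation split_form := (split_form K).
Implicit Types (A : 'M[K]_(3, 8)) (h w : 'rV[K]_N).

Local Notation i0 := (ord0 : 'I_3).
Local Notation i1 := (lift ord0 ord0 : 'I_3).

Lemma base_split i r c : i != ord_max -> base i r c = (pivot i r == c)%:R.
Proof.
elim/ord3P: i => // _; elim/ord3P: r; rewrite /base /= rows_ofE /= mxE -val_eqE /= inordK //;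
  by rewrite eq_sym.
Qed.

Lemma mul_base_split i A : i != ord_max -> A *m (base i)^T = colsub (pivot i) A.
Proof.
move=> ni; apply/matrixP=> r c; rewrite [RHS]mxE mxE (bigD1 (pivot i c)) //=.
rewrite mxE base_split // eqxx mulr1 big1 ?addr0 // => l ne.
by rewrite mxE base_split // eq_sym (negPf ne) mulr0.
Qed.

Lemma base_split_ortho i j : i != ord_max -> j != ord_max -> i != j -> base i *m (base j)^T = 0.
Proof.
move=> ni nj ne; rewrite mul_base_split //; apply/matrixP=> r c; rewrite mxE base_split // mxE.
elim/ord3P: i ni ne => // _; elim/ord3P: j nj => // _ _;
  by elim/ord3P: r; elim/ord3P: c; rewrite /pivot /= -val_eqE /= !inordK.
Qed.

Lemma ev_split_form A :
  ev split_form A = \det (colsub (pivot i0) A) + \det (colsub (pivot i1) A).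
Proof.
rewrite /split_form evD !ev_wedge -det_tr -[X in _ + X]det_tr !trmx_mul !trmxK.
by rewrite !mul_base_split.
Qed.

Lemma det_setrow0 n (M : 'M[K]_n) r : \det (setrow M r 0) = 0.
Proof. by rewrite det_setrow big1 // => j _; rewrite mxE mul0r. Qed.

(** A vector replacing a row of A may be supported in one block, so that the two
    determinants are tested separately; the derivatives of the determinant of a
    block are its cofactors. *)
Lemma tang_split_form A : tang split_form A <->
  rank_one (colsub (pivot i0) A) /\ rank_one (colsub (pivot i1) A).
Proof.
have S i r v : i != ord_max ->
    colsub (pivot i) (setrow A r v) = setrow (colsub (pivot i) A) r (v *m (base i)^T).
  by move=> ni; rewrite -!mul_base_split // setrow_mul.
split=> [th|[rk0 rk1] r v]; last first.
  by rewrite ev_split_form !S // !det_setrow_rank_one // addr0.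
split; apply: rank_one_det_setrow => r u.
  have := th r (u *m base i0); rewrite ev_split_form !S // -!mulmxA.
  by rewrite (@base_split_ortho i0 i1) // mul_base_split // base_pivot mulmx0 mulmx1 det_setrow0 addr0.
have := th r (u *m base i1); rewrite ev_split_form !S // -!mulmxA.
by rewrite (@base_split_ortho i1 i0) // mul_base_split // base_pivot mulmx0 mulmx1 det_setrow0 add0r.
Qed.

(** The 3 x 8 matrices whose first two 3 x 3 blocks have rank at most one. *)
Definition rank_one_blocks (s : 'I_6 * 'I_3 -> K) : 'M[K]_(3, 8) :=
  let x i r := s (inord i, r) in let y i j := x i (inord j) in
  \matrix_(r, c) [:: x 0%N r * y 1%N 0%N; x 0%N r * y 1%N 1%N; x 0%N r * y 1%N 2%N; x 2%N r * y 3%N 0%N;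
    x 2%N r * y 3%N 1%N; x 2%N r * y 3%N 2%N; x 4%N r; x 5%N r]`_c.

Lemma rank_one_blocksP A : rank_one (colsub (pivot i0) A) /\ rank_one (colsub (pivot i1) A) <->
  exists s, A = rank_one_blocks s.
Proof.
split=> [[[u [v Eu]] [u' [v' Eu']]]|[s ->]].
  exists (fun x : 'I_6 * 'I_3 => [:: u x.2 0; v 0 x.2; u' x.2 0; v' 0 x.2; A x.2 (inord 6); A x.2 (inord 7)]`_(val x.1)).
  have E (i j : 'I_3) (z : 'cV_3) (w : 'rV_3) (r : 'I_3) (a : nat) (lta : (a < 8)%N) :
      colsub (pivot i) A = z *m w -> nth 0%N (nth [::] pivots i) j = a ->
      A r (Ordinal lta) = z r 0 * w 0 (inord j).
    move=> /matrixP/(_ r j) Ez Ea; rewrite inord_val; move: Ez; rewrite [RHS]mxE big_ord1 => <-.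
    by rewrite mxE; congr (A _ _); apply/val_inj; rewrite /pivot /= inordK Ea.
  apply/matrixP=> r; case=> [[|[|[|[|[|[|[|[|//]]]]]]]] ltc]; rewrite mxE /= !inordK //=.
  - exact: (E i0 ord0 _ _ _ _ _ Eu).
  - exact: (E i0 i1 _ _ _ _ _ Eu).
  - exact: (E i0 ord_max _ _ _ _ _ Eu).
  - exact: (E i1 ord0 _ _ _ _ _ Eu').
  - exact: (E i1 i1 _ _ _ _ _ Eu').
  - exact: (E i1 ord_max _ _ _ _ _ Eu').
  - by congr (A _ _); apply/val_inj; rewrite /= inordK.
  - by congr (A _ _); apply/val_inj; rewrite /= inordK.
split; [exists (\col_r s (inord 0, r)), (\row_c s (inord 1, c))
  | exists (\col_r s (inord 2, r)), (\row_c s (inord 3, c))];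
  apply/matrixP=> r; elim/ord3P; rewrite [RHS]mxE big_ord1 !mxE /pivot /= inordK //=;
  by congr (_ * s (_, _)); apply/val_inj; rewrite /= inordK.
Qed.

Section Orbit.
Variable P : 'M[K]_8.
Hypothesis uP : P \in unitmx.
Local Notation Z := (@tangency_locus K 2 5 (split_form *m compound 3 P)).
Local Notation g := (invmx P^T).

Let ug : g \in unitmx. Proof. by rewrite unitmx_inv unitmx_tr. Qed.

Let phi s : 'rV[K]_N := wedge (rank_one_blocks s *m g).

Let tangency_locusE : Z = [set w | w != 0 /\ exists s, w = phi s].
Proof.
have uPT : P^T \in unitmx by rewrite unitmx_tr.
apply/seteqP; split=> w [nz].
  case=> A E /(tang_mulmx _ _ uP)/tang_split_form/rank_one_blocksP[s Es]; split=> //.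
  by exists s; rewrite /phi -Es mulmxK.
case=> s E; split=> //; exists (rank_one_blocks s *m g) => //.
apply/(tang_mulmx _ _ uP); rewrite mulmxKV //; apply/tang_split_form/rank_one_blocksP.
by exists s.
Qed.

Definition contact_pivot (r : 'I_3) : 'I_8 := inord (3 * r).

Local Notation E := (rowsub contact_pivot 1%:M : 'M[K]_(3, 8)).

(** The normal form has rows (1, x, x, 0, 0, 0, 0, x), (0, 0, 0, 1, x, x, 0, x)
    and (0, 0, 0, 0, 0, 0, 1, x). *)
Definition contact_entry : pred ('I_1 * 'I_3 * 'I_8) := fun x =>
  (val x.1.2, val x.2) \in [:: (0, 1); (0, 2); (0, 7); (1, 4); (1, 5); (1, 7); (2, 7)]%N.

Lemma card_contact_entry : #|{: {x | contact_entry x}}| = 7%N.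
Proof.
rewrite card_sig -sum1_card big_mkcond /=.
rewrite -(pair_bigA _ (fun p c => if (p, c) \in contact_entry then 1 else 0)%N) /=.
rewrite -(pair_bigA _ (fun i r => \sum_(c < 8) if (i, r, c) \in contact_entry then 1 else 0)%N) /=.
by rewrite !big_ord_recl !big_ord0 /in_mem /= /contact_entry /=.
Qed.

Let psi := chart_sum (fun _ => E) g (a := contact_entry).
Let s0 := chart_origin (fun _ => E) (a := contact_entry).

Let val_pivot r : contact_pivot r = (3 * r)%N :> nat.
Proof. by elim/ord3P: r; rewrite inordK. Qed.

Let EE : E *m E^T = 1%:M.
Proof.
apply/matrixP=> i j; rewrite mxE (bigD1 (contact_pivot i)) //= !mxE eqxx mul1r.
rewrite big1 => [|l ne]; last by rewrite !mxE eq_sym (negPf ne) mul0r.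
rewrite addr0 -(inj_eq val_inj) /= !val_pivot eqn_mul2l /= eq_sym.
by [].
Qed.

Let E_entry (i : 'I_1) (r : 'I_3) (c : 'I_8) (r' : 'I_3) : contact_entry (i, r, c) -> E r' c = 0.
Proof.
rewrite !mxE -(inj_eq val_inj) /= val_pivot /contact_entry /=.
case: c => [[|[|[|[|[|[|[|[|//]]]]]]]] ltc]; elim/ord3P: r => // _; by elim/ord3P: r'.
Qed.

Let framed_contact : framed psi (chart_dsum (fun _ => E) g (a := contact_entry)) s0.
Proof. exact: (framed_chart EE E_entry ug). Qed.

Let chart_blocks u : exists s, chart (fun _ => E) (a := contact_entry) u ord0 = rank_one_blocks s :> 'M_(3, 8).
Proof.
set A := chart (a := contact_entry) _ _ _.
have A0 r c : ~~ contact_entry (ord0, r, c) -> A r c = E r c by move=> nf; rewrite mxE insubN.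
apply/rank_one_blocksP.
pose d i : 'cV[K]_3 := \col_r (r == i)%:R.
split; [exists (d i0), (row i0 (colsub (pivot i0) A)) | exists (d i1), (row i1 (colsub (pivot i1) A))];
  apply/matrixP=> r c; rewrite [RHS]mxE big_ord1 [d _ _ _]mxE ![row _ _ _ _]mxE;
  case: eqP => [->|ne]; rewrite ?mul1r // mul0r mxE A0 ?mxE -?(inj_eq val_inj) /= ?val_pivot;
  move: ne; elim/ord3P: r => // _; elim/ord3P: c; rewrite ?/contact_entry /pivot /= inordK //.
Qed.

Let param_contact : param psi Z.
Proof.
pose o i r : 'I_6 * 'I_3 := (inord i, inord r).
pose t0 (x : 'I_6 * 'I_3) : K := (((val x.1, val x.2) \in
  [:: (0, 0); (1, 0); (2, 1); (3, 0); (4, 2)]%N))%:R.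
have Et0 : rank_one_blocks t0 = E.
  apply/matrixP; elim/ord3P; case=> [[|[|[|[|[|[|[|[|//]]]]]]]] ltc];
    rewrite !mxE /= /t0 /= !inordK //= -(inj_eq val_inj) /= val_pivot ?mulr0 ?mul0r ?mulr1 //.
have nz0 : phi t0 != 0.
  rewrite /phi Et0 wedge_mulmx_neq0 //; apply: (wedge_neq0_colsub (f := contact_pivot)).
  rewrite (_ : colsub _ _ = 1%:M) ?det1 ?oner_neq0 //.
  by apply/matrixP=> i j; rewrite !mxE -(inj_eq val_inj) /= !val_pivot eqn_mul2l.
have par : param phi Z.
  rewrite -(proj_closure_id (@tangency_locus_closed K 2 5 _)) tangency_locusE.
  exact: param_image nz0.
have pblocks r c : polyfun (fun s => rank_one_blocks s r c).
  under eq_fun do rewrite mxE.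
  case: c => [[|[|[|[|[|[|[|[|//]]]]]]]] ltc] /=; by do ?apply: polyfunM; apply: polyfun_var.
pose D s := s (o 1%N 0%N) * s (o 3%N 0%N) * \det (colsub contact_pivot (rank_one_blocks s)).
apply: (@param_cover _ _ _ _ phi psi Z D t0 par).
- move=> j; apply: polyfun_wedge => r c; apply: polyfun_mulmx => // r' c'.
  exact: polyfun_cst.
- by move=> u; have [s Es] := chart_blocks u; exists s; rewrite /psi chart_sum1 Es.
- apply: polyfunM; first by apply: polyfunM; apply: polyfun_var.
  by apply: polyfun_det => r c; under eq_fun do rewrite mxE.
- rewrite /D Et0 (_ : colsub _ _ = 1%:M) ?det1 ?mulr1.
    by rewrite /t0 /= !inordK //= mulr1 oner_neq0.
  by apply/matrixP=> i j; rewrite !mxE -(inj_eq val_inj) /= !val_pivot eqn_mul2l.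
move=> s; rewrite /D !mulf_eq0 !negb_or => /andP[/andP[nz1 nz3] nzd].
set C := colsub _ _ in nzd; have uC : C \in unitmx by rewrite unitmxE unitfE.
pose B := invmx C *m rank_one_blocks s.
have BP r l : B r (contact_pivot l) = (r == l)%:R.
  have : colsub contact_pivot B = 1%:M.
    by rewrite -(mulVmx uC); apply/matrixP=> r' c'; rewrite !mxE; apply: eq_bigr => j _; rewrite !mxE.
  by move/matrixP/(_ r l); rewrite !mxE.
have prop (a b : K) (c c' : 'I_8) : (forall r, a * rank_one_blocks s r c = b * rank_one_blocks s r c') ->
    forall r, a * B r c = b * B r c'.
  by move=> Er r; rewrite !mxE !mulr_sumr; apply: eq_bigr => l _; rewrite mulrCA Er mulrCA.
(* In a block of rank one each column is a multiple of the first one. *)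
have blk0 (c : 'I_8) : (val c < 3)%N -> exists b, forall r,
    s (o 1%N 0%N) * rank_one_blocks s r c = b * rank_one_blocks s r (contact_pivot i0).
  move=> ltc; exists (s (o 1%N (val c))) => r; rewrite !mxE val_pivot /=.
  by case: c ltc => [[|[|[|//]]] ltc] _; rewrite /o /=; ring.
have blk1 (c : 'I_8) : (2 < val c < 6)%N -> exists b, forall r,
    s (o 3%N 0%N) * rank_one_blocks s r c = b * rank_one_blocks s r (contact_pivot i1).
  move=> ltc; exists (s (o 3%N (val c - 3)%N)) => r; rewrite !mxE val_pivot /=.
  by case: c ltc => [[|[|[|[|[|[|//]]]]]] ltc] _ //; rewrite /o /=; ring.
have EB : chart (fun _ => E) (chart_origin (fun _ => B) (a := contact_entry)) = (fun _ => B).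
  apply: chart_fill => i r c; rewrite (ord1 i) => nf; rewrite [RHS]mxE [RHS]mxE.
  have piv l : c = contact_pivot l -> B r c = (contact_pivot r == c)%:R.
    by move=> ->; rewrite BP -[in RHS](inj_eq val_inj) /= !val_pivot eqn_mul2l.
  have zero l a b : a != 0 -> r != l ->
      (forall r', a * rank_one_blocks s r' c = b * rank_one_blocks s r' (contact_pivot l)) -> B r c = 0.
    move=> nza ne /prop/(_ r); rewrite BP (negPf ne) mulr0 => /eqP.
    by rewrite mulf_eq0 (negPf nza) => /eqP.
  have [ltc|gec] := ltnP c 3.
    have [b Eb] := blk0 c ltc; have [c0|nzc] := eqVneq (val c) 0%N.
      by apply: (piv i0); apply/val_inj; rewrite /= val_pivot.
    have ne : r != i0.
      apply: contraNneq nf => ->; rewrite /contact_entry /=.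
      by case: (c) ltc nzc => [[|[|[|//]]]].
    rewrite (zero i0 _ b nz1 ne Eb) -(inj_eq val_inj) /= val_pivot.
    by case: (r) ne (c) ltc => [[|[|[|//]]] ?] //= _ [[|[|[|//]]] ?].
  have [ltc|gec'] := ltnP c 6.
    have [b Eb] := blk1 c (introT andP (conj gec ltc)); have [c0|nzc] := eqVneq (val c) 3%N.
      by apply: (piv i1); apply/val_inj; rewrite /= val_pivot.
    have ne : r != i1.
      apply: contraNneq nf => ->; rewrite /contact_entry /=.
      by case: (c) gec ltc nzc => [[|[|[|[|[|[|//]]]]]]].
    rewrite (zero i1 _ b nz3 ne Eb) -(inj_eq val_inj) /= val_pivot.
    by case: (r) ne (c) gec ltc nzc => [[|[|[|//]]] ?] //= _ [[|[|[|[|[|[|//]]]]]] ?].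
  apply: (piv ord_max); apply/val_inj; rewrite /= val_pivot.
  case: (c) gec' nf => [[|[|[|[|[|[|[|[|//]]]]]]]] ltc] //= _.
  by elim/ord3P: (r).
exists (\det C), (chart_origin (fun _ => B) (a := contact_entry)).
by rewrite /psi chart_sum1 EB /B -mulmxA wedge_mul_det scalerA det_inv mulfV // scale1r.
Qed.

(** General rank one blocks are brought to the normal form by row operations. *)
Lemma tangency_locus_dim : has_dim Z 7.
Proof.
have := (has_dim_param (@polymap_chart_sum _ _ _ _ _ _ _) (@multiaffine_chart _ _ _ _ _ _ _)
  framed_contact (@tangency_locus_closed K 2 5 _) param_contact).
by rewrite card_contact_entry.
Qed.

Lemma tangency_locus_irreducible : irreducible_closed Z.
Proof.
apply: (irreducible_param (@polymap_chart_sum _ _ _ _ _ _ _) param_contact).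
  exact: tangency_locus_closed.
exists (psi s0); apply: param_mem param_contact _; first exact: tangency_locus_closed.
have [u Hu] := framed_contact; have := Hu None None.
rewrite eqxx /= /pairing => Hu0; apply/eqP => E0; move: Hu0; rewrite big1 => [/eqP|j _].
  by rewrite eq_sym oner_eq0.
by rewrite E0 mxE mul0r.
Qed.

End Orbit.

End ContactLocus.

(** * Families of tangent hyperplanes *)

Section Transport.
Variables (K : numFieldType) (n : nat).
Implicit Types (X : set 'rV[K]_n) (h x : 'rV[K]_n) (L : 'M[K]_n).

(** Points and hyperplanes are moved by contragredient matrices. *)
Lemma tangent_at_mulmx X h x L : L \in unitmx -> stable X L^T ->
  tangent_at X h x -> tangent_at X (h *m L) (x *m invmx L^T).
Proof.
move=> uL st th v /(tangent_space_mulmx st); rewrite mulmxKV ?unitmx_tr // => /th.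
by move=> E; change (pairing (h *m L) v = 0); rewrite pairing_mulmx.
Qed.

(** A hyperplane tangent at one point, even a special one, spreads to a
    polynomial family of conormal vectors along X: the coefficients of the
    gradients are kept constant. *)
Lemma conormal_family X h x : tangent_at X h x -> exists H : 'I_n -> {mpoly K[n]},
  (forall i, (H i).@[x 0] = h 0 i) /\
  forall y : 'rV[K]_n, tangent_at X (\row_i (H i).@[y 0]) y.
Proof.
move=> /conormal_gradients[m [q [c [qX Eh]]]].
exists (fun i => \sum_j c j *: (q j)^`M(i)); split=> [i|y v Tv].
  by rewrite Eh raddf_sum; apply: eq_bigr => j _; rewrite /= mevalZ.
change (pairing (\row_i (\sum_j c j *: (q j)^`M(i)).@[y 0]) v = 0); rewrite /pairing.
under eq_bigr do rewrite mxE raddf_sum mulr_suml.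
rewrite exchange_big big1 //= => j _.
under eq_bigr do rewrite /= mevalZ -mulrA.
by rewrite -mulr_sumr; have [hq qj] := qX j; rewrite (Tv _ hq qj) mulr0.
Qed.

(** Polynomials that vanish outside of the origin vanish identically. *)
Lemma indep_nonzero : (0 < n)%N -> indep [set x : 'rV[K]_n | x != 0] n.
Proof.
move=> n0; exists (fun i => 'X_i) => [i|P P0]; first by exists 1%N; rewrite dhomogX /= mdeg1.
have EP v : (msubst (fun i => 'X_i) P).@[v] = P.@[v].
  by rewrite meval_msubst; apply: meval_eq => i; rewrite mevalXU.
pose i0 := Ordinal n0; apply/eqP; have : P * 'X_i0 == 0.
  apply/eqP/meval_eq0 => v; rewrite mevalM mevalXU.
  have [->|nzv] := eqVneq (v i0) 0; first by rewrite mulr0.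
  have : (\row_i v i : 'rV[K]_n) != 0 by apply: contra_neq nzv => /rowP/(_ i0); rewrite !mxE.
  move/P0; rewrite EP (meval_eq (v2 := v)) => [->|i]; first by rewrite mul0r.
  by rewrite mxE.
rewrite mulf_eq0 => /orP[//|/eqP/(congr1 (meval (fun=> 1)))].
by rewrite mevalXU meval0 => /eqP; rewrite oner_eq0.
Qed.

End Transport.

(** * The dual of the third secant variety *)

Section Duality.
Variables (K : numClosedFieldType).
Local Notation N := (pluecker_dim 3 8).
Local Notation G := (grassmannian K 3 8).
Local Notation e i := (bv K 8 i).
Local Notation base := (base K).
Local Notation split_form := (split_form K).
Local Notation secant r := (secant_variety r G).
Implicit Types (h x y : 'rV[K]_N).

Definition split_pair (i : 'I_2) : 'M[K]_(3, 8) := base (widen_ord (isT : 2 <= 3)%N i).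

Lemma split_formE : split_form = wedge_sum split_pair.
Proof.
rewrite /wedge_sum !big_ord_recl big_ord0 addr0 /split_form /split_pair.
by congr (wedge (base _) + wedge (base _)); apply/val_inj.
Qed.

Lemma vanishes_split_form (p : {mpoly K[N]}) P : homogeneous p -> vanishes p (secant 2) ->
  p.@[(split_form *m compound 3 P) 0] = 0.
Proof.
move=> hp pS; rewrite split_formE -wedge_sum_mulmx.
by apply: (@vanishes_secant _ _ _ _ split_pair) hp pS; rewrite -split_formE split_form_neq0.
Qed.

Lemma polyfun_hyperdet (T : finType) (w : (T -> K) -> 'rV[K]_N) :
  (forall i, polyfun (fun s => w s 0 i)) -> polyfun (fun s => hyperdet (w s)).
Proof.
move=> pw; rewrite /hyperdet /pencil_disc /det22 /coef6 /coef7 /tri.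
have pe B : polyfun (fun s => ev (w s) B) by apply: polyfun_ev => // r c; apply: polyfun_cst.
by repeat (first [exact: pe | exact: polyfun_cst | apply: polyfunB | apply: polyfunD
  | apply: polyfunM | apply: polyfunX]).
Qed.

Lemma hyperdet0 : hyperdet (0 : 'rV[K]_N) = 0.
Proof.
have c0 i j : coef7 (0 : 'rV[K]_N) i j = 0 by rewrite /coef7 /tri -(scale0r 0) evZ mul0r.
by rewrite /hyperdet /pencil_disc /det22 !c0 mulr0 subrr mul0r.
Qed.

(** On the line from y to a hyperplane with nonzero hyperdeterminant, all but
    finitely many points are sums of two decomposable forms. *)
Lemma vanishes_conormal_base (p : {mpoly K[N]}) y : homogeneous p -> vanishes p (secant 2) ->
  (forall i, tang y (base i)) -> p.@[y 0] = 0.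
Proof.
move=> hp pS ty; pose w (s : unit -> K) := (1 - s tt) *: y + s tt *: hyper_witness K.
have pw i : polyfun (fun s => w s 0 i).
  under eq_fun do rewrite mxE !rowZE.
  by apply: polyfunD; apply: polyfunM; [apply: polyfunB| | |]; do ?[exact: polyfun_var|exact: polyfun_cst].
have nz1 : hyperdet (w (fun=> 1)) != 0.
  by rewrite /w subrr scale0r add0r scale1r hyperdet_witness.
have E0 : w (fun=> 0) = y by rewrite /w subr0 scale1r scale0r addr0.
rewrite -E0.
apply: (polyfun_eq0 (@polyfun_meval _ _ _ p (fun i s => w s 0 i) pw) (polyfun_hyperdet pw) nz1) => s nzs.
have [|P _ ->] := conormal_split _ nzs; last exact: vanishes_split_form.
by move=> i; apply: tangD; apply: tangZ => //; apply: tang_hyper_witness.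
Qed.

Lemma tang_base_mulmx h (A : 'M[K]_(3, 8)) g i : g \in unitmx -> wedge A != 0 ->
  wedge A = wedge (base i *m g) -> tang h A <-> tang (h *m compound 3 g^T) (base i).
Proof.
move=> ug nzA EA; have nzB : wedge (base i *m g) != 0 by rewrite -EA.
have [_ tA] := @grassmannian_tangent K 2 5 A nzA.
have [_ tB] := @grassmannian_tangent K 2 5 _ nzB.
have tM := tang_mulmx h (base i) (_ : g^T \in unitmx); rewrite trmxK unitmx_tr in tM.
split=> [/tA|/(tM ug)/tB]; first by rewrite EA => /tB/(tM ug).
by rewrite -EA => /tA.
Qed.

Lemma vanishes_conormal (p : {mpoly K[N]}) h (A : 'I_3 -> 'M[K]_(3, 8)) g : g \in unitmx ->
  (forall i, wedge (A i) = wedge (base i *m g)) -> homogeneous p -> vanishes p (secant 2) ->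
  (forall i, tang h (A i)) -> p.@[h 0] = 0.
Proof.
move=> ug EA hp pS th; have uT : g^T \in unitmx by rewrite unitmx_tr.
have [q hq Eq] := form_mulmx (compound 3 (invmx g^T)) hp.
have <- : q.@[(h *m compound 3 g^T) 0] = p.@[h 0].
  by rewrite Eq -mulmxA -compoundM mulmxV // compound1 mulmx1.
apply: vanishes_conormal_base => // [y Sy|i].
  by rewrite Eq; apply: pS; apply: (stable_secant (k := 2)) => //; rewrite unitmx_inv.
by apply/(tang_base_mulmx _ ug _ (EA i)) => //; rewrite EA base_mulmx_neq0.
Qed.

Lemma polyfun_triple (F : {mpoly K[3 * N]}) :
  polyfun (fun s : 'I_3 * 'I_3 * 'I_8 -> K => F.@[mxvec (\matrix_i wedge (mats_of s i)) 0]).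
Proof.
apply: (@polyfun_meval _ _ _ _ (fun j s => mxvec (\matrix_i wedge (mats_of s i)) 0 j)) => j.
case/mxvec_indexP: j => i j; under eq_fun do rewrite mxvecE mxE.
by apply: polyfun_wedge => r c; apply: polyfun_mats_of.
Qed.

(** Let p be a form vanishing on the second secant variety, and H a polynomial
    family of conormal vectors through the given one. At a general sum of three
    decomposable tensors H is tangent along the three planes, so that p composed
    with H vanishes there, hence on the whole of the third secant variety,
    whatever the point of tangency. *)
Lemma dual_secant3_sub : dual_variety (secant 3) `<=` secant 2.
Proof.
rewrite [X in _ `<=` X]secant_varietyE => h [nzh ph]; split=> // p hp pX; apply: ph => // h0 [nzh0 [x0 [sm th]]].
have pS : vanishes p (secant 2) by rewrite secant_varietyE; apply: vanishes_closure.
have [H [EH tH]] := conormal_family th; pose Rp := msubst H p.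
have ER x : Rp.@[x 0] = p.@[(\row_i (H i).@[x 0]) 0].
  by rewrite meval_msubst; apply: meval_eq => i; rewrite mxE.
have [F [nzF HF]] := general_triple K.
have R0 (A : 'I_3 -> 'M[K]_(3, 8)) : Rp.@[wedge_sum A 0] = 0.
  have pf := @polyfun_meval _ _ _ Rp (fun i s => wedge_sum (mats_of s) 0 i)
    (@polymap_wedge_sum K 3 2 8).
  rewrite -(mats_ofK A); apply: (polyfun_eq0 pf (polyfun_triple F) (a := of_mats base)).
    by rewrite mats_ofK.
  move=> s /HF[g ug Eg]; rewrite ER.
  apply: (vanishes_conormal ug Eg hp pS).
  exact: (tangent_at_secant_tang (wedge_sum_base_neq0 K) (tH _)).
pose X3 := [set x : 'rV[K]_N | x != 0 /\ exists A : 'I_3 -> 'M[K]_(3, 8), x = wedge_sum A].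
have cX3 : cone X3.
  move=> x c [nzx [A EA]] nzc; split; first by rewrite scaler_eq0 negb_or nzc.
  exists (fun i => setrow (A i) ord0 (c *: row ord0 (A i))).
  by rewrite EA scaler_sumr; apply: eq_bigr => i _; rewrite wedge_setrowZ.
have RX : vanishes Rp X3 by move=> _ [_ [A ->]].
have -> : h0 = \row_i (H i).@[x0 0] by apply/rowP=> i; rewrite mxE EH.
rewrite -ER; apply: meval_sum_pihomog => d.
have : vanishes (pihomog mdeg d Rp) (secant 3).
  rewrite secant_varietyE; apply: vanishes_closure; first by exists d; apply: pihomogP.
  exact: vanishes_pihomog.
by apply; case: sm.
Qed.

(** The hyperplanes of this shape form one orbit, which contains the one tangent
    at the base point. *)
Lemma split_form_conormal P : P \in unitmx -> split_form *m compound 3 P != 0 /\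
  exists x, smooth_point (secant 3) x /\ tangent_at (secant 3) (split_form *m compound 3 P) x.
Proof.
move=> uP; split.
  apply: contra_neq (split_form_neq0 K) => E0.
  by rewrite -(mulmxK (compound_unit 3 uP) split_form) E0 mul0mx.
have [P0 uP0 E0] := conormal_split (@tang_hyper_witness K) (hyperdet_witness K).
have [sm tan] := secant3_base K; have {}tan := tan _ (@tang_hyper_witness K).
pose Q := invmx P0 *m P; have uQ : Q \in unitmx by rewrite unitmx_mul unitmx_inv uP0.
have uQT : Q^T \in unitmx by rewrite unitmx_tr.
have -> : split_form *m compound 3 P = hyper_witness K *m compound 3 Q.
  by rewrite E0 -mulmxA -compoundM mulKVmx.
exists (wedge_sum base *m invmx (compound 3 Q)^T); split.
  apply: smooth_point_mulmx => //; rewrite -compoundT.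
  - by rewrite unitmx_inv; apply: compound_unit.
  - by rewrite -compoundV //; apply: stable_secant; rewrite unitmx_inv.
  - by rewrite invmxK; apply: stable_secant.
apply: tangent_at_mulmx => //; first exact: compound_unit.
by rewrite -compoundT; apply: stable_secant.
Qed.

(** The first two planes of the base triple are sent to any two planes by this
    matrix, which is invertible for general planes. *)
Definition pair_stack (A : 'I_2 -> 'M[K]_(3, 8)) : 'M[K]_8 :=
  let r i j : 'rV[K]_8 := row (inord j) (A (inord i)) in
  rows_of 8 [:: r 0 0; r 0 1; r 0 2; r 1 0; r 1 1; r 1 2; e 6; e 7]%N.

Lemma split_pair_stack A i : split_pair i *m pair_stack A = A i.
Proof.
rewrite /split_pair base_mulmx [RHS]rows_of3.
case: i => [[|[|//]] lti] /=; congr (rows_of 3 [:: row _ (A _); row _ (A _); row _ (A _)]);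
  by apply/val_inj; rewrite /= inordK.
Qed.

Lemma pair_stack_split : pair_stack split_pair = 1%:M.
Proof.
rewrite -(rows_of_bv K) /pair_stack /split_pair.
have E i j k : (i < 2)%N -> (j < 3)%N -> k = (3 * i + j)%N ->
    row (inord j) (base (widen_ord (isT : 2 <= 3)%N (inord i))) = e k.
  move=> lti ltj ->; case: i lti => [|[|//]] _; rewrite /base /= inordK // row_rows_of inordK //;
    by case: j ltj => [|[|[|//]]].
rewrite (E 0%N 0%N 0%N) // (E 0%N 1%N 1%N) // (E 0%N 2%N 2%N) //.
by rewrite (E 1%N 0%N 3%N) // (E 1%N 1%N 4%N) // (E 1%N 2%N 5%N).
Qed.

(** General sums of two decomposable forms are in the orbit of hyperplanes
    tangent at smooth points. *)
Lemma sub_dual_secant3 : secant 2 `<=` dual_variety (secant 3).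
Proof.
rewrite secant_varietyE => h [nzh ph]; split=> // p hp pD; apply: ph => // _ [_ [A ->]].
have pf := @polyfun_meval _ _ _ p (fun i s => wedge_sum (mats_of s) 0 i) (@polymap_wedge_sum K 2 2 8).
have pg : polyfun (fun s => \det (pair_stack (mats_of s))).
  apply: polyfun_det => r c; under eq_fun do rewrite rows_ofE.
  by case: r => [[|[|[|[|[|[|[|[|//]]]]]]]] ltr] /=; under eq_fun do rewrite mxE;
    do ?[exact: polyfun_mats_of | exact: polyfun_cst].
rewrite -(mats_ofK A); apply: (polyfun_eq0 pf pg (a := of_mats split_pair)).
  by rewrite mats_ofK pair_stack_split det1 oner_neq0.
move=> s nzd; set B := mats_of s in nzd *.
have -> : wedge_sum B = split_form *m compound 3 (pair_stack B).
  rewrite split_formE -wedge_sum_mulmx; congr wedge_sum; apply/funext => i.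
  by rewrite split_pair_stack.
apply: pD; apply: split_form_conormal; by rewrite unitmxE unitfE.
Qed.

(** The third secant variety has dimension at most 47, while the Grassmannian
    spans the whole projective space of dimension 55. *)
Lemma secant3_proper : secant 3 `<` linear_span G.
Proof.
have spanE : linear_span G = [set x | x != 0].
  apply/seteqP; split=> [x []//|x nzx]; split=> //.
  exists N, 1%:M; split=> [s|]; last exact: submx1.
  rewrite row1 -wedge_std; split; last by eexists.
  rewrite wedge_std; apply/eqP => /rowP/(_ s); rewrite !mxE !eqxx => /eqP.
  by rewrite oner_eq0.
rewrite spanE; split=> [x []//|sub].
have := secant3_indep (indep_sub sub (indep_nonzero K (_ : 0 < N)%N)).
by rewrite !pluecker_dimE; move/(_ isT).
Qed.

(** The general points are the triples in the orbit of the base triple, and the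
    general tangent hyperplanes are those with nonzero hyperdeterminant in
    adapted coordinates; their contact loci are all equivalent. *)
Lemma general_contact_locus3 : general_contact_locus 3 G (fun Z => has_dim Z 7).
Proof.
have [F [nzF HF]] := general_triple K; exists F; split.
  exists (base_point K) => // i; rewrite rowK; split; first exact: base_neq0.
  by exists (base i).
move=> t Gt nzFt; have /choice[A EA] : forall i, exists A : 'M[K]_(3, 8), row i t = wedge A.
  by move=> i; have [_ [A ->]] := Gt i; exists A.
have Et : t = \matrix_i wedge (A i) by apply/row_matrixP=> i; rewrite rowK EA.
have nzA i : wedge (A i) != 0 by have [] := Gt i; rewrite EA.
rewrite {1}Et in nzFt; have [g ug Eg] := HF _ nzFt.
have uT : g^T \in unitmx by rewrite unitmx_tr.
have tanE h i : tangent_at G h (row i t) <-> tang (h *m compound 3 g^T) (base i).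
  by rewrite EA (@grassmannian_tangent K 2 5 _ (nzA i)).2; apply: tang_base_mulmx.
pose y (s : 'I_1 * 'I_N -> K) := (\row_j s (0, j)) *m compound 3 g^T.
have py i : polyfun (fun s => y s 0 i).
  apply: polyfun_mulmx => r c; last exact: polyfun_cst.
  by under eq_fun do rewrite mxE; apply: polyfun_var.
have [F' EF'] := polyfun_mxvec (polyfun_hyperdet py).
have {}EF' h : F'.@[mxvec h 0] = hyperdet (h *m compound 3 g^T).
  by rewrite -EF' /y; congr (hyperdet (_ *m _)); apply/rowP=> j; rewrite mxE.
exists F'; split.
  pose h := hyper_witness K *m compound 3 (invmx g^T).
  have Eh : h *m compound 3 g^T = hyper_witness K.
    by rewrite -mulmxA -compoundM mulVmx // compound1 mulmx1.
  exists h; last by rewrite EF' Eh hyperdet_witness.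
  split=> [|i]; last by apply/tanE; rewrite Eh; apply: tang_hyper_witness.
  apply: contraTneq (hyperdet_witness K) => h0; rewrite -Eh h0 mul0mx negbK.
  by rewrite hyperdet0.
move=> h [nzh th]; rewrite EF' => nzd.
have [|P uP EP] := conormal_split _ nzd; first by move=> i; apply/tanE.
have uP' : P *m invmx g^T \in unitmx by rewrite unitmx_mul uP unitmx_inv.
have Eh : h = split_form *m compound 3 (P *m invmx g^T).
  by rewrite compoundM mulmxA -EP -mulmxA -compoundM mulmxV // compound1 mulmx1.
have Z0 : @tangency_locus K 2 5 h (row ord0 t).
  split; first by rewrite EA.
  exists (A ord0); first exact: EA.
  by apply/(@grassmannian_tangent K 2 5 _ (nzA ord0)).2; rewrite -EA.
have irr : irreducible_closed (@tangency_locus K 2 5 h).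
  by rewrite Eh; apply: tangency_locus_irreducible.
have EC := contact_locusE irr Z0.
by change (has_dim (contact_locus G h t) 7); rewrite [contact_locus _ _ _]EC Eh; apply: tangency_locus_dim.
Qed.

Lemma general_contact_locus_impl r X (P Q : set 'rV[K]_N -> Prop) :
  (forall Z, P Z -> Q Z) -> general_contact_locus r X P -> general_contact_locus r X Q.
Proof.
move=> PQ [F [wF HF]]; exists F; split=> // t Xt nzF.
have [F' [wF' HF']] := HF t Xt nzF; exists F'; split=> // h th nzF'.
exact/PQ/HF'.
Qed.

End Duality.

Theorem proposition1p2 (R : realType) :
  dual_variety (secant_variety 3 (grassmannian R[i] 3 8))
    = secant_variety 2 (grassmannian R[i] 3 8)
  /\ weakly_defective 3 (grassmannian R[i] 3 8)
  /\ general_contact_locus 3 (grassmannian R[i] 3 8) (fun Z => has_dim Z 7).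
Proof.
split; first by apply/seteqP; split; [exact: dual_secant3_sub | exact: sub_dual_secant3].
have dim7 := general_contact_locus3 R[i]; split=> //; split; first exact: secant3_proper.
by apply: general_contact_locus_impl dim7 => Z dimZ; exists 7%N.
Qed.
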